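(* Let $(a,b)\subset\mathbb{R}$ be a bounded open interval, let $p>1$, and let $\psi\colon\mathbb{R}\to(0,+\infty)$ be a bounded Borel function such that $\inf_{t\in K}\psi(t)>0$ for every compact set $K\subset\mathbb{R}$ and $\int_{-\infty}^{+\infty}(\psi(t))^{1/p}\,dt<+\infty$. Let $g\in C^1([a,b])\cap X^p_\psi((a,b))$, and let $\{h_n\}\subset L^\infty((a,b))$ satisfy $h_n\rightharpoonup0$ weakly$^*$ in $L^\infty((a,b))$. For $\lambda>0$ and $n\in\mathbb{N}$ let $\mathcal{A}_{\lambda,n}\subset X^p_\psi((a,b))$ be the class of the solutions to the minimization problem $$\min\Big\{\overline{\mathcal{F}}_p(u)+\lambda\int_a^b|u-g_n|^2\,dx:\ u\in X^p_\psi((a,b))\Big\},\qquad g_n:=g+h_n.$$ Let $C:=\max\{\|g\|_{C^1([a,b])},\overline{\mathcal{F}}_p(g)\}$, and let $\overline\lambda=\overline\lambda(C)>0$ be a number with the following property (such a number exists): for all $\tilde g\in C^1([a,b])\cap X^p_\psi((a,b))$ with $\|\tilde g\|_{C^1([a,b])}\le C$ and $\overline{\mathcal{F}}_p(\tilde g)\le C$, and for all $\lambda\ge\overline\lambda$, every solution of $\min\{\overline{\mathcal{F}}_p(u)+\lambda\int_a^b|u-\tilde g|^2\,dx:\ u\in X^p_\psi((a,b))\}$ belongs to $C^1([a,b])$. Then for all $\lambda\ge\overline\lambda$ we have $\mathcal{A}_{\lambda,n}\subset C^1([a,b])$ for $n$ sufficiently large. Moreover, $$\lim_{\lambda\to\infty}\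 \limsup_{n\to\infty}\ \sup_{u\in\mathcal{A}_{\lambda,n}}\|u-g\|_{C^1([a,b])}=0.$$
   Context: Functions are identified up to $\mathcal{L}^1$-a.e. equality; $\|u-g\|_{C^1([a,b])}$ is understood to be $+\infty$ if $u\notin C^1([a,b])$. For $u\in BV((a,b))$ the distributional derivative $u'$ is a bounded Radon measure with total variation measure $|u'|$; its Lebesgue decomposition is $u'=(u')^a\mathcal{L}^1+(u')^s$, where $(u')^a\in L^1((a,b))$ is the density of the absolutely continuous part and $(u')^s$ the singular part. $M:=\int_{\mathbb{R}}\psi^{1/p}\,dt$, and $\Psi_p\colon[-\infty,+\infty]\to[0,M]$, $\Psi_p(t):=\int_{-\infty}^t(\psi(s))^{1/p}\,ds$. $Z^{\pm}[(u')^a]:=\{x\in(a,b):\lim_{\varepsilon\to0+}\frac1{2\varepsilon}\int_{x-\varepsilon}^{x+\varepsilon}(u')^a\,dx=\pm\infty\}$. $X^p_\psi((a,b))$ is the set of all $u\in BV((a,b))$ such that $v:=\Psi_p\circ(u')^a\in W^{1,p}((a,b))$ and the positive and negative parts $((u')^s)^+$ and $((u')^s)^-$ of the measure $(u')^s$ are concentrated on $Z^+[(u')^a]$ and $Z^-[(u')^a]$, respectively (a measure is concentrated on a set if the complement of the set has measure zero). For $u\in X^p_\psi((a,b))$, with $v:=\Psi_p\circ(u')^a$, $\overline{\mathcal{F}}_p(u):=|u'|((a,b))+\int_a^b|v'|^p\,dx$. *)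

(* Defs.v *)
From HB Require Import structures.
From mathcomp Require Import all_boot all_order all_algebra.
From mathcomp Require Import all_classical all_reals all_analysis.

Set Implicit Arguments.
Unset Strict Implicit.
Unset Printing Implicit Defensive.

Import Order.TTheory GRing.Theory Num.Theory.
Import numFieldNormedType.Exports.

Local Open Scope classical_set_scope.
Local Open Scope ring_scope.

Notation leb R := (@lebesgue_measure R).

(* Charges are finite-valued: on the Borel sets of R they are the bounded signed
   Radon measures. *)
Notation signed_measure R := (charge (measurableTypeR R) R).

HB.instance Definition _ (R : realType) := gen_eqMixin (signed_measure R).
HB.instance Definition _ (R : realType) := gen_choiceMixin (signed_measure R).

(* Elements of function spaces on (a, b) are represented by functions R -> R;
   only their a.e. class on (a, b) matters. *)

Definition Lp (R : realType) (a b : R) (q : \bar R) : set (R -> R) :=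
  [set f : R -> R | measurable_fun `]a, b[ f /\
    (Lnorm (leb R) q ((EFin \o f) \_ `]a, b[) < +oo)%E].

Definition weak_star_to0 (R : realType) (a b : R) (h : nat -> R -> R) : Prop :=
  forall phi : R -> R, (leb R).-integrable `]a, b[ (EFin \o phi) ->
    (\int[leb R]_(x in `]a, b[) (h n x * phi x))%R @[n --> \oo] --> (0 : R).

(* C^1([a, b]): [w] is the continuous representative of [u], and [dw] is its
   derivative in (a, b), extended continuously to [a, b]. *)
Definition C1_representative (R : realType) (a b : R) (u w dw : R -> R) :=
  [/\ {within `[a, b], continuous w},
      {within `[a, b], continuous dw},
      (forall x, x \in `]a, b[ -> is_derive x 1 w (dw x)) &
      {ae leb R, forall x, x \in `]a, b[ -> u x = w x}].

Definition C1 (R : realType) (a b : R) : set (R -> R) :=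
  [set u | exists w dw, C1_representative a b u w dw].

(* [w] and [dw] are determined by [u] on [a, b], so that the infimum is over a
   singleton if [u] is C^1, and over the empty set (hence +oo) otherwise. *)
Definition C1norm (R : realType) (a b : R) (u : R -> R) : \bar R :=
  ereal_inf [set N | exists w dw, C1_representative a b u w dw /\
    N = (ereal_sup [set `|w x|%:E | x in `[a, b]] +
         ereal_sup [set `|dw x|%:E | x in `[a, b]])%E].

(* phi is in C^1_c((a, b)); this class yields the same weak and distributional
   derivatives as C^oo_c((a, b)). *)
Definition test_function (R : realType) (a b : R) (phi : R -> R) :=
  [/\ (forall x, derivable phi x 1), continuous (derive1 phi) &
      exists c d, [/\ a < c, d < b &
        forall x, x \notin `[c, d] -> phi x = 0]].

Definition weak_derivative (R : realType) (a b : R) (v w : R -> R) :=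
  forall phi, test_function a b phi ->
    \int[leb R]_(x in `]a, b[) (v x * derive1 phi x) =
    - \int[leb R]_(x in `]a, b[) (w x * phi x).

Definition W1p (R : realType) (a b p : R) : set (R -> R) :=
  [set v | Lp a b p%:E v /\ exists2 w, Lp a b p%:E w & weak_derivative a b v w].

Definition weak_deriv (R : realType) (a b p : R) (v : R -> R) : R -> R :=
  xget (cst 0) [set w | Lp a b p%:E w /\ weak_derivative a b v w].

(* Jordan decomposition: it does not depend on the chosen Hahn decomposition. *)
Definition hahn_pos (R : realType) (nu : signed_measure R) :
    set (measurableTypeR R) :=
  projT1 (cid (Hahn_decomposition nu)).

Definition hahn_neg (R : realType) (nu : signed_measure R) :
    set (measurableTypeR R) :=
  projT1 (cid (projT2 (cid (Hahn_decomposition nu)))).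

Definition hahnP (R : realType) (nu : signed_measure R) :
    hahn_decomposition nu (hahn_pos nu) (hahn_neg nu) :=
  projT2 (cid (projT2 (cid (Hahn_decomposition nu)))).

Definition pos_part (R : realType) (nu : signed_measure R) :
    {measure set (measurableTypeR R) -> \bar R} := jordan_pos (hahnP nu).

Definition neg_part (R : realType) (nu : signed_measure R) :
    {measure set (measurableTypeR R) -> \bar R} := jordan_neg (hahnP nu).

Definition total_var (R : realType) (nu : signed_measure R) :
    {measure set (measurableTypeR R) -> \bar R} := charge_variation (hahnP nu).

Definition charge_integral (R : realType) (nu : signed_measure R)
    (phi : R -> R) : R :=
  \int[pos_part nu]_x phi x - \int[neg_part nu]_x phi x.

(* A measure on (a, b) is a measure on R that vanishes outside (a, b). *)
Definition distributional_derivative (R : realType) (a b : R) (u : R -> R)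
    (mu : signed_measure R) : Prop :=
  (forall A : set (measurableTypeR R), measurable A ->
     A `<=` ~` `]a, b[ -> mu A = 0%E) /\
  (forall phi, test_function a b phi ->
     \int[leb R]_(x in `]a, b[) (u x * derive1 phi x) = - charge_integral mu phi).

Definition BV (R : realType) (a b : R) : set (R -> R) :=
  [set u | (leb R).-integrable `]a, b[ (EFin \o u) /\
    exists mu, distributional_derivative a b u mu].

Definition Du (R : realType) (a b : R) (u : R -> R) : signed_measure R :=
  xget (czero : signed_measure R) [set mu | distributional_derivative a b u mu].

(* mu = f L^1 + s with s singular with respect to L^1 *)
Definition lebesgue_decomposition (R : realType) (mu : signed_measure R)
    (f : R -> R) (s : signed_measure R) : Prop :=
  [/\ (leb R).-integrable setT (EFin \o f),
      (exists N : set (measurableTypeR R),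
         [/\ measurable N, leb R N = 0%E &
             forall A, measurable A -> A `<=` ~` N -> s A = 0%E]) &
      forall A : set (measurableTypeR R), measurable A ->
        mu A = (\int[leb R]_(x in A) (f x)%:E + s A)%E].

Definition lebesgue_parts (R : realType) (mu : signed_measure R) :
    (R -> R) * signed_measure R :=
  xget (cst 0, czero : signed_measure R) [set fs | lebesgue_decomposition mu fs.1 fs.2].

(* (u')^a and (u')^s *)
Definition Da (R : realType) (a b : R) (u : R -> R) : R -> R :=
  (lebesgue_parts (Du a b u)).1.

Definition Ds (R : realType) (a b : R) (u : R -> R) : signed_measure R :=
  (lebesgue_parts (Du a b u)).2.

(* Z^+[f] for l = +oo and Z^-[f] for l = -oo *)
Definition Zset (R : realType) (a b : R) (f : R -> R) (l : \bar R) : set R :=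
  [set x | (x \in `]a, b[) /\
    ((fun e : R =>
        ((2 * e)^-1 * \int[leb R]_(t in `]x - e, x + e[) f t)%:E) @ 0^'+
     --> l)].

(* "The complement has measure zero"; [negligible] applies to any set. *)
Definition concentrated_on (R : realType)
    (nu : {measure set (measurableTypeR R) -> \bar R}) (Z : set R) : Prop :=
  nu.-negligible (~` Z).

Definition Psi (R : realType) (p : R) (psi : R -> R) (t : \bar R) : R :=
  fine (\int[leb R]_(s in [set s | (s%:E <= t)%E]) (psi s `^ p^-1)%:E).

Definition Psi_Da (R : realType) (a b p : R) (psi u : R -> R) : R -> R :=
  fun x => Psi p psi (Da a b u x)%:E.

Definition X (R : realType) (a b p : R) (psi : R -> R) : set (R -> R) :=
  [set u | [/\ BV a b u,
      W1p a b p (Psi_Da a b p psi u),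
      concentrated_on (pos_part (Ds a b u)) (Zset a b (Da a b u) +oo%E) &
      concentrated_on (neg_part (Ds a b u)) (Zset a b (Da a b u) -oo%E)]].

Definition Fbar (R : realType) (a b p : R) (psi u : R -> R) : \bar R :=
  (total_var (Du a b u) [set` `]a, b[] +
   \int[leb R]_(x in `]a, b[)
     (`|weak_deriv a b p (Psi_Da a b p psi u) x| `^ p)%:E)%E.

Definition functional (R : realType) (a b p : R) (psi : R -> R) (lambda : R)
    (f u : R -> R) : \bar R :=
  (Fbar a b p psi u +
   lambda%:E * \int[leb R]_(x in `]a, b[) (`|u x - f x| ^+ 2)%:E)%E.

Definition minimizers (R : realType) (a b p : R) (psi : R -> R) (lambda : R)
    (f : R -> R) : set (R -> R) :=
  [set u | X a b p psi u /\ forall w, X a b p psi w ->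
    (functional a b p psi lambda f u <= functional a b p psi lambda f w)%E].

(* Supremum in [0, +oo]: the supremum of the empty set is 0. *)
Definition nonneg_sup (R : realType) (S : set (\bar R)) : \bar R :=
  ereal_sup (0%E |` S).

(* Main.v *)
(* Write F for Psi_p. A function u lies in X iff u(x) = c + mu(]-oo, x]) a.e. for a
   bounded measure mu, and F o (u')^a has a representative V = d + int w with w in
   L^p that controls the slopes of u: if V <= F(c) on [x, y] then
   mu(]x, y]) <= c (y - x), and symmetrically from below. These inequalities encode
   the concentration of the singular part on Z^+ and Z^- and pass to limits. Hence,
   if Fbar is bounded along a sequence in X, Helly's theorem and the equicontinuity
   of the V's give a limit u0 in X, with convergence in L^1, lower semicontinuity of
   Fbar and uniform convergence of the V's. If u0 is C^1, its V stays in a compact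
   part of the range of F, so nearby functions of X are C^1 with derivative F^-1(V),
   and they converge to u0 in C^1.

   The h_n are bounded in L^oo, so int (u_n - w) h_n -> 0 whenever u_n converges in
   L^1. For fixed lambda, limits of minimizers u_n thus minimize the problem with
   datum g; they are C^1 by the choice of lambdabar, hence so is u_n for large n.
   Comparing with g gives
     Fbar u + lambda int |u - g|^2 <= Fbar g + 2 lambda int (u - g) h_n,
   where the last term vanishes as n -> oo for fixed lambda; so u is close to g in
   L^1 for large lambda, and therefore in C^1. *)

Require Import Defs.
From HB Require Import structures.
From mathcomp Require Import all_boot all_order all_algebra.
From mathcomp Require Import all_classical all_reals all_analysis.
From mathcomp Require Import measurable_realfun.
From mathcomp Require Import lra.

Set Implicit Arguments.
Unset Strict Implicit.
Unset Printing Implicit Defensive.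

Import Order.TTheory GRing.Theory Num.Theory.
Import numFieldNormedType.Exports.

Local Open Scope classical_set_scope.
Local Open Scope ring_scope.

(** * Distribution functions of charges *)

(** The obstacle is closedness: neither the concentration of the singular part nor the bound on the
    energy visibly survives a limit. Both are recast as inequalities that are linear in increments
    over half-open intervals. For the energy, the tangents of x^p give, for every t >= 0, p t^(p-1)
    |V(y) - V(x)| <= int_x^y |w|^p + (p-1) t^p (y - x). These pass to pointwise limits of
    distribution functions. Afterwards, large t yields equicontinuity and absolute continuity, and t
    ranging over the rationals yields the L^p density and the bound on its energy.
    [charge_ge0_local] carries inequalities from intervals to Borel sets.

    Limits are taken along an ultrafilter: a claim that fails for infinitely many n gives an
    ultrafilter containing the bad indices, along which all bounded quantities converge.

    The order of the parameters matters. For fixed lambda, the a priori bound comes from the bound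
    on the h_n and grows with lambda. For the second claim n is chosen after lambda, so that 2
    lambda int (u - g) h_n <= 1; then Fbar u + lambda int |u - g|^2 <= Fbar g + 1, a bound uniform
    in lambda. *)

Section cdf.
Context {R : realType}.
Implicit Types (nu : signed_measure R)
  (m : {finite_measure set (measurableTypeR R) -> \bar R}).

Definition cdf (nu : set (measurableTypeR R) -> \bar R) (x : R) : R :=
  fine (nu `]-oo, x]%classic).

Lemma chargeE_cdf nu x y : x <= y -> nu `]x, y]%classic = (cdf nu y - cdf nu x)%:E.
Proof.
move=> xy; rewrite /cdf EFinB !fineK ?fin_num_measure//.
have -> : `]-oo, y]%classic = `]-oo, x] `|` `]x, y] :> set R.
  by rewrite -itv_bndbnd_setU// bnd_simp.
rewrite chargeU//; first by rewrite addeAC subee ?add0e// fin_num_measure.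
by apply/seteqP; split => z//= []; rewrite !in_itv/= => zx /andP[]; lra.
Qed.

Lemma cdf_incr m x y : x <= y -> m `]x, y]%classic = (cdf m y - cdf m x)%:E.
Proof. exact: (@chargeE_cdf (charge_of_finite_measure m)). Qed.

Lemma cdf_ge0 m x : 0 <= cdf m x.
Proof. exact/fine_ge0. Qed.

Lemma cdf_nd m : {homo cdf m : x y / x <= y}.
Proof.
by move=> x y xy; rewrite -subr_ge0 -lee_fin -(cdf_incr m xy).
Qed.

Lemma cdf_le m x : cdf m x <= fine (m setT).
Proof. by rewrite fine_le ?fin_num_measure// le_measure ?inE. Qed.

Lemma cdf_rc_exists m (x e : R) : 0 < e ->
  exists2 d, 0 < d & cdf m (x + d) < cdf m x + e.
Proof.
move=> e0.
have : (m \o (fun n => `]-oo, x + n.+1%:R^-1]%classic)) n @[n --> \oo]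
    --> m (\bigcap_n `]-oo, x + n.+1%:R^-1]%classic).
  apply: nonincreasing_cvg_mu => //.
  - by rewrite -ge0_fin_numE// fin_num_measure.
  - exact: bigcapT_measurable.
  - move=> i j ij; apply/subsetPset; apply: subset_itvl.
    by rewrite bnd_simp lerD2l lef_pV2 ?posrE// ler_nat.
rewrite -itvNycEbigcap -[X in _ --> X]fineK ?fin_num_measure// => /fine_cvgP[_] /cvgrPdist_lt /(_ _ e0)[n _] /(_ n (leqnn _)) /=.
rewrite -/(cdf m _) => h; exists (n.+1%:R^-1); first by rewrite invr_gt0.
move: h; rewrite -/(cdf m (x + n.+1%:R^-1)) distrC => /ltr_distlDr.
by rewrite addrC.
Qed.

Lemma nd_right_continuous (f : R -> R) : {homo f : x y / x <= y} ->
  (forall x e, 0 < e -> exists2 d, 0 < d & f (x + d) < f x + e) ->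
  right_continuous f.
Proof.
move=> fnd frc x; apply/cvgrPdist_lt => e e0.
have [d d0 fd] := frc x e e0.
near=> y; rewrite distrC ger0_norm ?subr_ge0; last by apply: fnd; near: y; exact: nbhs_right_ge.
rewrite ltrBlDl; apply: le_lt_trans fd; apply: fnd; near: y.
by apply: nbhs_right_le; rewrite ltrDl.
Unshelve. all: by end_near. Qed.

Lemma cdf_rc m : right_continuous (cdf m).
Proof. by apply: nd_right_continuous; [exact: cdf_nd|exact: cdf_rc_exists]. Qed.

Lemma LS_itv (f : cumulative R R) x y : x <= y ->
  lebesgue_stieltjes_measure f `]x, y]%classic = (f y - f x)%:E.
Proof.
move=> xy; rewrite /lebesgue_stieltjes_measure/= /measure_extension/=.
by rewrite measurable_mu_extE//=; [rewrite wlength_itv_bnd|exact: is_ocitv].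
Qed.

(** Let P - N be the Jordan decomposition of [nu] restricted to ]c, d]. Nonnegativity on intervals
    makes [cdf P - cdf N] nondecreasing and right-continuous, hence the cumulative function of a
    Lebesgue-Stieltjes measure. By uniqueness, P is the sum of that measure and N, so P >= N on all
    Borel sets. *)
Lemma charge_ge0_of_itv nu c d :
  (forall x y, c <= x -> x < y -> y <= d -> (0 <= nu `]x, y]%classic)%E) ->
  forall A : set (measurableTypeR R), measurable A -> A `<=` `]c, d]%classic ->
  (0 <= nu A)%E.
Proof.
move=> nuge0 A mA Acd.
have mcd : measurable (`]c, d]%classic : set (measurableTypeR R)) by [].
pose nu' : signed_measure R := crestr0 nu mcd.
pose P : {finite_measure set (measurableTypeR R) -> \bar R} := jordan_pos (hahnP nu').
pose N : {finite_measure set (measurableTypeR R) -> \bar R} := jordan_neg (hahnP nu').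
have nuPN B : measurable B -> nu' B = (P B - N B)%E.
  by move=> mB; rewrite (jordan_decomp (hahnP nu') mB) /cadd/= cscaleN1.
have nu'itv x y : x <= y -> (0 <= nu' `]x, y]%classic)%E.
  move=> xy; rewrite /nu' /= /crestr0 mem_set// /crestr.
  have -> : `]x, y] `&` `]c, d] = `]Num.max x c, Num.min y d]%classic :> set R.
    by apply/seteqP; split => z; rewrite /= !in_itv/= gt_max le_min => *; lra.
  have [lt|ge] := ltP (Num.max x c) (Num.min y d).
    by apply: nuge0 => //; [rewrite le_max lexx orbT|rewrite ge_min lexx orbT].
  by rewrite set_itv_ge ?charge0// bnd_simp -leNgt.
pose G x := cdf P x - cdf N x.
have Gnd : {homo G : x y / x <= y}.
  move=> x y xy; rewrite -subr_ge0 -lee_fin; move: (nu'itv _ _ xy).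
  rewrite nuPN// !cdf_incr// -EFinB !lee_fin /G; lra.
have Grc : right_continuous G.
  by move=> x; apply: cvgB; exact: cdf_rc.
have [g gE] : exists g : cumulative R R, g = G :> (R -> R).
  pose g : cumulative R R := HB.pack G (isCumulative.Build R _ R G Gnd Grc); by exists g.
have [fP fPE] : exists f : cumulative R R, f = cdf P :> (R -> R).
  pose g2 : cumulative R R := HB.pack (cdf P) (isCumulative.Build R _ R (cdf P) (@cdf_nd P) (@cdf_rc P)); by exists g2.
have aE B : measure_add (lebesgue_stieltjes_measure g) N B =
  (lebesgue_stieltjes_measure g B + N B)%E := measure_addE _ _ B.
have addE : forall B, measurable B -> lebesgue_stieltjes_measure fP B =
    measure_add (lebesgue_stieltjes_measure g) N B.
  apply: lebesgue_stieltjes_measure_unique => X /ocitvP[->|[[x y]/= xy ->]].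
    by rewrite !measure0.
  apply: (eq_trans _ (esym (aE _))); rewrite !LS_itv ?ltW// cdf_incr ?ltW//= -EFinD; congr EFin.
  rewrite gE fPE /G; lra.
have PE : forall B, measurable B -> lebesgue_stieltjes_measure fP B = P B.
  apply: lebesgue_stieltjes_measure_unique => X /ocitvP[->|[[x y]/= xy ->]].
    by rewrite !measure0.
  by rewrite LS_itv ?cdf_incr ?ltW//= fPE.
have -> : nu A = nu' A by rewrite /nu'/= /crestr0 mem_set// /crestr (setIidl Acd).
rewrite nuPN// sube_ge0 ?fin_num_measure// -PE// addE// aE.
by rewrite leeDr.
Qed.

End cdf.

(** * Local positivity, and the Lebesgue decomposition of a charge *)

Section charges.
Context {R : realType}.
Implicit Types (nu : signed_measure R).
Local Open Scope ereal_scope.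

Lemma pos_partE nu A : measurable A -> pos_part nu A = nu (A `&` hahn_pos nu).
Proof.
move=> mA; rewrite -[LHS]/(jordan_pos (hahnP nu) A) jordan_posE cjordan_posE.
by rewrite /crestr0 mem_set.
Qed.

Lemma neg_partE nu A : measurable A -> neg_part nu A = - nu (A `&` hahn_neg nu).
Proof.
move=> mA; rewrite -[LHS]/(jordan_neg (hahnP nu) A) jordan_negE cjordan_negE.
by rewrite /crestr0 mem_set.
Qed.

Lemma jordanE nu A : measurable A -> nu A = pos_part nu A - neg_part nu A.
Proof. by move=> mA; rewrite [LHS](jordan_decomp (hahnP nu) mA) /cadd/= cscaleN1. Qed.

Lemma total_varE nu A : total_var nu A = pos_part nu A + neg_part nu A.
Proof. by []. Qed.

(** Countably many rational intervals of the given kind cover [U]. By [charge_ge0_of_itv] the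
    negative part of [nu] vanishes on each of them, hence on [A]. This is the passage from interval
    inequalities to Borel sets. *)
Lemma charge_ge0_local nu (U : set R) :
  (forall z, U z -> exists c d, [/\ (c < z)%R, (z < d)%R & forall x y,
    (c <= x)%R -> (x < y)%R -> (y <= d)%R -> 0 <= nu `]x, y]%classic]) ->
  forall A : set (measurableTypeR R), measurable A -> A `<=` U -> 0 <= nu A.
Proof.
move=> Uloc A mA AU.
have mH : measurable (hahn_neg nu) by have [_ []] := hahnP nu.
suff NA : neg_part nu A = 0 by rewrite jordanE// NA sube0.
pose good (q : rat * rat) := forall x y, (ratr q.1 <= x)%R -> (x < y)%R ->
  (y <= ratr q.2)%R -> 0 <= nu `]x, y]%classic.
(* The decoded [n] runs through all pairs of rationals; codes of nothing and intervals that are not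
   good contribute the empty set. *)
pose F (n : nat) : set (measurableTypeR R) := if unpickle n is Some q then
  (if `[< good q >] then A `&` `](ratr q.1), (ratr q.2)] else set0) else set0.
have mF n : measurable (F n).
  by rewrite /F; case: unpickle => [q|]//; case: ifP => // _; exact: measurableI.
have NF n : neg_part nu (F n) = 0.
  rewrite /F; case: unpickle => [q|]; last by rewrite measure0.
  case: ifPn => [/asboolP gq|_]; last by rewrite measure0.
  apply/eqP; rewrite eq_le measure_ge0 andbT neg_partE; last exact: measurableI.
  rewrite leeNl oppe0; apply: (charge_ge0_of_itv gq).
    by apply: measurableI => //; exact: measurableI.
  by move=> z [[]].
have AF : A `<=` \bigcup_n F n.
  move=> z Az; have [c [d [cz zd H]]] := Uloc z (AU _ Az).
  have [q1] := rat_in_itvoo cz; rewrite in_itv/= => /andP[cq1 q1z].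
  have [q2] := rat_in_itvoo zd; rewrite in_itv/= => /andP[zq2 q2d].
  have gq : good (q1, q2).
    move=> x y /= qx xy yq; apply: H => //.
      exact: (le_trans (ltW cq1)).
    by rewrite (le_trans yq)// ltW.
  have [n nE] : exists n, unpickle n = Some (q1, q2).
    by eexists; exact: pickleK.
  exists n => //; rewrite /F nE ifT; last exact/asboolP.
  by split => //; rewrite /= in_itv/= q1z ltW.
apply/eqP; rewrite eq_le measure_ge0 andbT.
have : (neg_part nu).-negligible (\bigcup_n F n).
  by apply: negligible_bigcup => n; apply/negligibleP; [exact: mF|exact: NF].
by move=> /(negligibleS AF) /(negligibleP _ mA) ->.
Qed.

Lemma total_var_fin_num nu A : measurable A -> total_var nu A \is a fin_num.
Proof. by move=> mA; exact: (fin_num_measure (charge_variation (hahnP nu))). Qed.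

(** By exhaustion: [N] is a union of Lebesgue-null sets whose total variations approach the supremum
    over all null sets. Off [N], [nu] is absolutely continuous and the Radon-Nikodym theorem gives
    [f]; the singular part is [nu] restricted to [N]. *)
Lemma lebesgue_decomposition_exists nu :
  exists (f : R -> R) (N : set (measurableTypeR R)),
  [/\ (leb R).-integrable setT (EFin \o f), measurable N, leb R N = 0 &
    forall A, measurable A ->
      nu A = \int[leb R]_(x in A) (f x)%:E + nu (A `&` N)].
Proof.
pose V := total_var nu.
pose null : set (set (measurableTypeR R)) := [set N | measurable N /\ leb R N = 0].
pose S := ereal_sup [set V N | N in null].
have VS N : null N -> V N <= S by move=> nN; apply: ereal_sup_ubound; exists N.
have Sfin : S \is a fin_num.
  rewrite ge0_fin_numE.
    apply: le_lt_trans (_ : V setT < +oo).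
      by apply: ge_ereal_sup => _ [N [mN _] <-]; rewrite le_measure ?inE.
    by rewrite -ge0_fin_numE// total_var_fin_num.
  apply: le_trans (VS set0 _); first by rewrite measure_ge0.
  by split => //; rewrite measure0.
have [F HF] : exists F : nat -> set (measurableTypeR R), forall n, null (F n) /\
    S - n.+1%:R^-1%:E < V (F n).
  have : forall n : nat, exists N, null N /\ S - n.+1%:R^-1%:E < V N.
    move=> n; have /(ub_ereal_sup_adherent)/(_ Sfin)[_ [N nN <-] lt] :
      (0 < n.+1%:R^-1 :> R)%R by rewrite invr_gt0.
    by exists N.
  by move=> /choice[F HF]; exists F.
pose N := \bigcup_n F n.
have mN : measurable N by apply: bigcup_measurable => n _; have [[]] := HF n.
have N0 : leb R N = 0.
  apply/(negligibleP _ mN); apply: negligible_bigcup => n.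
  by have [[mF F0] _] := HF n; apply/(negligibleP _ mF).
have SVN : S <= V N.
  apply/lee_subgt0Pr => e e0; have [n ne] := ltr_add_invr e0.
  have [[mF _] /ltW h] := HF n.
  apply: le_trans (le_trans h _); last first.
    by apply: le_measure; rewrite ?inE//; exact: bigcup_sup.
  by rewrite leeD2lE// leeN2 lee_fin; move: ne; rewrite add0r => /ltW.
have mNC : measurable (~` N) by exact: measurableC.
pose nu' : signed_measure R := crestr0 nu mNC.
have dom : nu' `<< leb R.
  apply/null_content_dominatesP => A mA A0.
  (* Otherwise the null set [A] united with [N] would have larger variation than [N], which already
     attains the supremum. *)
  have VA : V (A `\` N) = 0.
    have mAN : measurable (A `\` N) by exact: measurableD.
    have AN0 : leb R (A `|` N) = 0.
      apply/(negligibleP _ (measurableU _ _ mA mN)).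
      by apply: negligibleU; apply/negligibleP.
    have : V (A `\` N) + V N <= V N.
      apply: (@le_trans _ _ (V (A `|` N))).
        rewrite -measureU//; last by rewrite setDE -setIA setICl setI0.
        have -> : (A `\` N) `|` N = A `|` N.
          by apply/seteqP; split => z; have [Nz|Nz] := pselect (N z) => /=; tauto.
        exact: lexx.
      by apply: le_trans SVN; apply: VS; split => //; exact: measurableU.
    rewrite -leeBrDr ?total_var_fin_num// subee ?total_var_fin_num// => h.
    by apply/eqP; rewrite eq_le h measure_ge0.
  rewrite /nu' /= /crestr0 mem_set// /crestr -setDE.
  apply/eqP; rewrite -abse_eq0 eq_le abse_ge0 andbT -VA.
  by apply: abse_charge_variation; exact: measurableD.
exists (fine \o Radon_Nikodym nu' (leb R)), N; split => //.
- apply: eq_integrable (Radon_Nikodym_integrable dom) => // x _.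
  by rewrite /= fineK// Radon_Nikodym_fin_num.
- move=> A mA; under eq_integral => x _ do
    rewrite /= fineK ?Radon_Nikodym_fin_num//.
  rewrite -Radon_Nikodym_integral// /nu'/= /crestr0 mem_set// /crestr -setDE.
  by rewrite (chargeDI nu mA mN).
Qed.

End charges.

(** * Weak derivatives on an interval *)

Section fubini.
Context {R : realType}.

Lemma measurable_le_pair : measurable [set z : measurableTypeR R * measurableTypeR R | z.2 <= z.1].
Proof.
have -> : [set z : measurableTypeR R * measurableTypeR R | z.2 <= z.1] =
    [set: _] `&` (fun z => z.1 - z.2 : R) @^-1` `[0, +oo[%classic.
  by apply/seteqP; split => z; rewrite /= in_itv/= andbT subr_ge0 => //; case.
have mf : measurable_fun [set: measurableTypeR R * measurableTypeR R]
    (fun z => z.1 - z.2 : R).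
  by apply: measurable_funB; [exact: measurable_fst|exact: measurable_snd].
exact: mf.
Qed.

Lemma integrable_Rintegral_mulr (m : {measure set (measurableTypeR R) -> \bar R})
    (D : set (measurableTypeR R)) (f : R -> R) (r : R) : measurable D ->
  m.-integrable setT (EFin \o f) ->
  (\int[m]_t (r * f t * \1_D t)%:E)%E = (r * \int[m]_(t in D) f t)%:E.
Proof.
move=> mD intf.
have intfD : m.-integrable D (EFin \o f) by exact: integrableS intf.
transitivity (\int[m]_(t in D) (r%:E * (f t)%:E))%E.
  rewrite [RHS]integral_mkcond; apply: eq_integral => t _.
  rewrite patchE indicE; case: ifPn => tD; first by rewrite mulr1 EFinM.
  by rewrite mulr0.
rewrite integralZl// EFinM /Rintegral fineK//.
exact: integrable_fin_num.
Qed.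

(** Integration by parts in disguise: for [k] the derivative of a test function, the inner integral
    on the right is minus that function. It is Fubini on the half-plane t <= x. A general [m] covers
    both [cdf] (finite [m], [f] = 1) and primitives of functions (Lebesgue measure). *)
Lemma Fubini_le (m : {sigma_finite_measure set (measurableTypeR R) -> \bar R})
    (k f : R -> R) :
  (leb R).-integrable setT (EFin \o k) -> m.-integrable setT (EFin \o f) ->
  \int[leb R]_x (k x * \int[m]_(t in `]-oo, x]) f t) =
  \int[m]_t (f t * \int[leb R]_(x in `[t, +oo[) k x).
Proof.
move=> ik jf.
pose F (z : measurableTypeR R * measurableTypeR R) : \bar R :=
  (k z.1 * f z.2 * \1_[set z : measurableTypeR R * measurableTypeR R | z.2 <= z.1] z)%:E.
have mk : measurable_fun [set: measurableTypeR R] k.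
  by have /integrableP[/measurable_EFinP] := ik.
have mf : measurable_fun [set: measurableTypeR R] f.
  by have /integrableP[/measurable_EFinP] := jf.
have mF : measurable_fun setT F.
  apply/measurable_EFinP; apply: measurable_funM.
    apply: measurable_funM.
      exact: (measurableT_comp mk measurable_fst).
    exact: (measurableT_comp mf measurable_snd).
  by apply: measurable_indic; exact: measurable_le_pair.
have FxE x t : F (x, t) = (k x * f t * \1_(`]-oo, x]%classic : set R) t)%:E.
  by rewrite /F /= !indicE; congr (_ * (nat_of_bool _)%:R)%:E.
have FtE x t : F (x, t) = (f t * k x * \1_(`[t, +oo[%classic : set R) x)%:E.
  rewrite /F /= !indicE (mulrC (f t)); congr (_ * (nat_of_bool _)%:R)%:E.
  by apply/idP/idP; rewrite !inE/= in_itv/= andbT.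
have iF : (leb R \x m)%E.-integrable setT F.
  apply/integrable12ltyP => //.
  apply: (@le_lt_trans _ _ (\int[leb R]_x (`|k x|%:E * \int[m]_t `|(f t)%:E|))%E).
    apply: ge0_le_integral => //.
    - by move=> x _; apply: integral_ge0.
    - apply: (measurable_fun_fubini_tonelli_F (abse \o F)); [exact: measurableT_comp|].
      by move=> z; rewrite /comp abse_ge0.
    - apply: emeasurable_funM => //; apply/measurable_EFinP.
      exact: measurableT_comp.
    - move=> x _; rewrite -integralZl//; last by apply: integrable_abse.
      apply: ge0_le_integral => //.
      + apply: measurableT_comp => //; apply/measurable_EFinP.
        rewrite (_ : (fun y => _) =
            (fun t => k x * f t * \1_(`]-oo, x]%classic : set R) t)); last first.
          by apply/funext => t; apply: EFin_inj; exact: FxE.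
        by apply: measurable_funM => //; exact: measurable_funM.
      + apply/measurable_EFinP; apply: measurable_funM => //.
        exact: measurableT_comp.
      + move=> t _; rewrite FxE !abse_EFin -EFinM lee_fin !normrM.
        by rewrite ler_piMr// indicE; case: (_ \in _); rewrite ?normr1 ?normr0.
  have /integrableP[_ fy] := jf.
  have f0 : (0 <= \int[m]_t `|(f t)%:E|)%E by exact: integral_ge0.
  under eq_integral => x _ do rewrite -[X in (_ * X)%E]fineK ?ge0_fin_numE//.
  rewrite integralZr//; last by have := integrable_abse ik.
  rewrite lte_mul_pinfty ?ge0_fin_numE//.
  - exact: integral_ge0.
  - by have /integrableP[] := ik.
  - exact: integral_ge0.
  - exact: ltry.
have := Fubini iF; rewrite /Rintegral => e.
transitivity (fine (\int[leb R]_x \int[m]_t F (x, t)))%E.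
  congr fine; apply: eq_integral => x _.
  under [RHS]eq_integral do rewrite FxE.
  by rewrite integrable_Rintegral_mulr.
rewrite e; congr fine; apply: eq_integral => t _.
under [LHS]eq_integral do rewrite FtE.
by rewrite integrable_Rintegral_mulr.
Qed.

End fubini.

(** * Test functions, and C^1 bumps built from second differences *)

Section test_functions.
Context {R : realType}.

Lemma is_derive_of_linear_bound (f : R -> R) (x l : R) :
  (forall e : R, 0 < e -> exists2 d : R, 0 < d & forall h : R, `|h| < d ->
    `|f (x + h) - f x - h * l| <= e * `|h|) -> is_derive x (1:R) f l.
Proof.
move=> H; suff cl : h^-1 *: (f (h *: (1:R) + x) - f x) @[h --> 0^'] --> l.
  apply: DeriveDef; first by apply/cvg_ex; exists l.
  by rewrite /derive; apply: cvg_lim => //; exact: Rhausdorff.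
apply/cvgrPdist_le => e e0; have [d d0 Hd] := H e e0.
near=> h.
have h0 : h != 0 by near: h; exact: nbhs_dnbhs_neq.
have hd : `|h| < d by near: h; apply: dnbhs0_lt.
have -> : l - h^-1 *: (f (h *: (1:R) + x) - f x) = - h^-1 * (f (x + h) - f x - h * l).
  rewrite /GRing.scale/= mulr1 (addrC h x) (mulrBr (- h^-1)) !mulNr mulrA mulVf//.
  lra.
rewrite normrM normrN normrV ?unitfE// ler_pdivrMl ?normr_gt0//.
by apply: le_trans (Hd _ hd) _; rewrite mulrC.
Unshelve. all: by end_near. Qed.

(** Half the squared positive part: a C^1 primitive of [Num.max 0], matching the regularity asked of
    a [test_function]. *)
Let q (s : R) : R := Num.max 0 s ^+ 2 / 2.

Let q_derive (s : R) : is_derive s (1:R) q (Num.max 0 s).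
Proof.
apply: is_derive_of_linear_bound => e e0; exists e => // h he.
suff : `|q (s + h) - q s - h * Num.max 0 s| <= `|h| ^+ 2.
  by move=> /le_trans; apply; rewrite expr2 ler_wpM2r// ltW.
rewrite real_normK ?num_real// /q ler_norml.
case: (leP 0 s) => s0; case: (leP 0 (s + h)) => sh; apply/andP; split; nra.
Qed.

(* Second differences of [max 0]: a tent of height and half-width [e]. *)
Definition tent (x e t : R) : R :=
  Num.max 0 (t - x + e) - 2 * Num.max 0 (t - x) + Num.max 0 (t - x - e).

(** A C^1 transition from 0 to e^2 across [x - e, x + e]. The difference of two such transitions has
    compact support, hence is a test function whose derivative is a difference of tents. *)
Definition tent_prim (x e t : R) : R :=
  q (t - x + e) - 2 * q (t - x) + q (t - x - e).

Lemma tent_prim_derive x e t : is_derive t (1:R) (tent_prim x e) (tent x e t).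
Proof.
have sh c : is_derive t (1:R) (fun t : R => q (t + c)) (Num.max 0 (t + c)).
  have h : is_derive t (1:R) (fun t : R => t + c) 1.
    by apply: is_derive_eq; rewrite addr0.
  have := @is_derive1_comp _ q (fun t : R => t + c) t _ _ (q_derive (t + c)) h.
  by rewrite mulr1.
have h1 := sh (- x + e); have h2 := sh (- x); have h3 := sh (- x - e).
rewrite /tent_prim /tent (_ : (fun t0 => _) =
  (fun t => q (t + (- x + e))) - (2 : R) \*: (fun t => q (t + - x)) + (fun t => q (t + (- x - e)))).
  have := is_deriveD (is_deriveB h1 (is_deriveZ (2 : R) h2)) h3.
  by rewrite /GRing.scale/= !addrA.
apply/funext => u.
rewrite [RHS](_ : _ = q (u + (- x + e)) - 2 * q (u + - x) + q (u + (- x - e)))//.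
by rewrite !addrA.
Qed.

Lemma tent_ge0 x e t : 0 < e -> 0 <= tent x e t.
Proof.
move=> e0; rewrite /tent.
by case: (leP 0 (t - x)); case: (leP 0 (t - x + e)); case: (leP 0 (t - x - e)); lra.
Qed.

Lemma tent_le x e t : 0 < e -> tent x e t <= e.
Proof.
move=> e0; rewrite /tent.
by case: (leP 0 (t - x)); case: (leP 0 (t - x + e)); case: (leP 0 (t - x - e)); lra.
Qed.

Lemma tent_out x e t : 0 < e -> e <= `|t - x| -> tent x e t = 0.
Proof.
move=> e0; rewrite /tent ler_normr.
by case: (leP 0 (t - x)); case: (leP 0 (t - x + e)); case: (leP 0 (t - x - e)); lra.
Qed.

Lemma tent_prim_left x e t : 0 < e -> t <= x - e -> tent_prim x e t = 0.
Proof.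
move=> e0 tx; rewrite /tent_prim /q.
by rewrite !max_l ?expr0n/=; lra.
Qed.

Lemma tent_prim_right x e t : 0 < e -> x + e <= t -> tent_prim x e t = e ^+ 2.
Proof.
move=> e0 tx; rewrite /tent_prim /q.
by rewrite !max_r ?expr0n/=; lra.
Qed.

Lemma tent_continuous x e : continuous (tent x e).
Proof.
have cm c : continuous (fun t : R => Num.max 0 (t + c)).
  move=> t; apply: (@continuous_max _ _ (cst 0) (fun t : R => t + c)).
    exact: cvg_cst.
  by apply: cvgD; [exact: cvg_id|exact: cvg_cst].
rewrite (_ : tent x e = (fun t => Num.max 0 (t + (- x + e)) -
    2 * Num.max 0 (t + - x) + Num.max 0 (t + (- x - e)))).
  move=> t; apply: cvgD; last exact: cm.
  by apply: cvgB; [exact: cm|apply: cvgM; [exact: cvg_cst|exact: cm]].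
by apply/funext => u; rewrite /tent !addrA.
Qed.


Lemma test_function_derive_out a b (phi : R -> R) : test_function a b phi ->
  forall x, x \notin `]a, b[ -> phi x = 0 /\ derive1 phi x = 0.
Proof.
move=> [dphi cphi [c [d [ac db phi0]]]] x xab.
have xcd y : y \notin `]a, b[ -> y \notin `[c, d].
  rewrite !in_itv/= !negb_and -!leNgt -!ltNge => /orP[ya|yb]; apply/orP; [left|right]; lra.
split; first exact/phi0/xcd.
have near0 : \forall y \near x, phi y = 0.
  have : (~` `[c, d]%classic : set R) x by have /negP := xcd _ xab.
  move=> xcd'; have := open_nbhs_nbhs (conj (closed_openC (@itv_closed _ R c d)) xcd').
  by apply: filterS => y /negP; exact: phi0.
rewrite derive1E; have -> : 'D_1 phi x = 'D_1 (cst 0 : R -> R) x by exact: near_eq_derive.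
by rewrite derive_cst.
Qed.

Lemma test_function_primitive a b (phi : R -> R) : test_function a b phi ->
  forall x y, x <= y -> \int[leb R]_(t in `[x, y]) derive1 phi t = phi y - phi x.
Proof.
move=> [dphi cphi _] x y; rewrite le_eqVlt => /predU1P[->|xy].
  by rewrite set_itv1 Rintegral_set1 subrr.
have cphi' : {within `[x, y], continuous (derive1 phi)} by exact: continuous_subspaceT.
have LR : derivable_oo_LRcontinuous phi x y.
  split.
  - by move=> z _; exact: dphi.
  - apply: cvg_at_right_filter; apply: differentiable_continuous.
    exact/derivable1_diffP.
  - apply: cvg_at_left_filter; apply: differentiable_continuous.
    exact/derivable1_diffP.
have e := continuous_FTC2 xy cphi' LR (fun z _ => erefl).
by rewrite /Rintegral e.
Qed.

Lemma test_function_derive_integrable a b (phi : R -> R) : test_function a b phi ->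
  (leb R).-integrable setT (EFin \o derive1 phi).
Proof.
move=> tphi; have [dphi cphi _] := tphi.
have : (leb R).-integrable `[a, b] (EFin \o derive1 phi).
  apply: continuous_compact_integrable; first exact: segment_compact.
  exact: continuous_subspaceT.
move=> /integrable_mkcond -/(_ (measurable_itv _)); apply: eq_integrable => // x _.
rewrite /= patchE; case: ifPn => // /negP xab.
have xab' : x \notin `]a, b[.
  by apply/negP => xab'; apply: xab; rewrite inE/=; apply: subset_itv_oo_cc.
by rewrite (test_function_derive_out tphi xab').2.
Qed.

Lemma test_function_tail a b (phi : R -> R) : test_function a b phi ->
  forall t, \int[leb R]_(x in `[t, +oo[) derive1 phi x = - phi t.
Proof.
move=> tphi t; pose B := Num.max t b.
have tB : t <= B by rewrite le_max lexx.
have phiB : phi B = 0.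
  apply: (test_function_derive_out tphi _).1.
  by rewrite in_itv/= negb_and -!leNgt; apply/orP; right; rewrite le_max lexx orbT.
have <- : \int[leb R]_(x in `[t, B]) derive1 phi x = - phi t.
  by rewrite (test_function_primitive tphi)// phiB sub0r.
rewrite Rintegral_mkcond [RHS]Rintegral_mkcond; apply: eq_Rintegral => x _.
rewrite !patchE !mem_setE !in_itv/= andbT.
case: (leP t x) => //= tx; case: (leP x B) => // Bx.
apply: (test_function_derive_out tphi _).2; rewrite in_itv/= negb_and -!leNgt.
by apply/orP; right; apply: le_trans (ltW Bx); rewrite le_max lexx orbT.
Qed.

Lemma test_function_bounded a b (phi : R -> R) : test_function a b phi ->
  exists2 M : R, 0 <= M & forall x, `|phi x| <= M /\ `|derive1 phi x| <= M.
Proof.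
move=> tphi; have [dphi cphi _] := tphi.
have cp : continuous phi.
  by move=> x; apply: differentiable_continuous; exact/derivable1_diffP.
have bnd (f : R -> R) : continuous f -> (forall x, x \notin `]a, b[ -> f x = 0) ->
    exists2 M : R, 0 <= M & forall x, `|f x| <= M.
  move=> cf f0.
  have := @compact_bounded _ R^o _ (continuous_compact (continuous_subspaceT cf) (@segment_compact R a b)).
  move=> [M0 [_ /(_ (M0 + 1))]]; rewrite ltrDl ltr01 => /(_ isT) HM.
  exists (Num.max 0 (M0 + 1)); first by rewrite le_max lexx.
  move=> x; have [xab|/f0->] := boolP (x \in `]a, b[); last first.
    by rewrite normr0 le_max lexx.
  rewrite le_max; apply/orP; right; apply: HM; exists x => //=.
  exact: subset_itv_oo_cc.
have [M1 M10 H1] := bnd phi cp (fun x h => (test_function_derive_out tphi h).1).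
have [M2 M20 H2] := bnd _ cphi (fun x h => (test_function_derive_out tphi h).2).
exists (M1 + M2); first exact: addr_ge0.
by move=> x; split; [apply: le_trans (H1 x) _|apply: le_trans (H2 x) _]; lra.
Qed.

End test_functions.

(** * Functions whose weak derivative is zero *)

Section du_bois_reymond.
Context {R : realType}.
Implicit Types (a b : R) (z u v w : R -> R).

Lemma integrable_mul_bounded d (T : measurableType d)
    (mu : {measure set T -> \bar R}) (D : set T) (f g : T -> R) (M : R) :
  measurable D -> mu.-integrable D (EFin \o f) -> measurable_fun D g ->
  (forall x, D x -> `|g x| <= M) ->
  mu.-integrable D (EFin \o (fun x => f x * g x)).
Proof.
move=> mD intf mg gM.
have mf : measurable_fun D f by have /integrableP[/measurable_EFinP] := intf.
apply: (@le_integrable _ _ _ mu D mD _ (fun x => M%:E * (f x)%:E)%E).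
- by apply/measurable_EFinP; exact: measurable_funM.
- move=> x Dx; rewrite -EFinM !abse_EFin lee_fin mulrC !normrM ler_wpM2r//.
  by apply: le_trans (gM _ Dx) _; exact: ler_norm.
- exact: integrableZl.
Qed.

Lemma ae_exists_itv a b (P : R -> Prop) : a < b -> {ae leb R, forall x, P x} ->
  exists2 x, x \in `]a, b[ & P x.
Proof.
move=> ab [N [mN N0 PN]]; apply: contrapT => H.
have : (leb R `]a, b[ <= leb R N)%E.
  apply: le_measure; rewrite ?inE// => x xab; apply: PN => Px.
  by apply: H; exists x.
by rewrite N0 lebesgue_measure_itv/= lte_fin ab -EFinB lee_fin subr_le0 leNgt ab.
Qed.

Lemma measurable_itvR (i : interval R) :
  measurable ([set` i] : set (measurableTypeR R)).
Proof. exact: measurable_itv. Qed.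

Lemma leb_itv_lty a b (l r : bool) :
  (leb R [set` Interval (BSide l a) (BSide r b)] < +oo)%E.
Proof.
have := @lebesgue_measure_itv R (Interval (BSide l a) (BSide r b)) => /= ->.
by case: ifP => // _; rewrite -EFinB ltry.
Qed.

Lemma integrable_bounded_itv a b (l r : bool) (f : R -> R) (M : R) :
  measurable_fun [set` Interval (BSide l a) (BSide r b)] f ->
  (forall x, x \in Interval (BSide l a) (BSide r b) -> `|f x| <= M) ->
  (leb R).-integrable [set` Interval (BSide l a) (BSide r b)] (EFin \o f).
Proof.
move=> mf fM; apply: measurable_bounded_integrable => //; first exact: leb_itv_lty.
exists M; split; first exact: num_real.
by move=> K MK x xab; apply: le_trans (ltW MK); exact: fM.
Qed.

Lemma ae_imp (P Q : R -> Prop) : (forall x, P x -> Q x) ->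
  {ae leb R, forall x, P x} -> {ae leb R, forall x, Q x}.
Proof. by move=> PQ; apply: filterS; first exact: (ae_filter_ringOfSetsType (leb R)). Qed.

Lemma ae_imp2 (P Q S : R -> Prop) : (forall x, P x -> Q x -> S x) ->
  {ae leb R, forall x, P x} -> {ae leb R, forall x, Q x} -> {ae leb R, forall x, S x}.
Proof. by move=> PQ; apply: filterS2; first exact: (ae_filter_ringOfSetsType (leb R)). Qed.

Lemma Rintegral_oo_cc a b (f : R -> R) : measurable_fun `]a, b[ f ->
  \int[leb R]_(x in `]a, b[) f x = \int[leb R]_(x in `[a, b]) f x.
Proof.
move=> mf; rewrite /Rintegral; congr fine.
have [ab|ba] := ltP a b.
- rewrite integral_itv_bndo_bndc; last exact/measurable_EFinP.
  rewrite integral_itv_obnd_cbnd//; apply/measurable_EFinP.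
  exact/measurable_fun_itv_bndo_bndcP.
- rewrite set_itv_ge ?integral_set0; last by rewrite bnd_simp -leNgt.
  move: ba; rewrite le_eqVlt => /predU1P[->|ba]; first by rewrite set_itv1 integral_set1.
  by rewrite set_itv_ge ?integral_set0// bnd_simp -ltNge.
Qed.

Lemma tent_integral a b (x e : R) : 0 < e -> a < x - e -> x + e < b ->
  \int[leb R]_(t in `]a, b[) tent x e t = e ^+ 2.
Proof.
move=> e0 axe xeb.
have mt : measurable_fun `]a, b[ (tent x e).
  by apply: measurable_funTS; apply: continuous_measurable_fun; exact: tent_continuous.
rewrite Rintegral_oo_cc//.
have ab : a < b by lra.
have ct : {within `[a, b], continuous (tent x e)}.
  by apply: continuous_subspaceT; exact: tent_continuous.
have ctp y : {for y, continuous (tent_prim x e)}.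
  apply: differentiable_continuous; apply/derivable1_diffP.
  by have [] := tent_prim_derive x e y.
have LR : derivable_oo_LRcontinuous (tent_prim x e) a b.
  split.
  - by move=> y _; have [] := tent_prim_derive x e y.
  - by apply: cvg_at_right_filter; exact: ctp.
  - by apply: cvg_at_left_filter; exact: ctp.
have dt : {in `]a, b[, (tent_prim x e)^`()%classic =1 tent x e}.
  by move=> y _; rewrite derive1E; have [_ ->] := tent_prim_derive x e y.
have h := continuous_FTC2 ab ct LR dt.
rewrite /Rintegral h/=.
have -> : tent_prim x e b = e ^+ 2 by apply: tent_prim_right; lra.
have -> : tent_prim x e a = 0 by apply: tent_prim_left; lra.
by rewrite subr0.
Qed.

(** The kernel e^-2 [tent x e] has mass 1, is at most 1/e and lives on the ball of radius e. The
    error is therefore at most twice the mean oscillation of [z] over that ball, which tends to 0 at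
    a Lebesgue point. *)
Lemma tent_mean_cvg a b z x : (leb R).-integrable `]a, b[ (EFin \o z) ->
  x \in `]a, b[ -> lebesgue_pt (z \_ `]a, b[) x ->
  e ^- 2 * \int[leb R]_(t in `]a, b[) (z t * tent x e t) @[e --> 0^'+] --> z x.
Proof.
move=> intz xab lx; move: (xab); rewrite in_itv/= => /andP[ax xb].
have mz : measurable_fun `]a, b[ z by have /integrableP[/measurable_EFinP] := intz.
have mZ : measurable_fun [set: measurableTypeR R] (z \_ `]a, b[).
  by apply/(measurable_restrictT _ _).1.
have tentM (e : R) : 0 < e -> forall t, `]a, b[%classic t -> `|tent x e t| <= e.
  by move=> e0 t _; rewrite ger0_norm ?tent_ge0 ?tent_le.
have mt e : measurable_fun `]a, b[ (tent x e).
  by apply: measurable_funTS; apply: continuous_measurable_fun; exact: tent_continuous.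
have intc : (leb R).-integrable `]a, b[ (EFin \o (cst (z x) : R -> R)).
  exact: (integrable_bounded_itv (M := `|z x|)).
have key (e : R) : 0 < e -> a < x - e -> x + e < b ->
    (`|z x - e ^- 2 * \int[leb R]_(t in `]a, b[) (z t * tent x e t)|%:E <=
    2%:E * davg (z \_ `]a, b[) x e)%E.
  move=> e0 ae be.
  have izt := integrable_mul_bounded (measurable_itvR _) intz (mt e) (tentM e e0).
  have ict := integrable_mul_bounded (measurable_itvR _) intc (mt e) (tentM e e0).
  have -> : z x - e ^- 2 * \int[leb R]_(t in `]a, b[) (z t * tent x e t) =
      - (e ^- 2 * \int[leb R]_(t in `]a, b[) (z t * tent x e t - z x * tent x e t)).
    rewrite RintegralB//.
    have -> : \int[leb R]_(t in `]a, b[) (z x * tent x e t) = z x * e ^+ 2.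
      rewrite RintegralZl// ?tent_integral//.
      by apply: (integrable_bounded_itv (M := e)) => // y yab; exact: tentM.
    have e2 : e ^- 2 * e ^+ 2 = 1 by rewrite mulVf// expf_neq0// gt_eqF.
    rewrite mulrBr [X in _ = - (_ - X)]mulrCA e2; lra.
  rewrite normrN normrM ger0_norm; last by rewrite invr_ge0 sqr_ge0.
  rewrite EFinM.
  apply: (@le_trans _ _ ((e ^- 2)%:E * (e%:E * \int[leb R]_(t in ball x e) `|((center ((z \_ `]a, b[) x) \o (z \_ `]a, b[)) t)%:E|))%E).
    apply: lee_wpmul2l; first by rewrite lee_fin invr_ge0 sqr_ge0.
    have iD : (leb R).-integrable `]a, b[ (EFin \o (fun t => z t * tent x e t - z x * tent x e t)).
      exact: integrableB izt ict.
    have bab : ball x e `<=` `]a, b[%classic.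
      by move=> t; rewrite ball_itv /= !in_itv/= => /andP[? ?]; apply/andP; split; lra.
    apply: le_trans (_ : (\int[leb R]_(t in `]a, b[) `|(z t * tent x e t - z x * tent x e t)%:E|)%E <= _)%E.
      rewrite (_ : (\int[leb R]_(t in `]a, b[) `|(z t * tent x e t - z x * tent x e t)%:E|)%E = (\int[leb R]_(t in `]a, b[) `|z t * tent x e t - z x * tent x e t|)%:E).
        by rewrite lee_fin le_normr_Rintegral.
      rewrite /Rintegral fineK//; apply: integrable_fin_num => //.
      exact: (integrable_norm iD).
    rewrite -ge0_integralZl//; last 3 first.
    - exact: measurable_ball.
    - apply/measurable_EFinP/measurableT_comp => //=.
      by apply: measurable_funB => //; exact: measurable_funTS.
    - by rewrite lee_fin ltW.
    rewrite [leRHS]integral_mkcond [leLHS]integral_mkcond/=.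
    apply: ge0_le_integral => //=.
    - by move=> t _; rewrite patchE; case: ifP.
    - apply/(measurable_restrictT _ _).1 => //.
      have /integrableP[/measurable_EFinP mi _] := iD; apply/measurable_EFinP.
      exact: measurableT_comp.
    - apply/(measurable_restrictT _ _).1; first exact: measurable_ball.
      apply: emeasurable_funM => //; apply/measurable_EFinP/measurableT_comp => //=.
      by apply: measurable_funB => //; exact: measurable_funTS.
    - move=> t _; rewrite !patchE; case: ifPn => tab; last first.
        rewrite ifN//; apply/negP => /set_mem/bab tab'.
        by move: tab; rewrite mem_set.
      case: ifPn => [tb|/negP tb].
        rewrite (_ : x \in `]a, b[%classic); last by rewrite inE.
        rewrite -EFinM lee_fin -mulrBl normrM.
        rewrite (mulrC e) (ger0_norm (tent_ge0 _ _ e0)).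
        by apply: ler_wpM2l => //; exact: tent_le.
      rewrite !tent_out ?mulr0 ?subr0 ?normr0//;
        by rewrite leNgt; apply/negP => h; apply: tb; rewrite inE /ball/= distrC.
  rewrite /davg /iavg (lebesgue_measure_ball _ (ltW e0)).
  rewrite muleA -EFinM (_ : e ^- 2 * e = e^-1); last first.
    by rewrite expr2 invfM -mulrA mulVf ?mulr1// gt_eqF.
  have inv2 : (((e *+ 2)%:E)^-1 = ((e *+ 2)^-1)%:E)%E.
    by rewrite inver mulrn_eq0/= gt_eqF.
  rewrite inv2 [leRHS]muleA -EFinM; apply: lee_wpmul2r.
    exact: integral_ge0.
  by rewrite lee_fin -[X in _ * X^-1]mulr_natr invfM mulrCA mulfV ?mulr1.
apply/cvgrPdist_le => eps eps0.
have eps2 : 0 < eps / 2 by lra.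
have nd : \forall e \near 0^'+, (davg (z \_ `]a, b[) x e < (eps / 2)%:E)%E.
  have := lx; rewrite /lebesgue_pt => /(_ [set y | (y < (eps / 2)%:E)%E]); apply.
  by apply: open_nbhs_nbhs; split; [exact: open_ereal_lt_ereal|rewrite /= lte_fin].
near=> e.
have e0 : 0 < e by near: e; exact: nbhs_right_gt.
rewrite -lee_fin; apply: le_trans (key e e0 _ _) _.
- have : e < x - a by near: e; apply: nbhs_right_lt; lra.
  lra.
- have : e < b - x by near: e; apply: nbhs_right_lt; lra.
  lra.
apply: le_trans (_ : 2%:E * (eps / 2)%:E <= _)%E.
  by apply: lee_wpmul2l => //; apply: ltW; near: e.
by rewrite -EFinM lee_fin; lra.
Unshelve. all: by end_near. Qed.

(** At two Lebesgue points, the tents of the same small radius differ by the derivative of a test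
    function, so the two tent averages of [z] coincide; their limits are the values of [z]. *)
Lemma du_bois_reymond a b z : a < b -> (leb R).-integrable `]a, b[ (EFin \o z) ->
  (forall phi, test_function a b phi ->
    \int[leb R]_(x in `]a, b[) (z x * derive1 phi x) = 0) ->
  exists c, {ae leb R, forall x, x \in `]a, b[ -> z x = c}.
Proof.
move=> ab intz H.
have ae := lebesgue_differentiation (integrable_locally (measurable_itvR _) intz).
have [x0 x0ab lx0] := ae_exists_itv ab ae.
exists (z x0); apply: ae_imp ae => x lx xab.
apply: (cvg_unique _ (tent_mean_cvg intz xab lx)).
  exact: Rhausdorff.
apply: cvg_trans (tent_mean_cvg intz x0ab lx0).
apply: near_eq_cvg.
move: xab x0ab; rewrite !in_itv/= => /andP[ax xb] /andP[ax0 x0b].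
near=> e; congr (_ * _).
have e0 : 0 < e by near: e; exact: nbhs_right_gt.
have h1 : e < (x - a) / 2 by near: e; apply: nbhs_right_lt; lra.
have h2 : e < (b - x) / 2 by near: e; apply: nbhs_right_lt; lra.
have h3 : e < (x0 - a) / 2 by near: e; apply: nbhs_right_lt; lra.
have h4 : e < (b - x0) / 2 by near: e; apply: nbhs_right_lt; lra.
pose phi : R -> R := tent_prim x0 e - tent_prim x e.
have dphi y : is_derive y (1:R) phi (tent x0 e y - tent x e y).
  by apply: is_deriveB; exact: tent_prim_derive.
have phi' : derive1 phi = (fun y => tent x0 e y - tent x e y).
  by apply/funext => y; rewrite derive1E; have [_ ->] := dphi y.
have tphi : test_function a b phi.
  split.
  - by move=> y; have [] := dphi y.
  - by rewrite phi' => y; apply: cvgB; exact: tent_continuous.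
  exists (Num.min (x - e) (x0 - e)), (Num.max (x + e) (x0 + e)).
  split; first by rewrite lt_min; apply/andP; split; lra.
    by rewrite gt_max; apply/andP; split; lra.
  move=> y; rewrite in_itv/= negb_and -!ltNge lt_min gt_max => /orP[|] /andP[y1 y2].
    rewrite /phi [LHS](_ : _ = tent_prim x0 e y - tent_prim x e y)//.
    by rewrite !tent_prim_left ?subr0 ?ltW.
  rewrite /phi [LHS](_ : _ = tent_prim x0 e y - tent_prim x e y)//.
  by rewrite !tent_prim_right ?subrr ?ltW.
have mt y : measurable_fun `]a, b[ (tent y e).
  by apply: measurable_funTS; apply: continuous_measurable_fun; exact: tent_continuous.
have izt y : (leb R).-integrable `]a, b[ (EFin \o (fun t => z t * tent y e t)).
  apply: (integrable_mul_bounded (measurable_itvR _) intz (mt y)) => t _.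
  by rewrite ger0_norm ?tent_ge0//; exact: tent_le.
have := H _ tphi; rewrite phi'; under eq_Rintegral do rewrite mulrBr.
by rewrite RintegralB// => /eqP; rewrite subr_eq0 => /eqP.
Unshelve. all: by end_near. Qed.

End du_bois_reymond.

(** * Weak and distributional derivatives read through primitives *)

Section representation.
Context {R : realType}.
Implicit Types (a b p : R) (u v w : R -> R) (mu nu : signed_measure R).

Lemma cdf_sub nu x : cdf nu x = cdf (pos_part nu) x - cdf (neg_part nu) x.
Proof.
rewrite /cdf jordanE// fineB//.
- by exact: (fin_num_measure (jordan_pos (hahnP nu))).
- by exact: (fin_num_measure (jordan_neg (hahnP nu))).
Qed.

Lemma cdf_measurable nu : measurable_fun [set: measurableTypeR R] (cdf nu).
Proof.
rewrite (_ : cdf nu = cdf (jordan_pos (hahnP nu)) \- cdf (jordan_neg (hahnP nu))); last first.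
  by apply/funext => x; exact: cdf_sub.
by apply: measurable_funB; apply: nondecreasing_measurable => // x y *; exact: cdf_nd.
Qed.

Lemma normrB_le_add (s t S T : R) :
  0 <= s -> 0 <= t -> s <= S -> t <= T -> `|s - t| <= S + T.
Proof. by move=> *; rewrite ler_norml; apply/andP; split; lra. Qed.

Lemma normr_cdf_le nu x : `|cdf nu x| <= fine (total_var nu setT).
Proof.
have mP := fin_num_measure (jordan_pos (hahnP nu)) setT measurableT.
have mN := fin_num_measure (jordan_neg (hahnP nu)) setT measurableT.
rewrite cdf_sub total_varE fineD//.
have h1 := cdf_le (jordan_pos (hahnP nu)) x; have h2 := cdf_le (jordan_neg (hahnP nu)) x.
have h3 := cdf_ge0 (jordan_pos (hahnP nu)) x; have h4 := cdf_ge0 (jordan_neg (hahnP nu)) x.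
exact: normrB_le_add.
Qed.

Lemma integrable_cmul d (T : measurableType d) (mu : {measure set T -> \bar R})
    (D : set T) (f : T -> R) (c : R) : measurable D ->
  mu.-integrable D (EFin \o f) -> mu.-integrable D (EFin \o (fun x => c * f x)).
Proof. by move=> mD intf; exact: (integrableZl mD c intf). Qed.

(** Integrating the extension by zero from -oo makes [prim] convertible to the [cdf] of the charge
    with density [w], so that facts on [cdf] transfer. It vanishes at [a]. *)
Definition prim a b w x : R := \int[leb R]_(t in `]-oo, x]) (w \_ `]a, b[) t.

Lemma Rintegral_test a b (f phi : R -> R) : test_function a b phi ->
  \int[leb R]_(x in `]a, b[) (f x * derive1 phi x) =
  \int[leb R]_x (f x * derive1 phi x).
Proof.
move=> tphi; rewrite Rintegral_mkcond; apply: eq_Rintegral => x _.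
rewrite patchE; case: ifPn => // /negP xab; rewrite (test_function_derive_out tphi _).2 ?mulr0//.
by apply/negP => h; apply: xab; rewrite inE.
Qed.

Lemma integrable_restrict_itv a b w : (leb R).-integrable `]a, b[ (EFin \o w) ->
  (leb R).-integrable setT (EFin \o (w \_ `]a, b[)).
Proof.
move=> /integrable_mkcond -/(_ (measurable_itv _)); apply: eq_integrable => // x _.
by rewrite /= !patchE; case: ifP.
Qed.

Lemma test_parts_cdf (m : {finite_measure set (measurableTypeR R) -> \bar R}) a b phi :
  test_function a b phi ->
  \int[leb R]_(x in `]a, b[) (cdf m x * derive1 phi x) = - \int[m]_t phi t.
Proof.
move=> tphi; rewrite Rintegral_test//.
have i1 : m.-integrable setT (EFin \o (cst 1 : R -> R)).
  exact: finite_measure_integrable_cst.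
have := Fubini_le (test_function_derive_integrable tphi) i1.
under eq_Rintegral => x _.
  rewrite Rintegral_cst// mul1r -/(cdf m x) mulrC.
  over.
move=> ->; under eq_Rintegral do rewrite (test_function_tail tphi) mul1r.
have mphi : m.-integrable setT (EFin \o phi).
  have [M M0 HM] := test_function_bounded tphi.
  apply: measurable_bounded_integrable => //.
  - by rewrite -ge0_fin_numE// fin_num_measure.
  - apply: continuous_measurable_fun => x; apply: differentiable_continuous.
    by apply/derivable1_diffP; case: tphi.
  - exists M; split; first exact: num_real.
    by move=> K MK x _; apply: le_trans (ltW MK); have [] := HM x.
under eq_Rintegral do rewrite -mulN1r.
by rewrite RintegralZl// mulN1r.
Qed.

Lemma test_parts_charge nu a b phi : test_function a b phi ->
  \int[leb R]_(x in `]a, b[) (cdf nu x * derive1 phi x) = - charge_integral nu phi.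
Proof.
move=> tphi; have iphi := test_function_derive_integrable tphi.
have h (m : {finite_measure set (measurableTypeR R) -> \bar R}) :
    (leb R).-integrable `]a, b[ (EFin \o (fun x => cdf m x * derive1 phi x)).
  rewrite (_ : (fun x => _) = (fun x => derive1 phi x * cdf m x)); last first.
    by apply/funext => x; rewrite mulrC.
  apply: (integrable_mul_bounded (M := fine (m setT)) (measurable_itvR _)).
  - exact: integrableS iphi.
  - apply: measurable_funTS; apply: nondecreasing_measurable => // x y *; exact: cdf_nd.
  - by move=> x _; rewrite ger0_norm ?cdf_ge0// cdf_le.
under eq_Rintegral do rewrite cdf_sub mulrBl.
rewrite RintegralB//; [|exact: (h (jordan_pos (hahnP nu)))|exact: (h (jordan_neg (hahnP nu)))].
rewrite (test_parts_cdf (jordan_pos (hahnP nu)) tphi).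
rewrite (test_parts_cdf (jordan_neg (hahnP nu)) tphi).
by rewrite /charge_integral /pos_part /neg_part; lra.
Qed.

Lemma test_parts_prim a b w phi : (leb R).-integrable `]a, b[ (EFin \o w) ->
  test_function a b phi ->
  \int[leb R]_(x in `]a, b[) (prim a b w x * derive1 phi x) =
  - \int[leb R]_(x in `]a, b[) (w x * phi x).
Proof.
move=> iw tphi; rewrite Rintegral_test//.
have iw0 := integrable_restrict_itv iw.
have := Fubini_le (test_function_derive_integrable tphi) iw0.
under eq_Rintegral do rewrite mulrC.
move=> ->; under eq_Rintegral do rewrite (test_function_tail tphi) mulrN.
under eq_Rintegral do rewrite -mulN1r.
rewrite RintegralZl//; last first.
  have [M M0 HM] := test_function_bounded tphi.
  apply: (integrable_mul_bounded (M := M) measurableT) => //.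
  - apply: continuous_measurable_fun => x; apply: differentiable_continuous.
    by apply/derivable1_diffP; case: tphi.
  - by move=> x _; have [] := HM x.
rewrite mulN1r; congr (- _); rewrite [RHS]Rintegral_mkcond; apply: eq_Rintegral => x _.
by rewrite !patchE; case: ifP => //; rewrite mul0r.
Qed.

Lemma test_integral0 a b phi : test_function a b phi ->
  \int[leb R]_(x in `]a, b[) derive1 phi x = 0.
Proof.
move=> tphi; have [ab|ba] := ltP a b; last first.
  by rewrite set_itv_ge ?Rintegral_set0// bnd_simp -leNgt.
rewrite Rintegral_oo_cc; last first.
  by apply: measurable_funTS; apply: continuous_measurable_fun; case: tphi.
rewrite (test_function_primitive tphi) ?ltW//.
rewrite !(test_function_derive_out tphi _).1 ?subrr// in_itv/= ltxx ?andbF//.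
Qed.

(** Common core of the representations by [cdf] and by [prim]: the difference [u - G] is integrable
    and has zero weak derivative. *)
Lemma weak_primitive_unique a b u (G : R -> R) (M : R) : a < b ->
  (leb R).-integrable `]a, b[ (EFin \o u) ->
  measurable_fun `]a, b[ G -> (forall x, x \in `]a, b[ -> `|G x| <= M) ->
  (forall phi, test_function a b phi ->
    \int[leb R]_(x in `]a, b[) (u x * derive1 phi x) =
    \int[leb R]_(x in `]a, b[) (G x * derive1 phi x)) ->
  exists c, {ae leb R, forall x, x \in `]a, b[ -> u x = c + G x}.
Proof.
move=> ab iu mG GM H.
have iG : (leb R).-integrable `]a, b[ (EFin \o G) by exact: integrable_bounded_itv mG GM.
have iz : (leb R).-integrable `]a, b[ (EFin \o (fun x => u x - G x)).
  exact: integrableB iu iG.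
have [|c Hc] := du_bois_reymond ab iz.
  move=> phi tphi; have [K K0 HK] := test_function_bounded tphi.
  have m' : measurable_fun `]a, b[ (derive1 phi).
    by apply: measurable_funTS; apply: continuous_measurable_fun; case: tphi.
  under eq_Rintegral do rewrite mulrBl.
  rewrite RintegralB//; first by rewrite H// subrr.
  - apply: (integrable_mul_bounded (M := K) (measurable_itvR _) iu m').
    by move=> x _; have [] := HK x.
  - apply: (integrable_mul_bounded (M := K) (measurable_itvR _) iG m').
    by move=> x _; have [] := HK x.
by exists c; apply: ae_imp Hc => x Hx xab; rewrite -(Hx xab) subrK.
Qed.

Lemma distributional_derivative_cdf a b u mu : a < b ->
  (leb R).-integrable `]a, b[ (EFin \o u) -> distributional_derivative a b u mu ->
  exists c, {ae leb R, forall x, x \in `]a, b[ -> u x = c + cdf mu x}.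
Proof.
move=> ab iu [_ Hmu]; apply: (weak_primitive_unique (M := fine (total_var mu setT)) ab iu).
- by apply: measurable_funTS; exact: cdf_measurable.
- by move=> x _; exact: normr_cdf_le.
- by move=> phi tphi; rewrite Hmu// test_parts_charge.
Qed.

Lemma ae_eq_Rintegral (D : set (measurableTypeR R)) (f g : R -> R) : measurable D ->
  measurable_fun D f -> measurable_fun D g ->
  {ae leb R, forall x, D x -> f x = g x} ->
  \int[leb R]_(x in D) f x = \int[leb R]_(x in D) g x.
Proof.
move=> mD mf mg fg; rewrite /Rintegral; congr fine.
apply: ae_eq_integral => //; [exact/measurable_EFinP|exact/measurable_EFinP|].
by apply: ae_imp fg => x h Dx; rewrite h.
Qed.

Lemma cdf_distributional_derivative a b u mu c :
  (leb R).-integrable `]a, b[ (EFin \o u) ->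
  (forall A : set (measurableTypeR R), measurable A -> A `<=` ~` `]a, b[ -> mu A = 0%E) ->
  {ae leb R, forall x, x \in `]a, b[ -> u x = c + cdf mu x} ->
  distributional_derivative a b u mu.
Proof.
move=> iu mu0 uc; split => // phi tphi.
have [K K0 HK] := test_function_bounded tphi.
have m' : measurable_fun `]a, b[ (derive1 phi).
  by apply: measurable_funTS; apply: continuous_measurable_fun; case: tphi.
have mc : measurable_fun `]a, b[ (cdf mu) by apply: measurable_funTS; exact: cdf_measurable.
rewrite -(test_parts_charge mu tphi).
rewrite (@ae_eq_Rintegral _ _ (fun x => c * derive1 phi x + cdf mu x * derive1 phi x))//.
- have ip : (leb R).-integrable `]a, b[ (EFin \o derive1 phi).
    exact: integrableS (test_function_derive_integrable tphi).
  rewrite RintegralD//.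
  + by rewrite RintegralZl// test_integral0// mulr0 add0r.
  + exact: integrable_cmul.
  + apply: (integrable_mul_bounded (M := K) (measurable_itvR _)) => //.
      by apply: (integrable_bounded_itv mc) => x _; exact: normr_cdf_le.
    by move=> x _; have [] := HK x.
- by apply: measurable_funM => //; have /integrableP[/measurable_EFinP] := iu.
- by apply: measurable_funD; apply: measurable_funM.
- by apply: ae_imp uc => x h xab; rewrite h// mulrDl.
Qed.

Lemma prim_measurable a b w : (leb R).-integrable `]a, b[ (EFin \o w) ->
  measurable_fun [set: measurableTypeR R] (prim a b w).
Proof.
move=> iw; have iw0 := integrable_restrict_itv iw.
exact: (@cdf_measurable (induced_charge iw0)).
Qed.

Lemma prim_bounded a b w : (leb R).-integrable `]a, b[ (EFin \o w) ->
  exists M : R, forall x, `|prim a b w x| <= M.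
Proof.
move=> iw; have iw0 := integrable_restrict_itv iw.
exists (fine (total_var (induced_charge iw0) setT)) => x.
exact: (@normr_cdf_le (induced_charge iw0)).
Qed.

Lemma weak_derivative_prim a b v w : a < b ->
  (leb R).-integrable `]a, b[ (EFin \o v) -> (leb R).-integrable `]a, b[ (EFin \o w) ->
  weak_derivative a b v w ->
  exists c, {ae leb R, forall x, x \in `]a, b[ -> v x = c + prim a b w x}.
Proof.
move=> ab iv iw H; have [M HM] := prim_bounded iw.
apply: (weak_primitive_unique (M := M) ab iv) => //.
- by apply: measurable_funTS; exact: prim_measurable.
- by move=> phi tphi; rewrite H// test_parts_prim.
Qed.

Lemma prim_weak_derivative a b v w c :
  (leb R).-integrable `]a, b[ (EFin \o v) -> (leb R).-integrable `]a, b[ (EFin \o w) ->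
  {ae leb R, forall x, x \in `]a, b[ -> v x = c + prim a b w x} ->
  weak_derivative a b v w.
Proof.
move=> iv iw vc phi tphi.
have [K K0 HK] := test_function_bounded tphi.
have [M HM] := prim_bounded iw.
have m' : measurable_fun `]a, b[ (derive1 phi).
  by apply: measurable_funTS; apply: continuous_measurable_fun; case: tphi.
have mc : measurable_fun `]a, b[ (prim a b w) by apply: measurable_funTS; exact: prim_measurable.
rewrite -(test_parts_prim iw tphi).
rewrite (@ae_eq_Rintegral _ _ (fun x => c * derive1 phi x + prim a b w x * derive1 phi x))//.
- have ip : (leb R).-integrable `]a, b[ (EFin \o derive1 phi).
    exact: integrableS (test_function_derive_integrable tphi).
  rewrite RintegralD//.
  + by rewrite RintegralZl// test_integral0// mulr0 add0r.
  + exact: integrable_cmul.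
  + apply: (integrable_mul_bounded (M := K) (measurable_itvR _)) => //.
      by apply: (integrable_bounded_itv mc) => x _; exact: HM.
    by move=> x _; have [] := HK x.
- by apply: measurable_funM => //; have /integrableP[/measurable_EFinP] := iv.
- by apply: measurable_funD; apply: measurable_funM.
- by apply: ae_imp vc => x h xab; rewrite h// mulrDl.
Qed.

End representation.

(** * Compactness along ultrafilters *)

Section filter_limits.
Context {R : realType} {I : Type} (U : set_system I).

Lemma near_forall_lt {FU : Filter U} (P : nat -> I -> Prop) n :
  (forall j, \forall i \near U, P j i) ->
  \forall i \near U, forall j, (j < n)%N -> P j i.
Proof.
move=> HP; elim: n => [|n IH]; first by apply: nearW.
apply: filterS2 IH (HP n) => i H1 H2 j; rewrite ltnS leq_eqVlt => /predU1P[->//|].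
exact: H1.
Qed.

Lemma cvg_le_near {FU : ProperFilter U} (f : I -> R) (l e : R) :
  f i @[i --> U] --> l -> (\forall i \near U, f i <= e) -> l <= e.
Proof.
move=> fl fe; apply/ler_addgt0Pr => d d0.
have /cvgrPdist_lt/(_ _ d0) := fl.
move=> /(filterI fe)/filter_ex[i [fie /ltr_distlBl]]; lra.
Qed.

Lemma cvg_ge_near {FU : ProperFilter U} (f : I -> R) (l e : R) :
  f i @[i --> U] --> l -> (\forall i \near U, e <= f i) -> e <= l.
Proof.
move=> fl fe; rewrite -lerN2; apply: (@cvg_le_near _ (fun i => - f i)).
  exact: cvgN.
by apply: filterS fe => i; rewrite lerN2.
Qed.

Lemma cvg_le2_near {FU : ProperFilter U} (f g : I -> R) (l k : R) :
  f i @[i --> U] --> l -> g i @[i --> U] --> k ->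
  (\forall i \near U, f i <= g i) -> l <= k.
Proof.
move=> fl gk fg; rewrite -subr_ge0; apply: (@cvg_ge_near _ (fun i => g i - f i)).
  exact: cvgB.
by apply: filterS fg => i; rewrite subr_ge0.
Qed.

Definition grid (a b : R) (n j : nat) : R := a + (b - a) / n.+1%:R * j%:R.

Lemma grid0 a b n : grid a b n 0 = a.
Proof. by rewrite /grid mulr0 addr0. Qed.

Lemma grid_last a b n : grid a b n n.+1 = b.
Proof. by rewrite /grid mulfVK ?pnatr_eq0// addrC subrK. Qed.

Lemma gridS a b n j : grid a b n j.+1 = grid a b n j + (b - a) / n.+1%:R.
Proof. by rewrite /grid -[j.+1%:R]natr1 mulrDr mulr1 addrA. Qed.

Lemma grid_approx a b n x : a < b -> a <= x <= b ->
  exists j, [/\ (j < n.+2)%N, grid a b n j \in `[a, b] &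
    `|x - grid a b n j| <= (b - a) / n.+1%:R].
Proof.
move=> ab /andP[ax xb]; set h := (b - a) / n.+1%:R.
have h0 : 0 < h by rewrite divr_gt0// subr_gt0.
have gle j k : (j <= k)%N -> grid a b n j <= grid a b n k.
  by move=> jk; rewrite lerD2l ler_wpM2l ?ler_nat// ltW.
have : exists j, (x <= grid a b n j) && (j < n.+2)%N.
  by exists n.+1; rewrite grid_last xb ltnSn.
move=> /ex_minnP[j /andP[xj jn] jmin]; exists j; split => //.
  by rewrite in_itv/= -{1}(grid0 a b n) gle//= -[leRHS](grid_last a b n) gle.
case: j xj jn jmin => [|j] xj jn jmin.
  move: xj; rewrite grid0 => xa; have -> : x = a by apply/eqP; rewrite eq_le xa ax.
  by rewrite subrr normr0 ltW.
have : grid a b n j < x.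
  rewrite ltNge; apply/negP => xj'; have := jmin j; rewrite xj' (ltn_trans (ltnSn _) jn).
  by move=> /(_ isT); rewrite ltnn.
move: xj; rewrite gridS -/h => h1 h2; rewrite ler_norml; apply/andP; split; lra.
Qed.

Lemma mesh_lt (a b e : R) : 0 < e -> exists n, (b - a) / n.+1%:R < e.
Proof.
move=> e0; have [n Hn] := ltr_add_invr (divr_gt0 e0 (ltr_wpDl (normr_ge0 (b - a)) ltr01)).
exists n; move: Hn; rewrite add0r ltr_pdivlMr ?ltr_wpDl// => h.
apply: le_lt_trans h; rewrite mulrC ler_pM2l ?invr_gt0//.
by apply: (le_trans (ler_norm _)); rewrite lerDl.
Qed.

(** The limit inherits the modulus. On a finite grid finer than both moduli, pointwise convergence
    is uniform, and three errors of size e / 3 add up. *)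
Lemma equicontinuous_uniform {FU : ProperFilter U} a b (V : I -> R -> R) (W : R -> R) : a < b ->
  (forall e : R, 0 < e -> exists2 d : R, 0 < d & forall i (x y : R), x \in `[a, b] -> y \in `[a, b] ->
     `|x - y| <= d -> `|V i x - V i y| <= e) ->
  (forall x : R, x \in `[a, b] -> V i x @[i --> U] --> W x) ->
  (forall e : R, 0 < e -> exists2 d : R, 0 < d & forall x y : R, x \in `[a, b] -> y \in `[a, b] ->
     `|x - y| <= d -> `|W x - W y| <= e) /\
  forall e : R, 0 < e -> \forall i \near U, forall x : R, x \in `[a, b] -> `|V i x - W x| <= e.
Proof.
move=> ab equi VW.
have equiW (e : R) : 0 < e -> exists2 d : R, 0 < d & forall x y : R, x \in `[a, b] -> y \in `[a, b] ->
     `|x - y| <= d -> `|W x - W y| <= e.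
  move=> e0; have [d d0 Hd] := equi e e0; exists d => // x y xab yab xy.
  have c : `|V i x - V i y| @[i --> U] --> `|W x - W y|.
    by apply: cvg_norm; apply: cvgB; exact: VW.
  by apply: (cvg_le_near c); apply: nearW => i; exact: Hd.
split => // e e0; have e3 : 0 < e / 3 by lra.
have [d d0 Hd] := equi _ e3; have [d' d'0 Hd'] := equiW _ e3.
have [n hn] : exists n, (b - a) / n.+1%:R < Num.min d d'.
  by apply: mesh_lt; rewrite lt_min d0 d'0.
have : \forall i \near U, forall j, (j < n.+2)%N -> grid a b n j \in `[a, b] ->
    `|W (grid a b n j) - V i (grid a b n j)| <= e / 3.
  apply: near_forall_lt => j.
  have [gab|_] := boolP (grid a b n j \in `[a, b]); last by apply: nearW.
  have /cvgrPdist_le/(_ _ e3) := VW _ gab.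
  by apply: filterS.
apply: filterS => i Hi x xab.
have := xab; rewrite in_itv/= => /(grid_approx n ab)[j [jn gab xj]].
move: hn; rewrite lt_min => /andP[/ltW h1 /ltW h2].
have H1 := Hd i _ _ xab gab (le_trans xj h1).
have H2 := Hd' _ _ xab gab (le_trans xj h2).
have H3 := Hi j jn gab.
have -> : V i x - W x = (V i x - V i (grid a b n j)) -
  (W (grid a b n j) - V i (grid a b n j)) - (W x - W (grid a b n j)) by lra.
apply: (le_trans (ler_normB _ _)); apply: le_trans (lerD (ler_normB _ _) H2) _.
lra.
Qed.

(** Compactness gives a cluster point, and an ultrafilter contains every neighbourhood of its
    cluster points. One ultrafilter thus makes all bounded real families converge at once, over any
    set of parameters. *)
Lemma ultra_cvg {UU : UltraFilter U} (f : I -> R) (K : R) : (forall i, `|f i| <= K) ->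
  exists l : R, f i @[i --> U] --> l.
Proof.
move=> fK; have H : (f @ U) `[- K, K]%classic.
  by apply: nearW => i; rewrite /= in_itv/= -ler_norml.
have [l [_ Hl]] := @segment_compact R (- K) K (f @ U) _ H.
exists l => V lV; have [//|UV] := in_ultra_setVsetC (f @^-1` V) UU.
by have [y [nVy /nVy]] := Hl (~` V) V UV lV.
Qed.

Lemma ultra_cvg_fun {UU : UltraFilter U} (T : Type) (f : I -> T -> R) (K : R) :
  (forall i x, `|f i x| <= K) ->
  exists l : T -> R, forall x, f i x @[i --> U] --> l x.
Proof.
move=> fK; have /choice[l Hl] : forall x, exists l : R, f i x @[i --> U] --> l.
  by move=> x; apply: ultra_cvg => i; exact: fK.
by exists l.
Qed.

End filter_limits.

(** * Pointwise and L^1 limits of bounded monotone functions *)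

Section helly.
Context {R : realType} {I : Type} (U : set_system I) {UU : UltraFilter U}.
Context (G : I -> R -> R) (K : R).
Hypothesis G_nd : forall i, {homo G i : x y / x <= y}.
Hypothesis G_ge0 : forall i x, 0 <= G i x.
Hypothesis G_le : forall i x, G i x <= K.

Lemma helly_limit : exists L : R -> R, [/\ (forall x, G i x @[i --> U] --> L x),
  {homo L : x y / x <= y} & forall x, 0 <= L x <= K].
Proof.
have GK i x : `|G i x| <= K by rewrite ger0_norm.
have [L HL] := ultra_cvg_fun (UU := UU) GK.
exists L; split => //.
- by move=> x y xy; apply: (cvg_le2_near (HL x) (HL y)); apply: nearW => i; exact: G_nd.
- move=> x; apply/andP; split.
    by apply: (cvg_ge_near (HL x)); exact: nearW.
  by apply: (cvg_le_near (HL x)); exact: nearW.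
Qed.

(** A pointwise limit [L] of right-continuous functions need not be right-continuous, as a Stieltjes
    function must be. Its right limit is, and differs from [L] only within the jumps, which the
    two-sided bound expresses. *)
Lemma right_regularization (L : R -> R) : {homo L : x y / x <= y} ->
  (forall x, 0 <= L x <= K) -> exists l : cumulative R R,
  forall x y, x < y -> L x <= l x <= L y.
Proof.
move=> Lnd LK; pose l x := inf [set L y | y in `]x, +oo[%classic].
have lbx x : has_lbound [set L y | y in `]x, +oo[%classic].
  by exists 0 => _ [y _ <-]; have /andP[] := LK y.
have l1 x y : x < y -> l x <= L y.
  by move=> xy; apply: ge_inf => //; exists y => //=; rewrite in_itv/= xy.
have l2 x c : (forall y, x < y -> c <= L y) -> c <= l x.
  move=> H; apply: lb_le_inf.
    by exists (L (x + 1)), (x + 1) => //=; rewrite in_itv/= ltrDl ltr01.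
  by move=> _ [y /= yx <-]; apply: H; move: yx; rewrite in_itv/= andbT.
have lnd : {homo l : x y / x <= y}.
  by move=> x y xy; apply: l2 => z yz; apply: l1; exact: le_lt_trans yz.
have lrc : right_continuous l.
  apply: nd_right_continuous => // x e e0.
  have hi : has_inf [set L y | y in `]x, +oo[%classic].
    by split => //; exists (L (x + 1)), (x + 1) => //=; rewrite in_itv/= ltrDl ltr01.
  have [_ [y /= xy <-] Ly] := inf_adherent e0 hi.
  move: xy; rewrite in_itv/= andbT => xy.
  exists ((y - x) / 2); first lra.
  by apply: le_lt_trans Ly; apply: l1; lra.
pose f : cumulative R R := HB.pack l (isCumulative.Build R _ R l lnd lrc).
exists f => x y xy; rewrite l1// andbT; apply: l2 => z xz; exact/Lnd/ltW.
Qed.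

(* Helly's selection theorem; an ultrafilter replaces the extraction of a
   subsequence. The mass that escapes to [a] or [b] is dropped. *)
Lemma helly a b : a < b ->
  exists (m : {finite_measure set (measurableTypeR R) -> \bar R}) (L l : R -> R),
  [/\ (forall x, G i x @[i --> U] --> L x), (forall x y, x < y -> L x <= l x <= L y),
     (forall A : set (measurableTypeR R), A `<=` ~` `]a, b[ -> m A = 0%E),
     (forall x y, a <= x -> x <= y -> y < b -> m `]x, y]%classic = (l y - l x)%:E) &
     (m setT <= (L b - L a)%:E)%E].
Proof.
move=> ab; have [L [GL Lnd LK]] := helly_limit.
have [l Hl] := right_regularization Lnd LK.
pose m0 := lebesgue_stieltjes_measure l.
have m0oc x y : x <= y -> m0 `]x, y]%classic = (l y - l x)%:E by exact: LS_itv.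
have moo : (m0 `]a, b[%classic < +oo)%E.
  apply: (@le_lt_trans _ _ (m0 `]a, b]%classic)).
    by apply: le_measure; rewrite ?inE//; apply: subset_itvl; rewrite bnd_simp.
  by rewrite m0oc ?ltry// ltW.
pose m : {finite_measure set (measurableTypeR R) -> \bar R} := mfrestr (measurable_itvR `]a, b[) moo.
have mE A : m A = m0 (A `&` `]a, b[) by [].
exists m, L, l; split => //.
- move=> A Aab; rewrite mE (_ : A `&` _ = set0) ?measure0//.
  by apply/seteqP; split => // x [/Aab].
- move=> x y ax xy yb; rewrite mE (_ : _ `&` _ = `]x, y]%classic) ?m0oc//.
  by apply/seteqP; split => z /=; rewrite !in_itv/= => *; [|split => //]; lra.
(* The mass is computed along ]a, b - 1/n], where the values of [l] are at most [L b]; the value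
   [l b] itself may exceed [L b]. *)
- rewrite mE setTI.
  have : m0 (\bigcup_n `]a, b - n.+1%:R^-1]%classic) = m0 `]a, b[%classic.
    by rewrite -itv_bnd_open_bigcup.
  have : (m0 \o (fun n => `]a, b - n.+1%:R^-1]%classic)) @ \oo -->
      m0 (\bigcup_n `]a, b - n.+1%:R^-1]%classic).
    apply: nondecreasing_cvg_mu => //; first exact: bigcup_measurable.
    move=> i j ij; apply/subsetPset; apply: subset_itvl; rewrite bnd_simp.
    by rewrite lerD2l lerN2 lef_pV2 ?posrE// ler_nat.
  move=> /[swap] -> c; rewrite -(cvg_lim _ c)//; apply: lime_le.
    by apply/cvg_ex; eexists; exact: c.
  apply: nearW => n /=; have [h|h] := leP a (b - n.+1%:R^-1); last first.
    rewrite set_itv_ge; first by rewrite /m0 measure0 lee_fin subr_ge0 Lnd// ltW.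
    by rewrite bnd_simp -leNgt ltW.
  rewrite m0oc// lee_fin lerB//.
    have : b - n.+1%:R^-1 < b by rewrite ltrBlDr ltrDl invr_gt0.
    by move=> /Hl/andP[].
  by have /Hl/andP[] := ab.
Qed.

(** On a grid cell, monotonicity bounds the difference by the error at the two nodes plus the
    increment of [L]. The increments telescope over the grid, so refining it makes their
    contribution small. *)
Lemma monotone_L1_cvg a b (L l : R -> R) : a < b ->
  (forall x, G i x @[i --> U] --> L x) -> (forall x y, x < y -> L x <= l x <= L y) ->
  {homo l : x y / x <= y} ->
  forall e : R, 0 < e ->
  \forall i \near U, (\int[leb R]_(x in `]a, b[) `|G i x - l x|%:E <= e%:E)%E.
Proof.
move=> ab GL Ll lnd e e0.
have Lnd x y : x <= y -> L x <= L y.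
  by rewrite le_eqVlt => /predU1P[->//|/Ll/andP[]]; exact: le_trans.
have L0 x : 0 <= L x by apply: (cvg_ge_near (GL x)); exact: nearW.
have LK x : L x <= K by apply: (cvg_le_near (GL x)); exact: nearW.
have K0 : 0 <= K by exact: le_trans (LK 0).
(* The node errors contribute (b - a) d = e / 2 and the telescoping sum at most h (K + 1) <= e /
   2. *)
pose d := e / (2 * (b - a)).
have d0 : 0 < d by rewrite divr_gt0// mulr_gt0// subr_gt0.
have [n hn] : exists n, (b - a) / n.+1%:R < e / (2 * (K + 1)).
  by apply: mesh_lt; rewrite divr_gt0//; lra.
set h := (b - a) / n.+1%:R in hn.
have h0 : 0 < h by rewrite divr_gt0// subr_gt0.
have : \forall i \near U, forall j, (j < n.+2)%N ->
    `|L (grid a b n j) - G i (grid a b n j)| <= d.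
  apply: near_forall_lt => j.
  by have /cvgrPdist_le/(_ _ d0) := GL (grid a b n j).
apply: filterS => i Hi.
have mf D : measurable_fun (D : set (measurableTypeR R)) (fun x => `|G i x - l x|%:E).
  apply/measurable_EFinP/measurableT_comp => //; apply: measurable_funTS.
  apply: measurable_funB; apply: nondecreasing_measurable => //; exact: G_nd.
have cell j : (j < n.+1)%N ->
    (\int[leb R]_(x in `]grid a b n j, grid a b n j.+1]) `|G i x - l x|%:E <=
    (h * (d + (L (grid a b n j.+1) - L (grid a b n j))))%:E)%E.
  (* The right end point is removed because [l x <= L y] requires x < y. *)
  move=> jn; rewrite -integral_itv_bndo_bndc; last exact: mf.
  set B := d + _.
  apply: (@le_trans _ _ (\int[leb R]_(x in `]grid a b n j, grid a b n j.+1[) B%:E)%E).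
    apply: ge0_le_integral => //.
      move=> x; rewrite /= in_itv/= => /andP[x1 x2]; rewrite lee_fin /B ler_norml.
      have := Hi j (ltnW jn); have := Hi j.+1 jn; rewrite !ler_norml => /andP[h1 h2] /andP[h3 h4].
      have g1 := G_nd i (ltW x1); have g2 := G_nd i (ltW x2).
      have /andP[l1 _] := Ll _ _ x1; have /andP[_ l2] := Ll _ _ x2.
      have l3 := lnd _ _ (ltW x1).
      by apply/andP; split; lra.
  have lebE : leb R `]grid a b n j, grid a b n j.+1[%classic = h%:E.
    have := @lebesgue_measure_itv R `]grid a b n j, grid a b n j.+1[ => /= ->.
    by rewrite lte_fin gridS ltrDl h0 -EFinB addrAC subrr add0r.
  have -> : (\int[leb R]_(x in `]grid a b n j, grid a b n j.+1[) B%:E =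
      B%:E * leb R `]grid a b n j, grid a b n j.+1[%classic)%E by exact: integral_cst.
  by rewrite lebE -EFinM mulrC.
have tot k : (k <= n.+1)%N ->
    (\int[leb R]_(x in `]a, grid a b n k]) `|G i x - l x|%:E <=
    (h * (d * k%:R + (L (grid a b n k) - L a)))%:E)%E.
  elim: k => [|k IH] kn.
    by rewrite grid0 set_itv_ge ?bnd_simp ?ltxx// integral_set0 mulr0 subrr addr0 mulr0.
  have ak : a <= grid a b n k.
    by rewrite /grid lerDl mulr_ge0// ltW.
  have kk : grid a b n k <= grid a b n k.+1 by rewrite gridS lerDl ltW.
  rewrite (@itv_bndbnd_setU _ _ _ (BRight (grid a b n k)))//=.
  rewrite ge0_integral_setU//=; last first.
    apply/disj_setPS => z []/=; rewrite !in_itv/= => /andP[_ z1] /andP[z2 _].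
    by have := lt_le_trans z2 z1; rewrite ltxx.
  apply: le_trans (leeD (IH (ltnW kn)) (cell k kn)) _.
  rewrite -EFinD lee_fin -natr1; lra.
have := tot n.+1 (leqnn _); rewrite grid_last -integral_itv_bndo_bndc; last exact: mf.
move=> /le_trans; apply; rewrite lee_fin.
have -> : h * (d * n.+1%:R + (L b - L a)) = (b - a) * d + h * (L b - L a).
  by rewrite mulrDr (mulrC d) mulrA /h mulfVK ?pnatr_eq0.
have -> : (b - a) * d = e / 2.
  rewrite /d invfM mulrCA; congr (_ * _).
  by rewrite mulrCA mulfV ?mulr1// subr_eq0 gt_eqF.
suff : h * (L b - L a) <= e / 2 by lra.
apply: (@le_trans _ _ (h * (K + 1))).
  by apply: ler_wpM2l; [exact: ltW|have := L0 a; have := LK b; lra].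
move: hn; rewrite ltr_pdivlMr; last lra.
lra.
Qed.

End helly.

(** * Primitives of L^p functions and the function Psi *)

Section young.
Context {R : realType}.

(** The graph of x^p lies above its tangent at [t]; this is Young's inequality for x and t^(p-1)
    with exponents p and p / (p-1). *)
Lemma young_tangent (p t x : R) : 1 < p -> 0 <= t -> 0 <= x ->
  p * t `^ (p - 1) * x <= x `^ p + (p - 1) * t `^ p.
Proof.
move=> p1 t0 x0; have p0 : 0 < p by lra.
have q0 : 0 < p / (p - 1) by rewrite divr_gt0//; lra.
have pq : p^-1 + (p / (p - 1))^-1 = 1.
  rewrite invf_div mulrBl mulfV ?gt_eqF// mul1r; lra.
have := conjugate_powR x0 (powR_ge0 t (p - 1)) p0 q0 pq.
rewrite -powRrM mulrCA mulfV ?mulr1; last by rewrite gt_eqF//; lra.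
rewrite invf_div => H.
have -> : p * t `^ (p - 1) * x = p * (x * t `^ (p - 1)) by rewrite mulrAC -mulrA.
have -> : x `^ p + (p - 1) * t `^ p = p * (x `^ p / p + t `^ p * ((p - 1) / p)).
  rewrite mulrDr mulrCA mulfV ?gt_eqF// mulr1; congr (_ + _).
  by rewrite mulrCA [p * _]mulrC mulfVK ?gt_eqF// mulrC.
by apply: ler_wpM2l => //; exact: ltW.
Qed.

(* The supremum over tangents recovers the power. *)
Lemma le_powR_of_tangents (p x c : R) : 1 < p ->
  (forall q : rat, (0 <= ratr q :> R) ->
     p * (ratr q) `^ (p - 1) * x - (p - 1) * (ratr q) `^ p <= c) ->
  0 <= x -> x `^ p <= c.
Proof.
move=> p1 H x0; have p10 : 0 < p - 1 by lra.
(* A rational q in ]t, x[ has a tangent whose value at x is q^p + p q^(p-1) (x - q) >= q^p. Left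
   continuity of the power then closes the gap between t and x. Rational points suit countably many
   almost everywhere statements. *)
have key (t : R) : 0 <= t -> t < x -> t `^ p <= c.
  move=> t0 tx; have [q] := rat_in_itvoo tx; rewrite in_itv/= => /andP[tq qx].
  have q0 : 0 <= ratr q :> R by exact: le_trans (ltW tq).
  apply: le_trans (H q q0); apply: (@le_trans _ _ (ratr q `^ p)).
    by apply: ge0_ler_powR; rewrite ?nnegrE//; [lra|exact: ltW].
  have : ratr q * ratr q `^ (p - 1) = ratr q `^ p :> R by rewrite mulr_powRB1//; lra.
  have := powR_ge0 (ratr q : R) (p - 1); set A := _ `^ _; set B := _ `^ _ => A0 <-.
  have : 0 <= p * A * (x - ratr q) by rewrite !mulr_ge0//; lra.
  lra.
have [->|xn0] := eqVneq x 0.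
  have := H 0; rewrite rmorph0 => /(_ (lexx _)).
  by rewrite !powR0 ?mulr0 ?subrr ?gt_eqF//; lra.
have {}x0 : 0 < x by rewrite lt_neqAle eq_sym xn0.
have cont : {for x, continuous (fun y : R => y `^ p)}.
  apply: differentiable_continuous; apply/derivable1_diffP.
  by apply: derivable_powR; rewrite in_itv/= x0.
have : y `^ p @[y --> x^'-] --> x `^ p.
  by apply: cvg_at_left_filter; exact: cont.
move=> c0; apply: (cvg_le_near c0); near=> y; apply: key; near: y.
- by apply: nbhs_left_ge.
- exact: nbhs_left_lt.
Unshelve. all: by end_near. Qed.

(** Tangent slopes are unbounded, which is where p > 1 acts. The form p (K + 1) is convenient for
    beating a given quotient [K]. *)
Lemma tangent_slope_large (p K : R) : 1 < p -> 0 <= K ->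
  exists2 t : R, 0 < t & p * t `^ (p - 1) = p * (K + 1).
Proof.
move=> p1 K0; exists ((K + 1) `^ (p - 1)^-1).
  by apply: powR_gt0; lra.
rewrite -powRrM mulVf ?powRr1//; [lra|].
by rewrite subr_eq0 gt_eqF.
Qed.

End young.

(** * The energy and its control of increments *)

Section Lp.
Context {R : realType}.
Implicit Types (a b p : R) (w : R -> R).

Definition energy a b p w : \bar R := (\int[leb R]_(x in `]a, b[) (`|w x| `^ p)%:E)%E.

Lemma Lp_energy a b p w : 0 < p ->
  Lp a b p%:E w <-> measurable_fun `]a, b[ w /\ (energy a b p w < +oo)%E.
Proof.
move=> p0; have p_neq0 : p != 0 by rewrite gt_eqF.
have e : (Lnorm (leb R) p%:E ((EFin \o w) \_ `]a, b[) `^ p = energy a b p w)%E.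
  rewrite poweR_Lnorm// [RHS]integral_mkcond; apply: eq_integral => x _.
  rewrite !patchE; case: ifP => // _.
  by rewrite abse0 poweR0r.
split=> -[mw H]; split => //; first by rewrite -e poweR_lty.
rewrite ltNge leye_eq; apply/eqP => h.
by move: H; rewrite -e h poweRyr.
Qed.

Lemma energy_ge0 a b p w : (0 <= energy a b p w)%E.
Proof. by apply: integral_ge0 => x _; rewrite lee_fin powR_ge0. Qed.

Lemma measurable_powR_norm d (T : measurableType d) (D : set T) p (w : T -> R) :
  measurable_fun D w -> measurable_fun D (fun x => `|w x| `^ p).
Proof.
move=> mw; apply: (measurableT_comp (measurable_powR p)); exact: measurableT_comp.
Qed.

Lemma energy_integrable a b p w : measurable_fun `]a, b[ w ->
  (energy a b p w < +oo)%E -> (leb R).-integrable `]a, b[ (EFin \o (fun x => `|w x| `^ p)).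
Proof.
move=> mw ew; apply/integrableP; split.
  by apply/measurable_EFinP; exact: measurable_powR_norm.
apply: le_lt_trans ew; rewrite le_eqVlt; apply/orP; left; apply/eqP.
by apply: eq_integral => x _; rewrite /= ger0_norm ?powR_ge0.
Qed.

(** The tangent at 1 gives p |w| <= |w|^p + (p - 1), and constants are integrable on a bounded
    interval. *)
Lemma Lp_integrable a b p w : 1 < p -> Lp a b p%:E w ->
  (leb R).-integrable `]a, b[ (EFin \o w).
Proof.
move=> p1 /(Lp_energy _ _ _ (lt_trans ltr01 p1))[mw ew].
have ic : (leb R).-integrable `]a, b[ (EFin \o (cst (p - 1) : R -> R)).
  exact: (integrable_bounded_itv (M := `|p - 1|)).
have := integrableD (measurable_itvR _) (energy_integrable mw ew) ic.
apply: le_integrable => //; first exact/measurable_EFinP.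
move=> x _; rewrite /= lee_fin [leRHS]ger0_norm; last first.
  by rewrite addr_ge0 ?powR_ge0//; lra.
have := @young_tangent _ p 1 `|w x| p1 ler01 (normr_ge0 _).
rewrite !powR1 !mulr1 => h; have := normr_ge0 (w x); nra.
Qed.

Lemma primB a b w x y : (leb R).-integrable `]a, b[ (EFin \o w) -> x <= y ->
  prim a b w y - prim a b w x = \int[leb R]_(t in `]x, y]) (w \_ `]a, b[) t.
Proof.
move=> iw xy; have iw0 := integrable_restrict_itv iw.
rewrite /prim (@itv_bndbnd_setU _ _ -oo%O (BRight x))//=.
rewrite Rintegral_setU//=.
- by rewrite addrC addKr.
- by apply: integrableS iw0 => //; exact: measurableU.
- apply/disj_setPS => z []/=; rewrite !in_itv/= => z1 /andP[z2 _].
  by have := lt_le_trans z2 z1; rewrite ltxx.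
Qed.

Lemma measurable_restrict_itv a b w : measurable_fun `]a, b[ w ->
  measurable_fun [set: measurableTypeR R] (w \_ `]a, b[).
Proof. by move=> mw; apply/(measurable_restrictT _ _).1. Qed.

Definition energy_cdf a b p w x : R := prim a b (fun t => `|w t| `^ p) x.

Lemma energy_cdf_ge0 a b p w x : 0 <= energy_cdf a b p w x.
Proof. by apply: Rintegral_ge0 => t _; rewrite patchE; case: ifP => // _; exact: powR_ge0. Qed.

Lemma energy_cdf_le a b p w x : measurable_fun `]a, b[ w -> (energy a b p w < +oo)%E ->
  energy_cdf a b p w x <= fine (energy a b p w).
Proof.
move=> mw ew; rewrite /energy_cdf /prim /Rintegral.
have fine_e : energy a b p w \is a fin_num by rewrite ge0_fin_numE// energy_ge0.
have h : (\int[leb R]_(t in `]-oo, x]) (((fun t0 : R => `|w t0| `^ p) \_ `]a, b[) t)%:E <= energy a b p w)%E.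
  rewrite /energy [leRHS]integral_mkcond.
  apply: (@le_trans _ _ (\int[leb R]_t (((fun t0 : R => `|w t0| `^ p) \_ `]a, b[) t)%:E)%E).
    apply: ge0_subset_integral => //.
      apply/measurable_EFinP; apply: measurable_restrict_itv; exact: measurable_powR_norm.
    by move=> t _; rewrite patchE; case: ifP => // _; rewrite lee_fin powR_ge0.
  rewrite le_eqVlt; apply/orP; left; apply/eqP; apply: eq_integral => t _.
  by rewrite !patchE; case: ifP.
apply: fine_le => //; rewrite ge0_fin_numE; first exact: le_lt_trans h ew.
by apply: integral_ge0 => t _; rewrite patchE; case: ifP => // _; rewrite lee_fin powR_ge0.
Qed.

(** The tangent inequality integrated over ]x, y]. Being linear in increments of distribution
    functions, it is the form in which the energy bound passes to limits. *)
Lemma prim_energy a b p w t x y : 1 < p -> 0 <= t -> x <= y -> Lp a b p%:E w ->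
  p * t `^ (p - 1) * `|prim a b w y - prim a b w x| <=
  energy_cdf a b p w y - energy_cdf a b p w x + (p - 1) * t `^ p * (y - x).
Proof.
move=> p1 t0 xy wLp; have p0 : 0 < p by lra.
have [mw ew] := (Lp_energy a b w p0).1 wLp.
have iw := Lp_integrable p1 wLp; have ie := energy_integrable mw ew.
have iw0 := integrable_restrict_itv iw; have ie0 := integrable_restrict_itv ie.
have iwxy : (leb R).-integrable `]x, y] (EFin \o (w \_ `]a, b[)) by exact: integrableS iw0.
have iexy : (leb R).-integrable `]x, y] (EFin \o ((fun t0 : R => `|w t0| `^ p) \_ `]a, b[)).
  exact: integrableS ie0.
rewrite /energy_cdf (primB ie xy) (primB iw xy).
have c0 : 0 <= p * t `^ (p - 1) by rewrite mulr_ge0 ?powR_ge0// ltW.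
have ci : (leb R).-integrable `]x, y] (EFin \o (cst ((p - 1) * t `^ p) : R -> R)).
  exact: (integrable_bounded_itv (M := `|(p - 1) * t `^ p|)).
have -> : (p - 1) * t `^ p * (y - x) = \int[leb R]_(s in `]x, y]) ((p - 1) * t `^ p).
  rewrite Rintegral_cst//; congr (_ * _).
  have := @lebesgue_measure_itv R `]x, y] => /= ->.
  move: xy; rewrite le_eqVlt lte_fin => /predU1P[->|->//].
  by rewrite ltxx subrr.
rewrite -RintegralD//.
apply: (@le_trans _ _ (p * t `^ (p - 1) * \int[leb R]_(s in `]x, y]) `|(w \_ `]a, b[) s|)).
  by apply: ler_wpM2l => //; exact: le_normr_Rintegral.
rewrite -RintegralZl//; last by exact: (integrable_norm iwxy).
apply: le_Rintegral => //.
- by apply: integrable_cmul => //; exact: (integrable_norm iwxy).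
- exact: (integrableD (measurable_itvR _) iexy ci).
move=> s _; rewrite !patchE; case: ifP => _.
  exact: young_tangent.
by rewrite normr0 mulr0 add0r mulr_ge0 ?powR_ge0//; lra.
Qed.

End Lp.

(** * Monotonicity and two-sided Lipschitz bounds of Psi *)

Section Psi.
Context {R : realType} (p : R) (psi : R -> R).
Hypothesis p_gt1 : 1 < p.
Hypothesis psi_gt0 : forall t, 0 < psi t.
Hypothesis psi_meas : measurable_fun [set: R] psi.
Hypothesis psi_bounded : exists B : R, forall t, psi t <= B.
Hypothesis psi_inf : forall K : set R, compact K ->
  (0 < ereal_inf [set (psi t)%:E | t in K])%E.
Hypothesis psi_int : (\int[leb R]_t (psi t `^ p^-1)%:E < +oo)%E.

Let p_gt0 : 0 < p. Proof. exact: lt_trans p_gt1. Qed.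

Let f t := psi t `^ p^-1.

Let f_int : (leb R).-integrable setT (EFin \o f).
Proof.
apply/integrableP; split.
  by apply/measurable_EFinP; exact: (measurableT_comp (measurable_powR p^-1)).
apply: le_lt_trans psi_int; rewrite le_eqVlt; apply/orP; left; apply/eqP.
by apply: eq_integral => x _; rewrite /= ger0_norm ?powR_ge0.
Qed.

Definition PsiR (t : R) : R := Psi p psi t%:E.

Let PsiRE t : PsiR t = \int[leb R]_(s in `]-oo, t]) f s.
Proof.
by rewrite /PsiR /Psi /Rintegral; congr fine; congr (integral _ _ _).
Qed.

Let PsiRB x y : x <= y -> PsiR y - PsiR x = \int[leb R]_(s in `]x, y]) f s.
Proof.
move=> xy; rewrite !PsiRE (@itv_bndbnd_setU _ _ -oo%O (BRight x))//=.
rewrite Rintegral_setU//=.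
- by rewrite addrC addKr.
- by apply: integrableS f_int => //; exact: measurableU.
- apply/disj_setPS => z []/=; rewrite !in_itv/= => z1 /andP[z2 _].
  by have := lt_le_trans z2 z1; rewrite ltxx.
Qed.

Let cst_int x y c : x <= y -> \int[leb R]_(s in `]x, y]) c = c * (y - x).
Proof.
move=> xy; rewrite Rintegral_cst//; congr (_ * _).
have := @lebesgue_measure_itv R `]x, y] => /= ->.
move: xy; rewrite le_eqVlt lte_fin => /predU1P[->|->//].
by rewrite ltxx subrr.
Qed.

Let cst_integrable x y (c : R) : (leb R).-integrable `]x, y] (EFin \o (cst c : R -> R)).
Proof. exact: (integrable_bounded_itv (M := `|c|)). Qed.

Lemma PsiR_lipschitz : exists2 L : R, 0 <= L & forall x y, x <= y -> PsiR y - PsiR x <= L * (y - x).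
Proof.
have [B HB] := psi_bounded; exists (B `^ p^-1); first exact: powR_ge0.
move=> x y xy; rewrite PsiRB// -cst_int//; apply: le_Rintegral => //.
- exact: integrableS f_int.
- exact: cst_integrable.
move=> s _; apply: ge0_ler_powR; rewrite ?nnegrE ?invr_ge0 ?(ltW p_gt0) ?(ltW (psi_gt0 s))//.
exact: le_trans (ltW (psi_gt0 s)) (HB s).
Qed.

Lemma PsiR_lower D : exists2 k : R, 0 < k & forall x y, - D <= x -> x <= y -> y <= D ->
  k * (y - x) <= PsiR y - PsiR x.
Proof.
have := psi_inf (@segment_compact R (- D) D).
set I := ereal_inf _ => I0.
(* For [D < 0] the segment is empty and [I] is +oo; any positive [k] then serves. *)
have [k [k0 kI]] : exists k : R, 0 < k /\ (k%:E <= I)%E.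
  case: I I0 => [r||]//= r0; first by exists r.
  by exists 1; rewrite leey.
exists (k `^ p^-1); first exact: powR_gt0.
move=> x y Dx xy yD; rewrite PsiRB// -cst_int//; apply: le_Rintegral => //.
- exact: cst_integrable.
- exact: integrableS f_int.
move=> s; rewrite /= in_itv/= => /andP[xs sy].
apply: ge0_ler_powR; rewrite ?nnegrE ?invr_ge0 ?(ltW p_gt0) ?(ltW (psi_gt0 s)) ?(ltW k0)//.
rewrite -lee_fin; apply: le_trans kI _; apply: ereal_inf_lbound; exists s => //=.
rewrite in_itv/=; apply/andP; split; lra.
Qed.

Lemma PsiR_increasing x y : x < y -> PsiR x < PsiR y.
Proof.
move=> xy; have [k k0 /(_ x y)] := PsiR_lower (Num.max `|x| `|y|).
have h1 : - Num.max `|x| `|y| <= x.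
  by rewrite lerNl; apply: le_trans (ler_norm _) _; rewrite normrN le_max lexx.
have h2 : y <= Num.max `|x| `|y| by rewrite le_max ler_norm orbT.
move=> /(_ h1 (ltW xy) h2) h; rewrite -subr_gt0; apply: lt_le_trans h.
by rewrite mulr_gt0// subr_gt0.
Qed.

Lemma PsiR_nd : {homo PsiR : x y / x <= y}.
Proof. by move=> x y; rewrite le_eqVlt => /predU1P[->//|/PsiR_increasing/ltW]. Qed.

Lemma PsiR_le x y : (PsiR x <= PsiR y) = (x <= y).
Proof.
by apply/idP/idP => [|/PsiR_nd//]; rewrite leNgt [in X in _ -> X]leNgt; apply: contra => /PsiR_increasing.
Qed.

Lemma PsiR_lt x y : (PsiR x < PsiR y) = (x < y).
Proof. by rewrite !ltNge PsiR_le. Qed.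

Lemma PsiR_continuous : continuous PsiR.
Proof.
have [L L0 HL] := PsiR_lipschitz.
move=> x; apply/cvgrPdist_le => e e0; near=> y.
have h : `|x - y| < e / (L + 1).
  near: y; apply/nbhs_ballP; exists (e / (L + 1)) => //=; rewrite divr_gt0//; lra.
have {}h : L * `|x - y| <= e.
  move: h; rewrite ltr_pdivlMr; last lra.
  by have := normr_ge0 (x - y); nra.
apply: le_trans h; have [xy|yx] := leP x y.
  rewrite distrC ger0_norm ?subr_ge0 ?PsiR_nd//.
  by rewrite distrC ger0_norm ?subr_ge0// HL.
have yx' := ltW yx; rewrite ger0_norm ?subr_ge0 ?PsiR_nd//.
by rewrite ger0_norm ?subr_ge0 ?HL.
Unshelve. all: by end_near. Qed.

Lemma PsiR_bounded : exists M : R, forall x, 0 <= PsiR x <= M.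
Proof.
exists (\int[leb R]_s f s) => x; rewrite PsiRE; apply/andP; split.
  by apply: Rintegral_ge0 => s _; exact: powR_ge0.
apply: fine_le.
- by apply: integrable_fin_num => //; exact: integrableS f_int.
- exact: (integrable_fin_num measurableT f_int).
- apply: ge0_subset_integral => //.
    by apply/measurable_EFinP; have /integrableP[/measurable_EFinP] := f_int.
  by move=> s _; rewrite lee_fin powR_ge0.
Qed.

End Psi.

(** * Slope characterization of X *)

Section slopes.
Context {R : realType}.
Implicit Types (a b c d x y z : R) (f F V : R -> R) (mu s : signed_measure R).

Definition avg f z (e : R) : R := (2 * e)^-1 * \int[leb R]_(t in `]z - e, z + e[) f t.

Definition slope_le F mu V x y := forall c, (forall z, x <= z <= y -> V z <= F c) ->
  (mu `]x, y]%classic <= (c * (y - x))%:E)%E.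

(** Conjugation by the reflection t -> -t. Replacing (F, mu, V) by (flip F, -mu, -V) turns lower
    slope bounds into upper ones, so each argument is carried out for upper bounds and then
    reflected. *)
Definition flip F : R -> R := fun t => - F (- t).

Lemma ae_le_Rintegral_cst x y (l r : bool) f c : x <= y ->
  (leb R).-integrable [set` Interval (BSide l x) (BSide r y)] (EFin \o f) ->
  {ae leb R, forall t, t \in Interval (BSide l x) (BSide r y) -> f t <= c} ->
  \int[leb R]_(t in [set` Interval (BSide l x) (BSide r y)]) f t <= c * (y - x).
Proof.
move=> xy intf fc; set D := [set` _].
have mD : measurable (D : set (measurableTypeR R)) by exact: measurable_itvR.
have mf : measurable_fun D f by have /integrableP[/measurable_EFinP] := intf.
have ic : (leb R).-integrable D (EFin \o (cst c : R -> R)).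
  exact: (integrable_bounded_itv (M := `|c|)).
have -> : c * (y - x) = \int[leb R]_(t in D) c.
  rewrite Rintegral_cst//; congr (_ * _).
  have := @lebesgue_measure_itv R (Interval (BSide l x) (BSide r y)) => /= ->.
  move: xy; rewrite le_eqVlt lte_fin => /predU1P[->|->//].
  by rewrite ltxx subrr.
have mg : measurable_fun D (fun t => Num.min (f t) c).
  by apply: measurable_minr.
(* The truncation agrees with [f] almost everywhere and is at most [c] at every point, as
   monotonicity of the integral asks. *)
rewrite (@ae_eq_Rintegral _ D f (fun t => Num.min (f t) c))//; last first.
  by apply: ae_imp fc => t h Dt; rewrite min_l// h.
have ig : (leb R).-integrable D (EFin \o (fun t => Num.min (f t) c)).
  have := integrableD (measurable_itvR _) (integrable_norm intf) (integrable_norm ic).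
  apply: le_integrable => //; first exact/measurable_EFinP.
  move=> t _; rewrite /= lee_fin [leRHS]ger0_norm ?addr_ge0//.
  by rewrite /Num.min; case: ifP => _; rewrite ?lerDl ?lerDr.
by apply: le_Rintegral => // t _; rewrite ge_min lexx orbT.
Qed.

Lemma avg_le a b f F V z c : (leb R).-integrable setT (EFin \o f) ->
  (forall x y, (F x < F y) = (x < y)) -> {for z, continuous V} ->
  {ae leb R, forall t, t \in `]a, b[ -> F (f t) = V t} ->
  z \in `]a, b[ -> V z < F c -> \forall e \near 0^'+, avg f z e <= c.
Proof.
move=> intf Flt Vz FfV zab Vc.
have nb : \forall t \near z, (t \in `]a, b[) /\ V t < F c.
  apply: filterI; first exact: near_in_itvoo.
  by move/cvgr_lt : Vz; apply.
move: nb => /nbhs_ballP[r /= r0 Hr].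
near=> e.
have e0 : 0 < e by near: e; exact: nbhs_right_gt.
have er : e < r by near: e; exact: nbhs_right_lt.
rewrite /avg ler_pdivrMl ?mulr_gt0//.
have -> : 2 * e * c = c * ((z + e) - (z - e)) by lra.
apply: ae_le_Rintegral_cst; first lra.
  exact: integrableS intf.
apply: ae_imp FfV => t h; rewrite in_itv/= => /andP[t1 t2].
have [tab Vt] : (t \in `]a, b[) /\ V t < F c.
  by apply: Hr; rewrite /ball/= ltr_norml; apply/andP; split; lra.
by apply: ltW; rewrite -Flt h.
Unshelve. all: by end_near. Qed.

Lemma flip_lt F : (forall x y, (F x < F y) = (x < y)) ->
  forall x y, (flip F x < flip F y) = (x < y).
Proof. by move=> H x y; rewrite /flip ltrN2 H ltrN2. Qed.

Lemma avgN f z e : (leb R).-integrable setT (EFin \o f) ->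
  avg (fun t => - f t) z e = - avg f z e.
Proof.
move=> intf; rewrite /avg -mulrN; congr (_ * _).
under eq_Rintegral do rewrite -mulN1r.
by rewrite RintegralZl ?mulN1r//; exact: integrableS intf.
Qed.

Lemma integrable_opp f : (leb R).-integrable setT (EFin \o f) ->
  (leb R).-integrable setT (EFin \o (fun t => - f t)).
Proof.
move=> intf; have := integrable_cmul (-1) measurableT intf.
by under [X in EFin \o X]eq_fun do rewrite mulN1r.
Qed.

Lemma avg_ge a b f F V z c : (leb R).-integrable setT (EFin \o f) ->
  (forall x y, (F x < F y) = (x < y)) -> {for z, continuous V} ->
  {ae leb R, forall t, t \in `]a, b[ -> F (f t) = V t} ->
  z \in `]a, b[ -> F c < V z -> \forall e \near 0^'+, c <= avg f z e.
Proof.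
move=> intf Flt Vz FfV zab Vc.
have := @avg_le a b (fun t => - f t) (flip F) (fun t => - V t) z (- c) (integrable_opp intf) (flip_lt Flt).
rewrite /flip opprK ltrN2 => H.
have {}H : \forall e \near 0^'+, avg (fun t => - f t) z e <= - c.
  apply: H => //; first exact: cvgN.
  by apply: ae_imp FfV => t h tab; rewrite opprK h.
by apply: filterS H => e; rewrite avgN// lerN2.
Qed.

(* [V <= F c] forces [f <= c] a.e., and where the averages of [f] stay bounded
   the singular part has no positive mass. *)
Lemma slope_le_of_density a b f F V mu s x y :
  (forall x y, (F x < F y) = (x < y)) -> continuous V ->
  (forall A : set (measurableTypeR R), measurable A -> A `<=` ~` `]a, b[ -> mu A = 0%E) ->
  lebesgue_decomposition mu f s ->
  {ae leb R, forall t, t \in `]a, b[ -> F (f t) = V t} ->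
  (forall A : set (measurableTypeR R), measurable A -> A `<=` `]a, b[ ->
     (forall z, A z -> exists c, \forall e \near 0^'+, avg f z e <= c) -> (s A <= 0)%E) ->
  a <= x -> x < y -> y <= b -> slope_le F mu V x y.
Proof.
move=> Flt Vcont mu0 [intf _ muE] FfV HS ax xy yb c Vc.
(* Since [y = b] is allowed, ]x, y] may reach the boundary, where [mu] has no mass; the intersection
   with ]a, b[ is then open on the right. *)
have [r [Ar Aoc]] : exists r, `]x, y] `&` `]a, b[ = [set` Interval (BRight x) (BSide r y)] :> set R /\
    `]x, y] `&` `]a, b[ `<=` `]x, y].
  have [yb'|yb'] := ltP y b.
  - exists false; split => [|z []//].
    by apply/seteqP; split => z /=; rewrite !in_itv/= => *; [|split => //]; lra.
  - exists true; split => [|z []//].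
    by apply/seteqP; split => z /=; rewrite !in_itv/= => *; [|split => //]; lra.
set A := (`]x, y] `&` `]a, b[) in Ar Aoc.
have mA : measurable (A : set (measurableTypeR R)) by exact: measurableI.
have -> : mu `]x, y]%classic = mu A.
  rewrite (chargeDI mu (measurable_itvR `]x, y]) (measurable_itvR `]a, b[)).
  have -> : mu (`]x, y] `\` `]a, b[) = 0%E.
    by apply: mu0; [exact: measurableD|move=> z []].
  by rewrite add0e.
rewrite muE//.
have sA : (s A <= 0)%E.
  apply: HS => //; first exact: subIsetr.
  (* Raising [c] by 1 produces the strict inequality that [avg_le] asks for. *)
  move=> z [zxy zab]; exists (c + 1); apply: (avg_le intf Flt (Vcont z) FfV) => //.
  apply: (@le_lt_trans _ _ (F c)); last by rewrite Flt ltrDl.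
  by apply: Vc; move: zxy; rewrite /= in_itv/= => /andP[/ltW-> ->].
rewrite -[leRHS]adde0; apply: leeD => //.
have iA : (leb R).-integrable A (EFin \o f) by exact: integrableS intf.
have -> : (\int[leb R]_(x0 in A) (f x0)%:E = (\int[leb R]_(x0 in A) f x0)%:E)%E.
  by rewrite /Rintegral fineK//; exact: integrable_fin_num iA.
rewrite lee_fin; move: iA; rewrite Ar => iA.
apply: ae_le_Rintegral_cst => //; first exact: ltW.
apply: ae_imp FfV => t h txy.
have : A t by rewrite Ar.
move=> [txy' tab]; rewrite leNgt -Flt h// -leNgt.
by apply: Vc; move: txy'; rewrite /= in_itv/= => /andP[/ltW-> ->].
Qed.

(** * From slope bounds back to the density and the singular part *)

Section converse.
Context (a b : R) (F V : R -> R) (mu s : signed_measure R) (f : R -> R).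
Hypothesis V_cont : continuous V.
Hypothesis mu_out :
  forall A : set (measurableTypeR R), measurable A -> A `<=` ~` `]a, b[ -> mu A = 0%E.
Hypothesis mu_dec : lebesgue_decomposition mu f s.
Hypothesis mu_slope : forall x y, a < x -> x < y -> y < b -> slope_le F mu V x y.

Let sub c : set (measurableTypeR R) := `]a, b[ `&` [set z | V z < F c].

Let sub_meas c : measurable (sub c).
Proof.
apply: measurableI => //; rewrite -[X in measurable X]setTI.
have -> : [set z | V z < F c] = V @^-1` `]-oo, F c[.
  by apply/seteqP; split => z; rewrite /= in_itv.
have mV : measurable_fun [set: measurableTypeR R] V by exact: continuous_measurable_fun.
exact: mV.
Qed.

(** Lebesgue measure cut to ]a, b[ is finite, so that c leb - mu is again a charge. *)
Let lebI : {finite_measure set (measurableTypeR R) -> \bar R} :=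
  mfrestr (measurable_itvR `]a, b[) (leb_itv_lty a b false true).

(** Around each point of the open set where V < F c, the slope bound makes c leb - mu nonnegative on
    short intervals; [charge_ge0_local] extends this to Borel sets. *)
Lemma charge_le_of_slope c (A : set (measurableTypeR R)) : measurable A -> A `<=` sub c ->
  (mu A <= c%:E * leb R A)%E.
Proof.
move=> mA Ac.
pose rho : signed_measure R := cadd (cscale c (charge_of_finite_measure lebI)) (copp mu).
have rhoE B : rho B = (c%:E * leb R (B `&` `]a, b[) - mu B)%E by [].
have : (0 <= rho A)%E.
  apply: (@charge_ge0_local _ rho (sub c)) => // z [zab Vz].
  have nb : \forall t \near z, (t \in `]a, b[) /\ V t < F c.
    apply: filterI; first exact: near_in_itvoo.
    have Vz' : {for z, continuous V} by exact: V_cont.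
    by move/cvgr_lt : Vz'; apply.
  move: nb => /nbhs_ballP[r /= r0 Hr].
  have Hr' t : z - r / 2 <= t -> t <= z + r / 2 -> (t \in `]a, b[) /\ V t < F c.
    by move=> t1 t2; apply: Hr; rewrite /ball/= ltr_norml; apply/andP; split; lra.
  exists (z - r / 2), (z + r / 2); split; [lra|lra|].
  move=> x y zx xy yz.
  have [xab _] := Hr' x zx (le_trans (ltW xy) yz).
  have [yab _] := Hr' y (le_trans zx (ltW xy)) yz.
  move: xab yab; rewrite !in_itv/= => /andP[ax xb] /andP[ay yb].
  rewrite rhoE (_ : _ `&` _ = `]x, y]%classic); last first.
    by apply/seteqP; split => t /=; rewrite !in_itv/= => *; [|split => //]; lra.
  have lebE : leb R `]x, y]%classic = (y - x)%:E.
    by have := @lebesgue_measure_itv R `]x, y] => /= ->; rewrite lte_fin xy EFinB.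
  rewrite sube_ge0 ?fin_num_measure// lebE -EFinM.
  apply: mu_slope => // t /andP[xt ty].
  by apply: ltW; have [] := Hr' t (le_trans zx xt) (le_trans ty yz).
rewrite rhoE sube_ge0 ?fin_num_measure// setIidl//.
by move=> t /Ac[].
Qed.

(** [s] lives on a Lebesgue-null set, where it coincides with [mu], and mu <= c leb = 0 there. *)
Lemma sing_le0 c (A : set (measurableTypeR R)) : measurable A -> A `<=` sub c -> (s A <= 0)%E.
Proof.
move=> mA Ac; have [intf [N [mN N0 sN]] muE] := mu_dec.
have mAN : measurable (A `&` N) by exact: measurableI.
have lAN : leb R (A `&` N) = 0%E.
  by apply/eqP; rewrite eq_le measure_ge0 andbT -N0 le_measure ?inE//; exact: subIsetr.
have -> : s A = mu (A `&` N).
  rewrite (chargeDI s mA mN) sN; [|exact: measurableD|by move=> z []].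
  rewrite add0e muE// (_ : \int[leb R]_(x in A `&` N) (f x)%:E = 0)%E ?add0e//.
  apply: null_set_integral => //; apply: measurable_funTS.
  by have /integrableP[] := intf.
apply: (le_trans (charge_le_of_slope (c := c) mAN _)); first by move=> z [/Ac].
by rewrite lAN mule0.
Qed.

(** On the set [B] where f > c, off the null carrier of [s], the integral of [f] is mu(B) <= c
    leb(B). So f - c is nonnegative on [B] with integral 0, and [B] is null. *)
Lemma density_le c : {ae leb R, forall z, sub c z -> f z <= c}.
Proof.
have [intf [N [mN N0 sN]] muE] := mu_dec.
have mf : measurable_fun [set: measurableTypeR R] f by have /integrableP[/measurable_EFinP] := intf.
pose B : set (measurableTypeR R) := (sub c `&` [set z | c < f z]) `\` N.
have mB : measurable B.
  apply: measurableD => //; apply: measurableI; first exact: sub_meas.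
  have -> : [set z | c < f z] = [set: R] `&` f @^-1` `]c, +oo[.
    by rewrite setTI; apply/seteqP; split => z; rewrite /= in_itv/= andbT.
  exact: mf.
have Bab : B `<=` `]a, b[ by move=> z [[[]]].
have lB : (leb R B < +oo)%E.
  by apply: le_lt_trans (leb_itv_lty a b false true); rewrite le_measure ?inE.
have ifB : (leb R).-integrable B (EFin \o f) by exact: integrableS intf.
have icB : (leb R).-integrable B (EFin \o (cst c : R -> R)).
  apply: measurable_bounded_integrable => //.
  by exists `|c|; split; [exact: num_real|move=> M cM z _; exact: ltW].
have B0 : (\int[leb R]_(z in B) `|(f z - c)%:E| = 0)%E.
  apply/eqP; rewrite eq_le integral_ge0// andbT.
  have -> : (\int[leb R]_(z in B) `|(f z - c)%:E| =
      \int[leb R]_(z in B) ((EFin \o f) \- (EFin \o (cst c : R -> R))) z)%E.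
    apply: eq_integral => z /set_mem [[_ /= cz] _].
    by rewrite -EFinB ger0_norm// subr_ge0 ltW.
  have -> : (\int[leb R]_(z in B) ((EFin \o f) \- (EFin \o (cst c : R -> R))) z =
      \int[leb R]_(z in B) (f z)%:E - c%:E * leb R B)%E.
    rewrite [LHS](integralB mB ifB icB); congr (_ - _)%E.
    exact: (integral_cst _ mB c%:E).
  have := muE B mB; rewrite [s B]sN//; last by move=> z [].
  have cB : (c%:E * leb R B)%E \is a fin_num by apply: fin_numM => //; rewrite ge0_fin_numE.
  rewrite adde0 => <-; rewrite leeBlDr// add0e.
  by apply: charge_le_of_slope => // z [[]].
have mfc : measurable_fun B (fun z => (f z - c)%:E).
  by apply/measurable_EFinP/measurable_funB => //; exact: measurable_funTS.
have := (ae_eq_integral_abs (leb R) mB mfc).1 B0.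
have aeN : {ae leb R, forall z, ~ N z}.
  by exists N; split => // z /contrapT.
apply: ae_imp2 aeN => z NN H Uz.
rewrite leNgt; apply/negP => cz.
have Bz : B z by [].
by have := H Bz; move/eqP; rewrite eqe subr_eq0 => /eqP fc; move: cz; rewrite fc ltxx.
Qed.

End converse.
End slopes.

(** * The chosen derivatives, uniqueness of charges, and moduli of continuity *)

Section specifications.
Context {R : realType}.
Implicit Types (a b p : R) (u v w : R -> R) (mu nu : signed_measure R).

Lemma Du_spec a b u : BV a b u -> distributional_derivative a b u (Du a b u).
Proof. by move=> [_ [mu Hmu]]; apply: (@xgetPex _ _ (distributional_derivative a b u)); exists mu. Qed.

Lemma lebesgue_parts_spec mu :
  lebesgue_decomposition mu (lebesgue_parts mu).1 (lebesgue_parts mu).2.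
Proof.
rewrite /lebesgue_parts; apply: (@xgetPex _ _ [set fs | lebesgue_decomposition mu fs.1 fs.2]).
have [f [N [intf mN N0 muE]]] := lebesgue_decomposition_exists mu.
exists (f, crestr0 mu mN : signed_measure R); split => //=.
- exists N; split => // A mA AN; rewrite /crestr0 mem_set// /crestr.
  rewrite (_ : A `&` N = set0) ?charge0//.
  by apply/seteqP; split => // z [/AN].
- by move=> A mA; rewrite muE// /crestr0 mem_set.
Qed.

Lemma weak_deriv_spec a b p v : W1p a b p v ->
  Lp a b p%:E (weak_deriv a b p v) /\ weak_derivative a b v (weak_deriv a b p v).
Proof.
move=> [_ [w Lw vw]].
by apply: (@xgetPex _ _ [set w | Lp a b p%:E w /\ weak_derivative a b v w]); exists w.
Qed.

(** The modulus depends on [w] only through the energy bound. With tangent slope p (2 K / e + 1), an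
    increment larger than e would cost more than K + e, whereas [d] keeps the remaining term (p-1)
    t^p (y - x) below e. *)
Lemma prim_modulus p K (e : R) : 1 < p -> 0 <= K -> 0 < e ->
  exists2 d : R, 0 < d & forall a b w x y, Lp a b p%:E w ->
    (energy a b p w <= K%:E)%E -> `|x - y| <= d -> `|prim a b w x - prim a b w y| <= e.
Proof.
move=> p1 K0 e0.
have K'0 : 0 <= 2 * K / e by rewrite !mulr_ge0// invr_ge0 ltW.
have [t t0 tE] := tangent_slope_large p1 K'0.
have A0 := powR_ge0 t p; set A := t `^ p in A0.
have A1 : 0 < (p - 1) * A + 1 by rewrite ltr_wpDl// mulr_ge0//; lra.
exists (e / ((p - 1) * A + 1)); first by rewrite divr_gt0.
have main a b w x y : x <= y -> Lp a b p%:E w -> (energy a b p w <= K%:E)%E ->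
    y - x <= e / ((p - 1) * A + 1) -> `|prim a b w y - prim a b w x| <= e.
  move=> xy wLp wK yx; have p0 : 0 < p by lra.
  have [mw ew] := (Lp_energy a b w p0).1 wLp.
  have := prim_energy p1 (ltW t0) xy wLp; rewrite tE.
  have E1 := energy_cdf_le y mw ew; have E2 := energy_cdf_ge0 a b p w x.
  have EK : fine (energy a b p w) <= K.
    by rewrite -lee_fin fineK// ge0_fin_numE// energy_ge0.
  move: yx; rewrite ler_pdivlMr// => yx.
  have := normr_ge0 (prim a b w y - prim a b w x); set D := `|_| => D0 H.
  have H1 : p * (2 * K / e + 1) * D <= K + e.
    apply: (le_trans H); rewrite -/A.
    have : (y - x) * ((p - 1) * A) <= e by nra.
    by nra.
  have H2 : (2 * K / e + 1) * D <= K + e.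
    have Q0 : 0 <= (2 * K / e + 1) * D by apply: mulr_ge0 => //; lra.
    have : 0 <= (p - 1) * ((2 * K / e + 1) * D) by apply: mulr_ge0 => //; lra.
    move: H1; rewrite -(mulrA p); lra.
  have eE : 2 * K / e * e = 2 * K by rewrite mulfVK// gt_eqF.
  rewrite leNgt; apply/negP => eD.
  have : 2 * K / e * e <= 2 * K / e * D by apply: ler_wpM2l => //; exact: ltW.
  by nra.
move=> a b w x y wLp wK xyd; have [xy|/ltW yx] := leP x y.
  by rewrite distrC; apply: main => //; apply: le_trans xyd; rewrite distrC ler_norm.
by apply: main => //; apply: le_trans xyd; rewrite ler_norm.
Qed.

Lemma prim_continuous a b p w : 1 < p -> Lp a b p%:E w -> continuous (prim a b w).
Proof.
move=> p1 wLp; have p0 : 0 < p by lra.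
have [mw ew] := (Lp_energy a b w p0).1 wLp.
have eE : energy a b p w = (fine (energy a b p w))%:E.
  by rewrite fineK// ge0_fin_numE// energy_ge0.
have K0 : 0 <= fine (energy a b p w) by apply: fine_ge0; exact: energy_ge0.
move=> x; apply/cvgrPdist_le => e e0.
have [d d0 Hd] := prim_modulus p1 K0 e0.
near=> y; have xyd : `|x - y| < d.
  by near: y; apply/nbhs_ballP; exists d.
by apply: Hd; rewrite -?eE// ltW.
Unshelve. all: by end_near. Qed.

Lemma ae_le_continuous a b (g : R -> R) (c : R) : a < b -> continuous g ->
  {ae leb R, forall x, x \in `]a, b[ -> g x <= c} -> forall x, x \in `[a, b] -> g x <= c.
Proof.
move=> ab gc H x xab; rewrite leNgt; apply/negP => cx.
have gx : {for x, continuous g} by exact: gc.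
have : \forall y \near x, c < g y by move/cvgr_gt : gx; apply.
move=> /nbhs_ballP[r /= r0 Hr].
move: xab; rewrite in_itv/= => /andP[ax xb].
have lt : Num.max a (x - r) < Num.min b (x + r).
  by rewrite gt_max !lt_min; apply/andP; split; apply/andP; split; lra.
have [y] := ae_exists_itv lt H.
rewrite in_itv/= gt_max lt_min => /andP[/andP[ay xy] /andP[yb yx]] Hy.
have := Hr y; rewrite /ball/= ltr_norml => /(_ _) h.
have : c < g y by apply: h; apply/andP; split; lra.
by rewrite ltNge Hy// in_itv/= ay.
Qed.

Lemma cdf_right_continuous mu : right_continuous (cdf mu).
Proof.
move=> x; rewrite (_ : cdf mu = cdf (jordan_pos (hahnP mu)) \- cdf (jordan_neg (hahnP mu))); last first.
  by apply/funext => y; exact: cdf_sub.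
by apply: cvgB; exact: cdf_rc.
Qed.

Lemma ae_eq_right_continuous a b (g h : R -> R) :
  (forall x, x \in `]a, b[ -> g y @[y --> x^'+] --> g x) ->
  (forall x, x \in `]a, b[ -> h y @[y --> x^'+] --> h x) ->
  {ae leb R, forall x, x \in `]a, b[ -> g x = h x} -> forall x, x \in `]a, b[ -> g x = h x.
Proof.
move=> grc hrc H x xab; move: (xab); rewrite in_itv/= => /andP[ax xb].
have c : (g y - h y) @[y --> x^'+] --> g x - h x by apply: cvgB; [exact: grc|exact: hrc].
apply/eqP; rewrite -subr_eq0; apply: contraT => l0.
have : \forall y \near x^'+, `|(g x - h x) - (g y - h y)| < `|g x - h x|.
  by move/cvgrPdist_lt : c; apply; rewrite normr_gt0.
move=> /nbhs_ballP[r /= r0 Hr].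
have lt : x < Num.min b (x + r) by rewrite lt_min xb ltrDl.
have [y] := ae_exists_itv lt H.
rewrite in_itv/= lt_min => /andP[xy /andP[yb yr]] Hy.
have := Hr y; rewrite /ball/= ltr_norml => /(_ _ xy).
rewrite Hy ?subrr ?subr0 ?ltxx; last by rewrite in_itv/= (lt_trans ax xy).
by apply; apply/andP; split; lra.
Qed.

(** [charge_ge0_local] applied to both differences inside ]a, b[; outside, both charges vanish. *)
Lemma charge_unique mu nu a b :
  (forall A : set (measurableTypeR R), measurable A -> A `<=` ~` `]a, b[ -> mu A = 0%E) ->
  (forall A : set (measurableTypeR R), measurable A -> A `<=` ~` `]a, b[ -> nu A = 0%E) ->
  (forall x y, a < x -> x < y -> y < b -> mu `]x, y]%classic = nu `]x, y]%classic) ->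
  forall A : set (measurableTypeR R), measurable A -> mu A = nu A.
Proof.
move=> mu0 nu0 munu A mA.
have in_loc z : `]a, b[%classic z -> exists c d : R, [/\ c < z, z < d, a < c & d < b].
  rewrite /= in_itv/= => /andP[az zb]; exists ((a + z) / 2), ((z + b) / 2); split; lra.
have main (m1 m2 : signed_measure R) :
    (forall x y, a < x -> x < y -> y < b -> m1 `]x, y]%classic = m2 `]x, y]%classic) ->
    forall B : set (measurableTypeR R), measurable B -> B `<=` `]a, b[ -> (m1 B <= m2 B)%E.
  move=> H B mB Bab; pose rho : signed_measure R := cadd m2 (copp m1).
  have rhoE C : rho C = (m2 C - m1 C)%E by [].
  rewrite -sube_ge0 ?fin_num_measure// -rhoE.
  apply: (charge_ge0_local (U := `]a, b[%classic)) => // z /in_loc[c [d [cz zd ac db]]].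
  exists c, d; split => // x y cx xy yd; rewrite rhoE H ?subee ?fin_num_measure//.
  - exact: lt_le_trans cx.
  - exact: le_lt_trans db.
rewrite (chargeDI mu mA (measurable_itvR `]a, b[)) (chargeDI nu mA (measurable_itvR `]a, b[)).
have mD : measurable (A `\` `]a, b[ : set (measurableTypeR R)) by exact: measurableD.
have mI : measurable (A `&` `]a, b[ : set (measurableTypeR R)) by exact: measurableI.
have -> : mu (A `\` `]a, b[) = 0%E by apply: mu0 => // z [].
have -> : nu (A `\` `]a, b[) = 0%E by apply: nu0 => // z [].
congr (_ + _)%E; apply/eqP; rewrite eq_le; apply/andP; split.
  by apply: main => //; exact: subIsetr.
by apply: main => [x y ax xy yb| |]//; rewrite munu.
Qed.

(** Minimality of the Jordan decomposition: evaluate [mu] on its two Hahn sets and drop the terms of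
    unfavourable sign. *)
Lemma total_var_le mu (P N : {finite_measure set (measurableTypeR R) -> \bar R}) :
  (forall A : set (measurableTypeR R), measurable A -> mu A = (P A - N A)%E) ->
  (total_var mu setT <= P setT + N setT)%E.
Proof.
move=> muE; rewrite total_varE.
have [[mH _] [mH' _] HH HI] := hahnP mu.
rewrite pos_partE// neg_partE// !setTI !muE//.
rewrite fin_num_oppeB ?fin_num_measure//.
have h (m : {finite_measure set (measurableTypeR R) -> \bar R}) : (m (hahn_pos mu) + m (hahn_neg mu) = m setT)%E.
  by rewrite -measureU// HH.
rewrite -!h.
have fP1 := fin_num_measure P _ mH; have fP2 := fin_num_measure P _ mH'.
have fN1 := fin_num_measure N _ mH; have fN2 := fin_num_measure N _ mH'.
have g1 : (0 <= P (hahn_neg mu))%E by exact: measure_ge0.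
have g2 : (0 <= N (hahn_pos mu))%E by exact: measure_ge0.
move: fP1 fP2 fN1 fN2 g1 g2.
move: (P _) (P _) (N _) (N _) => [r1| |] [r2| |] [r3| |] [r4| |] //= _ _ _ _.
rewrite -!EFinD !lee_fin; clear; lra.
Qed.

End specifications.

(** * From membership in X to slope bounds *)

Section representation.
Context {R : realType}.
Implicit Types (a b p c d : R) (u v w f F : R -> R) (mu nu s : signed_measure R).

Lemma cvg_pinfty_not_le (f : R -> R) c : (f e)%:E @[e --> 0^'+] --> +oo%E ->
  (\forall e \near 0^'+, f e <= c) -> False.
Proof.
move=> h0 h'; have h : \forall e \near 0^'+, (c%:E < (f e)%:E)%E by move: c {h'}; apply/cvgeyPgt.
near (0 : R)^'+ => e.
have h1 : (c%:E < (f e)%:E)%E by near: e.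
have h2 : f e <= c by near: e.
by move: h1; rewrite lte_fin => /lt_le_trans /(_ h2); rewrite ltxx.
Unshelve. all: by end_near. Qed.

Lemma coppE nu (A : set (measurableTypeR R)) : (copp nu : signed_measure R) A = (- nu A)%E.
Proof. by []. Qed.

Lemma lebesgue_decomposition_opp mu f s : lebesgue_decomposition mu f s ->
  lebesgue_decomposition (copp mu) (fun t => - f t) (copp s).
Proof.
move=> [intf [N [mN N0 sN]] muE]; split; first exact: integrable_opp.
- by exists N; split => // A mA AN; rewrite coppE sN// oppe0.
- move=> A mA; rewrite coppE muE//.
  have iA : (leb R).-integrable A (EFin \o f) by exact: integrableS intf.
  rewrite fin_num_oppeD; last by rewrite fin_num_measure.
  congr (_ + _)%E; rewrite -integralN//=.
  by apply: fin_num_adde_defl; rewrite fin_numN (integrable_neg_fin_num mA iA).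
Qed.

Lemma null_of_concentrated (m : {measure set (measurableTypeR R) -> \bar R}) (Z : set R)
    (A : set (measurableTypeR R)) :
  concentrated_on m Z -> measurable A -> A `<=` ~` Z -> m A = 0%E.
Proof.
move=> [B [mB B0 ZB]] mA AZ; apply/eqP; rewrite eq_le measure_ge0 andbT -B0.
by apply: le_measure; rewrite ?inE// => z /AZ /ZB.
Qed.

Definition slopes a b F mu (V : R -> R) := forall x y, a < x -> x < y -> y < b ->
  slope_le F mu V x y /\ slope_le (flip F) (copp mu) (fun t => - V t) x y.

(** A point where the averages of the density stay bounded above is not in Z^+, so a set of such
    points carries no positive singular mass and [slope_le_of_density] applies. The lower bound is
    the same statement for the reflected data. *)
Lemma X_slopes a b p psi u (V : R -> R) : let F := PsiR p psi in
  (forall x y, (F x < F y) = (x < y)) -> continuous V ->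
  {ae leb R, forall t, t \in `]a, b[ -> F (Da a b u t) = V t} ->
  X a b p psi u -> slopes a b F (Du a b u) V.
Proof.
move=> F Flt Vc FV [bvu _ cp cn] x y ax xy yb.
have [mu0 _] := Du_spec bvu.
have dec : lebesgue_decomposition (Du a b u) (Da a b u) (Ds a b u) := lebesgue_parts_spec _.
have intf : (leb R).-integrable setT (EFin \o Da a b u) by case: dec.
split.
- apply: (slope_le_of_density Flt Vc mu0 dec FV) => //; [|exact: ltW|exact: ltW].
  move=> A mA Aab HA; rewrite jordanE//.
  rewrite (null_of_concentrated cp mA) ?sub0e ?oppe_le0 ?measure_ge0//.
  move=> z Az; have [c Hc] := HA z Az; by case=> _ /cvg_pinfty_not_le; apply; exact: Hc.
- apply: (slope_le_of_density (flip_lt Flt) (a := a) (b := b) (f := fun t => - Da a b u t) (s := copp (Ds a b u))) => //.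
  + by move=> z; apply: cvgN; exact: Vc.
  + by move=> A mA Aab; rewrite coppE mu0// oppe0.
  + exact: lebesgue_decomposition_opp.
  + by apply: ae_imp FV => t h tab; rewrite /flip opprK h.
  + move=> A mA Aab HA; rewrite coppE oppe_le0 jordanE//.
    rewrite (null_of_concentrated cn mA) ?sube0 ?measure_ge0//.
    move=> z Az; have [c Hc] := HA z Az; move=> [_] /cvgeN H.
    apply: (@cvg_pinfty_not_le (avg (fun t => - Da a b u t) z) c) => //.
    by under eq_fun do rewrite avgN// EFinN.
  + exact: ltW.
  + exact: ltW.
Qed.

(* [V] bounds the slopes of [u] from both sides; this replaces the conditions on
   the density and on the concentration of the singular part, and is stable under limits. *)
Definition represented a b p F u c mu d w := [/\
  (forall A : set (measurableTypeR R), measurable A -> A `<=` ~` `]a, b[ -> mu A = 0%E),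
  {ae leb R, forall x, x \in `]a, b[ -> u x = c + cdf mu x},
  Lp a b p%:E w & slopes a b F mu (fun x => d + prim a b w x)].

Lemma X_represented a b p psi u : let F := PsiR p psi in a < b -> 1 < p ->
  (forall x y, (F x < F y) = (x < y)) -> continuous F ->
  (exists M, forall x, 0 <= F x <= M) -> X a b p psi u ->
  exists c d, represented a b p F u c (Du a b u) d (weak_deriv a b p (Psi_Da a b p psi u)) /\
    {ae leb R, forall x, x \in `]a, b[ ->
      F (Da a b u x) = d + prim a b (weak_deriv a b p (Psi_Da a b p psi u)) x}.
Proof.
move=> F ab p1 Flt Fc [M HM] uX; have [bvu Wv _ _] := uX.
have DuS := Du_spec bvu; have [mu0 _] := DuS.
have [iu _] := bvu.
have [c uc] := distributional_derivative_cdf ab iu DuS.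
have [Lw vw] := weak_deriv_spec Wv; set w := weak_deriv _ _ _ _ in Lw vw *.
have iw := Lp_integrable p1 Lw.
have iv : (leb R).-integrable `]a, b[ (EFin \o Psi_Da a b p psi u).
  by apply: Lp_integrable p1 _; case: Wv.
have [d vd] := weak_derivative_prim ab iv iw vw.
exists c, d; split => //; split => //.
apply: X_slopes => // x; apply: cvgD; first exact: cvg_cst.
exact: (prim_continuous p1 Lw).
Qed.

End representation.

(** * From slope bounds to membership in X *)

Section membership.
Context {R : realType}.
Implicit Types (a b p c d : R) (u v w f F : R -> R) (mu nu s : signed_measure R).

(** The charges with densities [w] and [w'] have the same increments inside ]a, b[, hence coincide.
    This identifies the weak derivative picked by [xget] with a known one. *)
Lemma prim_injective a b w w' d d' : a < b ->
  (leb R).-integrable `]a, b[ (EFin \o w) -> (leb R).-integrable `]a, b[ (EFin \o w') ->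
  (forall x, x \in `]a, b[ -> d + prim a b w x = d' + prim a b w' x) ->
  {ae leb R, forall x, x \in `]a, b[ -> w x = w' x}.
Proof.
move=> ab iw iw' H.
have iw0 := integrable_restrict_itv iw; have iw0' := integrable_restrict_itv iw'.
pose m : signed_measure R := induced_charge iw0.
pose m' : signed_measure R := induced_charge iw0'.
have out f (if0 : (leb R).-integrable setT (EFin \o (f \_ `]a, b[))) (A : set (measurableTypeR R)) :
    measurable A -> A `<=` ~` `]a, b[ -> (induced_charge if0 : signed_measure R) A = 0%E.
  move=> mA Aab; rewrite -[LHS]/(\int[leb R]_(x in A) ((f \_ `]a, b[) x)%:E)%E.
  apply: integral0_eq => x /Aab xab.
  by rewrite patchE; case: ifPn => // /set_mem.
have mmE : forall A : set (measurableTypeR R), measurable A -> m A = m' A.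
  apply: (@charge_unique _ m m' a b); [exact: out|exact: out|].
  move=> x y ax xy yb.
  have xab : x \in `]a, b[ by rewrite in_itv/= ax (lt_trans xy).
  have yab : y \in `]a, b[ by rewrite in_itv/= yb (lt_trans ax).
  rewrite !chargeE_cdf ?ltW//.
  have -> : cdf m y - cdf m x = prim a b w y - prim a b w x by [].
  have -> : cdf m' y - cdf m' x = prim a b w' y - prim a b w' x by [].
  by congr EFin; move: (H x xab) (H y yab); clear; lra.
have aeE : ae_eq (leb R) setT (EFin \o (w \_ `]a, b[)) (EFin \o (w' \_ `]a, b[)).
  apply: integral_ae_eq => //.
    by have /integrableP[] := iw0'.
  by move=> A _ mA; exact: mmE.
apply: ae_imp aeE => x /(_ Logic.I) h xab.
by move: h; rewrite /= !patchE mem_set// => -[].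
Qed.

Lemma energy_ae a b p w w' : measurable_fun `]a, b[ w -> measurable_fun `]a, b[ w' ->
  {ae leb R, forall x, x \in `]a, b[ -> w x = w' x} -> energy a b p w = energy a b p w'.
Proof.
move=> mw mw' H; apply: ae_eq_integral => //.
- by apply/measurable_EFinP; exact: measurable_powR_norm.
- by apply/measurable_EFinP; exact: measurable_powR_norm.
- by apply: ae_imp H => x h xab; rewrite /= h.
Qed.

Lemma null_bigcup (m : {measure set (measurableTypeR R) -> \bar R})
    (B : nat -> set (measurableTypeR R)) :
  (forall n, measurable (B n)) -> (forall n, m (B n) = 0%E) -> m (\bigcup_n B n) = 0%E.
Proof.
move=> mB B0; have mU : measurable (\bigcup_n B n) by exact: bigcupT_measurable.
apply: (measure_negligible mU); apply: negligible_bigcup => n.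
by exists (B n); split.
Qed.

(** [A] collects the complement of ]a, b[ and the points where V < F n for some n. At any other
    point V exceeds every value of F, so the averages of [f] tend to +oo. On [A] the positive part
    of [s] is null, by [sing_le0] for each n. *)
Lemma sing_concentrated a b F (V : R -> R) mu s f :
  (forall x y, (F x < F y) = (x < y)) -> continuous V ->
  (forall A : set (measurableTypeR R), measurable A -> A `<=` ~` `]a, b[ -> mu A = 0%E) ->
  lebesgue_decomposition mu f s ->
  (forall x y, a < x -> x < y -> y < b -> slope_le F mu V x y) ->
  {ae leb R, forall t, t \in `]a, b[ -> F (f t) = V t} ->
  exists A : set (measurableTypeR R), [/\ measurable A,
    (forall z, ~ A z -> Zset a b f +oo%E z) &
    forall B : set (measurableTypeR R), measurable B -> B `<=` A -> (s B <= 0)%E].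
Proof.
move=> Flt Vc mu0 dec sl FV.
have [intf [N [mN N0 sN]] muE] := dec.
pose sub n : set (measurableTypeR R) := `]a, b[ `&` [set z | V z < F n%:R].
have msub n : measurable (sub n).
  apply: measurableI => //; rewrite -[X in measurable X]setTI.
  have -> : [set z | V z < F n%:R] = V @^-1` `]-oo, F n%:R[.
    by apply/seteqP; split => z; rewrite /= in_itv.
  have mV : measurable_fun [set: measurableTypeR R] V by exact: continuous_measurable_fun.
  exact: mV.
exists (~` `]a, b[ `|` \bigcup_n sub n); split.
- apply: measurableU; first exact: measurableC.
  exact: bigcupT_measurable.
- move=> z /not_orP[/contrapT zab zn]; split => //.
  apply/cvgeyPge => c.
  have cV : F c < V z.
    have [n cn] : exists n, c < n%:R.
      by exists (Num.truncn `|c|).+1; apply: le_lt_trans (ler_norm _) _; exact: truncnS_gt.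
    apply: (@lt_le_trans _ _ (F n%:R)); first by rewrite Flt.
    by rewrite leNgt; apply/negP => h; apply: zn; exists n.
  have := avg_ge intf Flt (Vc z) FV zab cV.
  by apply: filterS => e h; rewrite lee_fin.
- move=> B mB BA.
  (* Outside ]a, b[ [mu] vanishes, and on the null carrier of [s] the density contributes nothing,
     so [s] vanishes there as well. *)
  have Bpart A : measurable A -> A `<=` ~` `]a, b[ -> s A = 0%E.
    move=> mA Aab; have mAN : measurable (A `&` N) by exact: measurableI.
    rewrite (chargeDI s mA mN) sN; [|exact: measurableD|by move=> t []].
    have := muE _ mAN; rewrite mu0//; last by move=> t [/Aab].
    rewrite (_ : \int[leb R]_(x in A `&` N) (f x)%:E = 0)%E ?add0e//.
    apply: null_set_integral => //; first by apply: measurable_funTS; have /integrableP[] := intf.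
    by apply/eqP; rewrite eq_le measure_ge0 andbT -N0 le_measure ?inE//; exact: subIsetr.
  have mPs : measurable (hahn_pos s) by have [[]] := hahnP s.
  have sub0 n : pos_part s (sub n) = 0%E.
    apply/eqP; rewrite eq_le measure_ge0 andbT pos_partE//.
    apply: (@sing_le0 _ a b F V mu s f Vc dec sl n%:R); first exact: measurableI.
    by move=> z [].
  have out0 : pos_part s (~` `]a, b[ : set (measurableTypeR R)) = 0%E.
    by rewrite pos_partE; [|exact: measurableC]; apply: Bpart; [apply: measurableI => //; exact: measurableC|move=> z []].
  have P0 : pos_part s (~` `]a, b[ `|` \bigcup_n sub n) = 0%E.
    apply/eqP; rewrite eq_le measure_ge0 andbT.
    apply: le_trans (measureU2 _ _ _) _; [exact: measurableC|exact: bigcupT_measurable|].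
    apply: (@le_trans _ _ (0 + 0)%E); last by rewrite adde0.
    apply: leeD; first exact: (eq_ind_r (fun x => x <= 0)%E (lexx _) out0).
    exact: (eq_ind_r (fun x => x <= 0)%E (lexx _) (null_bigcup msub sub0)).
  rewrite jordanE// (_ : pos_part s B = 0%E) ?sub0e ?oppe_le0 ?measure_ge0//.
  apply/eqP; rewrite eq_le measure_ge0 andbT -P0 le_measure ?inE//.
  by apply: measurableU; [exact: measurableC|exact: bigcupT_measurable].
Qed.

(** Almost everywhere and for all rational r at once, V < F r implies f <= r, and V > F r implies f
    >= r. If F (f z) and V z differed, continuity of F at f z would give a rational r violating one
    of these. *)
Lemma density_eq a b F (V : R -> R) mu s f :
  (forall x y, (F x < F y) = (x < y)) -> continuous F -> continuous V ->
  (forall A : set (measurableTypeR R), measurable A -> A `<=` ~` `]a, b[ -> mu A = 0%E) ->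
  lebesgue_decomposition mu f s -> slopes a b F mu V ->
  {ae leb R, forall t, t \in `]a, b[ -> F (f t) = V t}.
Proof.
move=> Flt Fc Vc mu0 dec sl.
(* An enumeration of the rationals; the default 0 merely repeats one of them. *)
pose q n : R := if unpickle n is Some r then ratr (r : rat) else 0.
have H1 n : {ae leb R, forall z, (`]a, b[ `&` [set z | V z < F (q n)]) z -> f z <= q n}.
  apply: (density_le Vc dec) => x y ax xy yb.
  by have [] := sl x y ax xy yb.
have H2 n : {ae leb R, forall z, (`]a, b[ `&` [set z | - V z < flip F (- q n)]) z -> - f z <= - q n}.
  apply: (@density_le _ a b (flip F) (fun z => - V z) (copp mu) (copp s) (fun z => - f z)) => //.
  - by move=> z; apply: cvgN; exact: Vc.
  - exact: lebesgue_decomposition_opp.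
  - by move=> x y ax xy yb; have [] := sl x y ax xy yb.
apply: ae_imp2 (ae_foralln H1) (ae_foralln H2) => z {}H1 {}H2 zab.
have key (G : R -> R) (x0 v : R) : {for x0, continuous G} -> (forall x y, (G x < G y) = (x < y)) ->
    G x0 < v -> exists r : rat, x0 < ratr r /\ G (ratr r) < v.
  move=> Gc Glt Gv.
  have : \forall t \near x0, G t < v by move/cvgr_lt : Gc; apply.
  move=> /nbhs_ballP[e /= e0 He].
  have [r] := rat_in_itvoo (ltr_pwDr e0 (lexx x0)); rewrite in_itv/= => /andP[r1 r2].
  exists r; split => //; apply: He; rewrite /ball/= ltr_norml; apply/andP; split; lra.
apply/eqP; rewrite eq_le !leNgt; apply/andP; split; apply/negP => h.
- have nc : {for - f z, continuous (flip F)}.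
    apply: cvgN; apply: (@continuous_comp _ _ _ (fun x => - x) F); [exact: opp_continuous|exact: Fc].
  have nlt : flip F (- f z) < - V z by rewrite /flip opprK ltrN2.
  have [r [r1 r2]] := key (flip F) (- f z) (- V z) nc (flip_lt Flt) nlt.
  have qr : q (pickle (- r)) = - ratr r by rewrite /q pickleK rmorphN.
  have := H1 (pickle (- r)); rewrite qr => /(_ _)/le_lt_trans {}H1.
  have Fr : V z < F (- ratr r) by move: r2; rewrite /flip ltrN2.
  by have := H1 (f z) (conj zab Fr); rewrite ltrNl => /(_ r1); rewrite ltxx.
- have [r [r1 r2]] := key F (f z) (V z) (Fc _) Flt h.
  have qr : q (pickle r) = ratr r by rewrite /q pickleK.
  have := H2 (pickle r); rewrite qr /flip/= opprK ltrN2 lerN2 => {}H2.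
  by have := lt_le_trans r1 (H2 (conj zab r2)); rewrite ltxx.
Qed.

Lemma Du_unique a b u c mu : a < b -> (leb R).-integrable `]a, b[ (EFin \o u) ->
  (forall A : set (measurableTypeR R), measurable A -> A `<=` ~` `]a, b[ -> mu A = 0%E) ->
  {ae leb R, forall x, x \in `]a, b[ -> u x = c + cdf mu x} ->
  BV a b u /\ forall A : set (measurableTypeR R), measurable A -> Du a b u A = mu A.
Proof.
move=> ab iu mu0 uc.
have bvu : BV a b u by split => //; exists mu; exact: cdf_distributional_derivative uc.
split=> //; have DuS := Du_spec bvu; have [Du0 _] := DuS.
have [c' uc'] := distributional_derivative_cdf ab iu DuS.
have E x : x \in `]a, b[ -> c' + cdf (Du a b u) x = c + cdf mu x.
  apply: (@ae_eq_right_continuous _ a b (fun x => c' + cdf (Du a b u) x) (fun x => c + cdf mu x)).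
  - by move=> y _; apply: cvgD; [exact: cvg_cst|exact: cdf_right_continuous].
  - by move=> y _; apply: cvgD; [exact: cvg_cst|exact: cdf_right_continuous].
  - by apply: ae_imp2 uc uc' => y h1 h2 yab; rewrite -h1// -h2.
apply: (charge_unique Du0 mu0) => x y ax xy yb.
have xab : x \in `]a, b[ by rewrite in_itv/= ax (lt_trans xy).
have yab : y \in `]a, b[ by rewrite in_itv/= yb (lt_trans ax).
rewrite !chargeE_cdf ?ltW//; congr EFin.
by have := E x xab; have := E y yab; clear; lra.
Qed.

Lemma slopes_eq a b F mu nu (V : R -> R) :
  (forall A : set (measurableTypeR R), measurable A -> mu A = nu A) ->
  slopes a b F nu V -> slopes a b F mu V.
Proof.
move=> E H x y ax xy yb; have [H1 H2] := H x y ax xy yb; split => c Hc.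
  by rewrite E//; exact: H1.
by rewrite coppE E//; exact: H2.
Qed.

(** Converse of [X_represented]. [Du] and [weak_deriv] are choices of [xget] and have to be
    identified: the former with [mu] by comparing right-continuous distribution functions, the
    latter with [w], almost everywhere, by [prim_injective]. *)
Lemma represented_X a b p psi u c mu d w : let F := PsiR p psi in a < b -> 1 < p ->
  (forall x y, (F x < F y) = (x < y)) -> continuous F ->
  (exists M, forall x, 0 <= F x <= M) ->
  (leb R).-integrable `]a, b[ (EFin \o u) -> represented a b p F u c mu d w ->
  [/\ X a b p psi u,
    forall A : set (measurableTypeR R), measurable A -> Du a b u A = mu A &
    energy a b p (weak_deriv a b p (Psi_Da a b p psi u)) = energy a b p w].
Proof.
move=> F ab p1 Flt Fc [M HM] iu [mu0 uc Lw sl].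
have p0 : 0 < p by lra.
have [bvu DuE] := Du_unique ab iu mu0 uc.
have [Du0 _] := Du_spec bvu.
set V := fun x => d + prim a b w x in sl.
have Vc : continuous V.
  by move=> x; apply: cvgD; [exact: cvg_cst|exact: (prim_continuous p1 Lw)].
have dec : lebesgue_decomposition (Du a b u) (Da a b u) (Ds a b u) := lebesgue_parts_spec _.
have {}sl : slopes a b F (Du a b u) V by exact: slopes_eq sl.
have FV := density_eq Flt Fc Vc Du0 dec sl.
have iw := Lp_integrable p1 Lw.
have mDa : measurable_fun [set: measurableTypeR R] (Da a b u).
  by have [/integrableP[/measurable_EFinP]] := dec.
have mF : measurable_fun [set: measurableTypeR R] (fun x => F (Da a b u x)).
  by apply: (measurableT_comp _ mDa); exact: continuous_measurable_fun.
have LF : Lp a b p%:E (Psi_Da a b p psi u).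
  apply/(Lp_energy _ _ _ p0); split; first exact: measurable_funTS mF.
  have : (leb R).-integrable `]a, b[ (EFin \o (fun x => `|F (Da a b u x)| `^ p)).
    apply: (integrable_bounded_itv (M := M `^ p)).
      by apply: measurable_powR_norm; exact: measurable_funTS mF.
    move=> x _; rewrite ger0_norm ?powR_ge0//.
    have /andP[h1 h2] := HM (Da a b u x).
    rewrite ger0_norm//; apply: ge0_ler_powR => //; first exact: ltW.
    by rewrite nnegrE; exact: le_trans h2.
  move=> /integrableP[_]; apply: le_lt_trans; rewrite le_eqVlt; apply/orP; left; apply/eqP.
  by rewrite /energy; apply: eq_integral => x _ /=; congr EFin; rewrite [RHS]ger0_norm// powR_ge0.
have iv := Lp_integrable p1 LF.
have wd : weak_derivative a b (Psi_Da a b p psi u) w by exact: prim_weak_derivative iv iw FV.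
have W1 : W1p a b p (Psi_Da a b p psi u) by split => //; exists w.
have [Lw' wd'] := weak_deriv_spec W1.
have uX : X a b p psi u.
  split => //.
  - have [A [mA AZ sA]] := sing_concentrated Flt Vc Du0 dec (fun x y ax xy yb => (sl x y ax xy yb).1) FV.
    exists A; split => //; last by move=> z nz; apply: contrapT => /AZ.
    have mPs : measurable (hahn_pos (Ds a b u)) by have [[]] := hahnP (Ds a b u).
    apply/eqP; rewrite eq_le measure_ge0 andbT pos_partE//.
    by apply: sA; [exact: measurableI|exact: subIsetl].
  - have Vc' : continuous (fun x => - V x) by move=> x; apply: cvgN; exact: Vc.
    have Du0' (A : set (measurableTypeR R)) : measurable A -> A `<=` ~` `]a, b[ -> (copp (Du a b u) : signed_measure R) A = 0%E.
      by move=> mA Aab; rewrite coppE Du0// oppe0.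
    have FV' : {ae leb R, forall t, t \in `]a, b[ -> flip F (- Da a b u t) = - V t}.
      by apply: ae_imp FV => t h tab; rewrite /flip opprK h.
    have [A [mA AZ sA]] := sing_concentrated (flip_lt Flt) Vc' Du0' (lebesgue_decomposition_opp dec) (fun x y ax xy yb => (sl x y ax xy yb).2) FV'.
    exists A; split => //; last first.
      move=> z nz; apply: contrapT => /AZ [zab] /cvgeN H; apply: nz; split => //.
      have [intf _ _] := dec.
      move: H; rewrite /=; apply: cvg_trans; apply: near_eq_cvg; near=> e.
      by have := avgN z e intf; rewrite /avg => ->; rewrite opprK.
    have mPs : measurable (hahn_neg (Ds a b u)) by have [_ []] := hahnP (Ds a b u).
    apply/eqP; rewrite eq_le measure_ge0 andbT neg_partE//.
    rewrite -coppE; apply: sA; [exact: measurableI|exact: subIsetl].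
split; [exact: uX|exact: DuE|].
have iw' := Lp_integrable p1 Lw'.
have [d' Fd'] := weak_derivative_prim ab iv iw' wd'.
have E x : x \in `]a, b[ -> d' + prim a b (weak_deriv a b p (Psi_Da a b p psi u)) x = d + prim a b w x.
  have cr (g : R -> R) : continuous g -> forall y, y \in `]a, b[ -> g z @[z --> y^'+] --> g y.
    by move=> gc y _; apply: cvg_at_right_filter; exact: gc.
  apply: (@ae_eq_right_continuous _ a b (fun x => d' + prim a b (weak_deriv a b p (Psi_Da a b p psi u)) x) V).
  - apply: cr => y; apply: cvgD; [exact: cvg_cst|exact: (prim_continuous p1 Lw')].
  - apply: cr; exact: Vc.
  - by apply: ae_imp2 FV Fd' => y h1 h2 yab; rewrite -h2// -h1.
have h := prim_injective ab iw' iw E.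
apply: energy_ae => //; first by have [] := Lw'.
by have [] := Lw.
Unshelve. all: by end_near. Qed.

End membership.

(** * Compactness in X *)

Section charge_compactness.
Context {R : realType}.
Implicit Types (a b p c d k : R) (mu nu : signed_measure R).

(** The increments of [A] are controlled on ]x, z[; let t decrease to y, then s decrease to x. The
    room between y and z is what the limit from the right at y uses. [A] is typically a pointwise
    limit, alpha and beta values of its right-continuous version. *)
Lemma right_slope (A : R -> R) (alpha beta k x y z : R) : x < y -> y < z ->
  A t @[t --> x^'+] --> alpha -> A t @[t --> y^'+] --> beta ->
  (forall s t, x < s -> s < t -> t < z -> A t - A s <= k * (t - s)) ->
  beta - alpha <= k * (y - x).
Proof.
move=> xy yz cx cy H.
have H1 s : x < s -> s < y -> beta - A s <= k * (y - s).
  move=> xs sy.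
  have c1 : A t - A s @[t --> y^'+] --> beta - A s by apply: cvgB => //; exact: cvg_cst.
  have c2 : k * (t - s) @[t --> y^'+] --> k * (y - s).
    apply: cvgMr; apply: cvgB; last exact: cvg_cst.
    by apply: cvg_at_right_filter; exact: cvg_id.
  apply: (cvg_le2_near c1 c2).
  apply: filterS2 (nbhs_right_gt y) (nbhs_right_lt yz) => t yt tz.
  by apply: H => //; exact: lt_trans yt.
have c1 : beta - A s @[s --> x^'+] --> beta - alpha by apply: cvgB => //; exact: cvg_cst.
have c2 : k * (y - s) @[s --> x^'+] --> k * (y - x).
  apply: cvgMr; apply: cvgB; first exact: cvg_cst.
  by apply: cvg_at_right_filter; exact: cvg_id.
apply: (cvg_le2_near c1 c2).
by apply: filterS2 (nbhs_right_gt x) (nbhs_right_lt xy) => s xs sy; exact: H1.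
Qed.

Lemma total_var_induced (f : R -> R) (intf : (leb R).-integrable setT (EFin \o f)) :
  (total_var (induced_charge intf : signed_measure R) setT <= \int[leb R]_x `|f x|%:E)%E.
Proof.
set nu : signed_measure R := induced_charge intf.
have [[mH _] [mH' _] HH HI] := hahnP nu.
rewrite total_varE pos_partE// neg_partE// !setTI.
have inta : (leb R).-integrable setT (EFin \o (fun x => `|f x|)) by exact: (integrable_norm intf).
have h (B : set (measurableTypeR R)) : measurable B -> (`|nu B| <= \int[leb R]_(x in B) `|f x|%:E)%E.
  move=> mB; have iB : (leb R).-integrable B (EFin \o f) by exact: (integrableS _ _ _ intf).
  by apply: (le_abse_integral (leb R) mB); have /integrableP[] := iB.
have -> : (\int[leb R]_x `|f x|%:E = \int[leb R]_(x in hahn_pos nu) `|f x|%:E +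
    \int[leb R]_(x in hahn_neg nu) `|f x|%:E)%E.
  rewrite -HH ge0_integral_setU//.
  - by rewrite HH; have /integrableP[] := inta.
  - exact/disj_set2P.
apply: leeD; first exact: le_trans (lee_abs _) (h _ mH).
by apply: le_trans (h _ mH'); rewrite -abseN lee_abs.
Qed.

Context {I : Type} (U : set_system I) {UU : UltraFilter U}.

(* [k] is the value at [a] of the limit: mass accumulating at [a] is lost to [mu]. *)
Lemma helly_charge (mu : I -> signed_measure R) (K a b : R) : a < b ->
  (forall i, (total_var (mu i) setT <= K%:E)%E) ->
  exists (nu : signed_measure R) (L : R -> R) (k : R),
  [/\ forall x, cdf (mu i) x @[i --> U] --> L x,
      forall A : set (measurableTypeR R), measurable A -> A `<=` ~` `]a, b[ -> nu A = 0%E,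
      forall x, a <= x < b -> L y @[y --> x^'+] --> k + cdf nu x,
      forall l : R, (\forall i \near U, (total_var (mu i) setT <= l%:E)%E) ->
        (total_var nu setT <= l%:E)%E &
      forall e : R, 0 < e -> \forall i \near U,
        (\int[leb R]_(x in `]a, b[) `|cdf (mu i) x - (k + cdf nu x)|%:E <= e%:E)%E].
Proof.
move=> ab HK.
pose P i := jordan_pos (hahnP (mu i)); pose N i := jordan_neg (hahnP (mu i)).
have fP i : fine (P i setT) + fine (N i setT) = fine (total_var (mu i) setT).
  by rewrite total_varE fineD//; exact: fin_num_measure.
have tvK i : fine (total_var (mu i) setT) <= K.
  by rewrite -lee_fin fineK// total_var_fin_num.
have PK i x : cdf (P i) x <= K.
  apply: le_trans (cdf_le _ _) _; apply: le_trans (tvK i); rewrite -fP lerDl.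
  exact: fine_ge0.
have NK i x : cdf (N i) x <= K.
  apply: le_trans (cdf_le _ _) _; apply: le_trans (tvK i); rewrite -fP lerDr.
  exact: fine_ge0.
have [mP [LP [lP [PL PLl mP0 mPl mPT]]]] := helly (fun i => @cdf_nd _ (P i)) (fun i => cdf_ge0 (P i)) PK ab.
have [mN [LN [lN [NL NLl mN0 mNl mNT]]]] := helly (fun i => @cdf_nd _ (N i)) (fun i => cdf_ge0 (N i)) NK ab.
(* The limits of the positive and negative parts need not be mutually singular, so [total_var nu] is
   bounded by the sum of their masses but may be smaller. *)
pose nu : signed_measure R := cadd (charge_of_finite_measure mP) (copp (charge_of_finite_measure mN)).
have nuE A : nu A = (mP A - mN A)%E by [].
have cdfE x : cdf nu x = cdf mP x - cdf mN x.
  by rewrite /cdf nuE fineB// fin_num_measure.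
have muE i x : cdf (mu i) x = cdf (P i) x - cdf (N i) x by exact: cdf_sub.
have lE (m : {finite_measure set (measurableTypeR R) -> \bar R}) (l : R -> R) :
    (forall A : set (measurableTypeR R), A `<=` ~` `]a, b[ -> m A = 0%E) ->
    (forall x y, a <= x -> x <= y -> y < b -> m `]x, y]%classic = (l y - l x)%:E) ->
    forall x, a <= x < b -> l x = l a + cdf m x.
  move=> m0 ml x /andP[ax xb]; have := cdf_incr m ax; rewrite ml// => -[].
  rewrite (_ : cdf m a = 0); first by move=> h; move: h; clear; lra.
  rewrite /cdf m0// => z /=; rewrite !in_itv/= => za /andP[az _].
  by have := lt_le_trans az za; rewrite ltxx.
have lnd (L l : R -> R) : (forall x y, x < y -> L x <= l x <= L y) -> {homo l : x y / x <= y}.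
  move=> H x y; rewrite le_eqVlt => /predU1P[->//|xy].
  have /andP[_ h1] := H _ _ xy; have /andP[h2 _] := H y (y + 1) (ltr_pwDr ltr01 (lexx y)).
  exact: le_trans h2.
have Lr (m : {finite_measure set (measurableTypeR R) -> \bar R}) (L l : R -> R) :
    (forall x y, x < y -> L x <= l x <= L y) ->
    (forall x, a <= x < b -> l x = l a + cdf m x) ->
    forall x, a <= x < b -> L y @[y --> x^'+] --> l a + cdf m x.
  move=> H1 H2 x axb; have /andP[ax xb] := axb.
  have c : l a + cdf m y @[y --> x^'+] --> l a + cdf m x.
    by apply: cvgD; [exact: cvg_cst|exact: cdf_rc].
  apply: (squeeze_cvgr _ (cvg_cst (l a + cdf m x)) c).
  apply: filterS2 (nbhs_right_gt x) (nbhs_right_lt xb) => y xy yb.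
  have ayb : a <= y < b by rewrite yb (le_trans ax (ltW xy)).
  rewrite -!H2//; have /andP[_ ->] := H1 _ _ xy.
  by have /andP[-> _] := H1 y (y + 1) (ltr_pwDr ltr01 (lexx y)).
have lPE := lE _ _ mP0 mPl; have lNE := lE _ _ mN0 mNl.
exists nu, (fun x => LP x - LN x), (lP a - lN a); split.
- move=> x; under eq_cvg do rewrite muE.
  by apply: cvgB; [exact: PL|exact: NL].
- by move=> A mA Aab; rewrite nuE mP0// mN0// sube0.
- move=> x axb; rewrite cdfE.
  rewrite (_ : _ + _ = (lP a + cdf mP x) - (lN a + cdf mN x)); last by lra.
  by apply: cvgB; [exact: Lr PLl lPE _ _|exact: Lr NLl lNE _ _].
- move=> l Hl; apply: (@le_trans _ _ (mP setT + mN setT)%E); first exact: total_var_le.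
  apply: le_trans (leeD mPT mNT) _; rewrite -EFinD lee_fin.
  apply: (@cvg_le_near _ _ U _ (fun i => (cdf (P i) b - cdf (P i) a) + (cdf (N i) b - cdf (N i) a))).
    apply: cvgD; apply: cvgB; [exact: PL|exact: PL|exact: NL|exact: NL].
  apply: filterS Hl => i Hi.
  have {}Hi : fine (P i setT) + fine (N i setT) <= l.
    by rewrite fP -lee_fin fineK// total_var_fin_num.
  have := cdf_le (P i) b; have := cdf_le (N i) b; have := cdf_ge0 (P i) a; have := cdf_ge0 (N i) a.
  by move: Hi; move: (cdf _ _) (cdf _ _) (cdf _ _) (cdf _ _) (fine _) (fine _) => *; lra.
- move=> e e0; have e20 : 0 < e / 2 by rewrite divr_gt0.
  have cP := monotone_L1_cvg (fun i => @cdf_nd _ (P i)) (fun i => cdf_ge0 (P i)) PK ab PL PLl (lnd _ _ PLl) e20.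
  have cN := monotone_L1_cvg (fun i => @cdf_nd _ (N i)) (fun i => cdf_ge0 (N i)) NK ab NL NLl (lnd _ _ NLl) e20.
  apply: filterS2 (cP UU) (cN UU) => i h1 h2.
  have md (m : {finite_measure set (measurableTypeR R) -> \bar R}) (L l : R -> R) :
      (forall x y, x < y -> L x <= l x <= L y) ->
      measurable_fun `]a, b[ (fun x => `|cdf m x - l x|%:E).
    move=> H; apply/measurable_EFinP/measurableT_comp => //; apply: measurable_funTS.
    apply: measurable_funB; apply: nondecreasing_measurable => //.
      by move=> x y *; exact: cdf_nd.
    by move=> x y *; exact: (lnd _ _ H).
  have -> : e = e / 2 + e / 2 by lra.
  rewrite EFinD; apply: le_trans (leeD h1 h2); rewrite -ge0_integralD//; [|exact: md PLl|exact: md NLl].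
  apply: ge0_le_integral => //.
  + apply/measurable_EFinP/measurableT_comp => //; apply: measurable_funTS.
    apply: measurable_funB; first exact: cdf_measurable.
    by apply: measurable_funD => //; exact: cdf_measurable.
  + by apply: emeasurable_funD; [exact: md PLl|exact: md NLl].
  move=> x; rewrite /= in_itv/= => /andP[ax xb].
  have axb : a <= x < b by rewrite xb ltW.
  rewrite -EFinD lee_fin (lPE x axb) (lNE x axb) muE -/nu cdfE -/(P i) -/(N i).
  set A := cdf (P i) x; set B := cdf (N i) x; set C := cdf mP x; set D := cdf mN x.
  rewrite (_ : A - B - _ = (A - (lP a + C)) - (B - (lN a + D))); last by lra.
  exact: ler_normB.
Qed.

End charge_compactness.

(** * Recovering an L^p density from tangent inequalities *)

Section tangents.
Context {R : realType}.
Implicit Types (a b p k m : R) (f g w : R -> R) (nu E : signed_measure R).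

Lemma charge_ineq_local a b nu E k m :
  (forall x y, a < x -> x < y -> y < b ->
     k * (cdf nu y - cdf nu x) <= cdf E y - cdf E x + m * (y - x)) ->
  forall A : set (measurableTypeR R), measurable A -> A `<=` `]a, b[ ->
  (k%:E * nu A <= E A + m%:E * leb R A)%E.
Proof.
move=> H A mA Aab.
pose lebI : {finite_measure set (measurableTypeR R) -> \bar R} :=
  mfrestr (measurable_itvR `]a, b[) (leb_itv_lty a b false true).
pose rho : signed_measure R := cadd (cadd E (cscale m (charge_of_finite_measure lebI))) (cscale (- k) nu).
have rhoE B : rho B = (E B + m%:E * leb R (B `&` `]a, b[) + (- k)%:E * nu B)%E by [].
have fm : (m%:E * leb R A)%E \is a fin_num.
  apply: fin_numM => //; rewrite ge0_fin_numE//.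
  by apply: le_lt_trans (leb_itv_lty a b false true); rewrite le_measure ?inE.
have : (0 <= rho A)%E.
  apply: (charge_ge0_local (U := `]a, b[%classic)) => // z; rewrite /= in_itv/= => /andP[az zb].
  exists ((a + z) / 2), ((z + b) / 2); split; [clear -az; lra|clear -zb; lra|].
  move=> x y azx xy yzb.
  have ax : a < x by clear -az azx; lra.
  have yb : y < b by clear -zb yzb; lra.
  rewrite rhoE (_ : _ `&` _ = `]x, y]%classic); last first.
    by apply/seteqP; split => t /=; rewrite !in_itv/= => *; [|split => //]; clear rho rhoE; lra.
  have lebE : leb R `]x, y]%classic = (y - x)%:E.
    by have := @lebesgue_measure_itv R `]x, y] => /= ->; rewrite lte_fin xy EFinB.
  rewrite (chargeE_cdf E (ltW xy)) (chargeE_cdf nu (ltW xy)) lebE.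
  rewrite -!EFinM -!EFinD.
  rewrite lee_fin.
  have := H x y ax xy yb; move: (cdf _ _) (cdf _ _) (cdf _ _) (cdf _ _) => c1 c2 c3 c4.
  by clear; lra.
rewrite rhoE setIidl// EFinN mulNe sube_ge0//.
by apply/orP; left; rewrite fin_numM// fin_num_measure.
Qed.

Lemma ae_le_of_integrals (D : set (measurableTypeR R)) f g : measurable D ->
  (leb R).-integrable D (EFin \o f) -> (leb R).-integrable D (EFin \o g) ->
  (forall A : set (measurableTypeR R), measurable A -> A `<=` D ->
     (\int[leb R]_(x in A) (f x)%:E <= \int[leb R]_(x in A) (g x)%:E)%E) ->
  {ae leb R, forall x, D x -> f x <= g x}.
Proof.
move=> mD intf intg H.
pose h x := f x - g x.
have inth : (leb R).-integrable D (EFin \o h) by exact: (integrableB mD intf intg).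
have mh : measurable_fun D h by have /integrableP[/measurable_EFinP] := inth.
pose B : set (measurableTypeR R) := D `&` h @^-1` `]0, +oo[.
have mB : measurable B by exact: mh.
have BD : B `<=` D by move=> x [].
have ifB : (leb R).-integrable B (EFin \o f) by exact: (integrableS _ _ _ intf).
have igB : (leb R).-integrable B (EFin \o g) by exact: (integrableS _ _ _ intg).
have B0 : (\int[leb R]_(z in B) `|(h z)%:E| = 0)%E.
  apply/eqP; rewrite eq_le integral_ge0// andbT.
  have -> : (\int[leb R]_(z in B) `|(h z)%:E| =
      \int[leb R]_(z in B) ((EFin \o f) \- (EFin \o g)) z)%E.
    apply: eq_integral => z /set_mem [_]; rewrite /= in_itv/= andbT => hz.
    by rewrite ger0_norm// ltW.
  rewrite (integralB mB ifB igB) leeBlDr ?add0e; first exact: H.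
  exact: (integrable_fin_num mB igB).
have mhB : measurable_fun B (EFin \o h) by apply/measurable_EFinP; exact: measurable_funS mh.
have := (ae_eq_integral_abs (leb R) mB mhB).1 B0.
apply: ae_imp => x Hx Dx; rewrite leNgt; apply/negP => gf.
have Bx : B x by split => //=; rewrite in_itv/= andbT subr_gt0.
by have [/eqP] := Hx Bx; rewrite subr_eq0 => /eqP fg; move: gf; rewrite fg ltxx.
Qed.

(** On Borel sets, +-p t^(p-1) nu <= E + (p-1) t^p leb. On a null set, large t forces nu = 0, so
    [nu] has a density w. Off the null carrier of the singular part of [E], the density f of [E]
    dominates all tangents at rational points evaluated at |w|, hence |w|^p <= f. Existence of the
    limit density and lower semicontinuity of the energy come out together. *)
Lemma tangent_density a b p nu E : 1 < p ->
  (forall A : set (measurableTypeR R), measurable A -> A `<=` ~` `]a, b[ -> nu A = 0%E) ->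
  (forall x y t e, a < x -> x < y -> y < b -> 0 <= t -> `|e| = 1 ->
     e * (p * t `^ (p - 1)) * (cdf nu y - cdf nu x) <=
     cdf E y - cdf E x + (p - 1) * t `^ p * (y - x)) ->
  exists w, [/\ Lp a b p%:E w, (energy a b p w <= total_var E setT)%E &
    forall A : set (measurableTypeR R), measurable A ->
      nu A = (\int[leb R]_(x in A) ((w \_ `]a, b[) x)%:E)%E].
Proof.
move=> p1 nu0 H; have p0 : 0 < p by lra.
have ineq t e (A : set (measurableTypeR R)) : 0 <= t -> `|e| = 1 -> measurable A -> A `<=` `]a, b[ ->
    ((e * (p * t `^ (p - 1)))%:E * nu A <= E A + ((p - 1) * t `^ p)%:E * leb R A)%E.
  by move=> t0 e1; apply: charge_ineq_local => x y ax xy yb; exact: H.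
have ac (A : set (measurableTypeR R)) : measurable A -> A `<=` `]a, b[ -> leb R A = 0%E -> nu A = 0%E.
  move=> mA Aab A0.
  set r := fine (nu A); set s := fine (E A).
  have nr : nu A = r%:E by rewrite fineK// fin_num_measure.
  have Es : E A = s%:E by rewrite fineK// fin_num_measure.
  have key t e : 0 <= t -> `|e| = 1 -> e * (p * t `^ (p - 1)) * r <= s.
    move=> t0 e1; have := ineq t e A t0 e1 mA Aab.
    by rewrite A0 mule0 adde0 nr Es -EFinM lee_fin.
  rewrite nr; congr EFin; apply/eqP.
  apply/negPn/negP => r0; have {r0}r0 : 0 < `|r| by rewrite normr_gt0.
  have K0 : 0 <= `|s| / `|r| by rewrite divr_ge0.
  have [t t0 tE] := tangent_slope_large p1 K0.
  have e1 : `|Num.sg r| = 1 :> R by rewrite normr_sg -normr_gt0 r0.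
  have := key t (Num.sg r) (ltW t0) e1.
  rewrite tE mulrAC -normrEsg mulrCA mulrDr mulr1 mulrCA mulfV ?mulr1 ?gt_eqF//.
  have := ler_norm s; have := normr_ge0 s; clear -p1 r0; nra.
have [w [N [intw mN N0 nuE]]] := lebesgue_decomposition_exists nu.
have [f [N' [intf mN' N'0 EE]]] := lebesgue_decomposition_exists E.
have null (A B : set (measurableTypeR R)) : measurable A -> measurable B -> leb R B = 0%E -> leb R (A `&` B) = 0%E.
  move=> mA mB B0; apply/eqP; rewrite eq_le measure_ge0 andbT -B0 le_measure ?inE//; exact: measurableI.
have nuE' (A : set (measurableTypeR R)) : measurable A -> A `<=` `]a, b[ ->
    nu A = (\int[leb R]_(x in A) (w x)%:E)%E.
  move=> mA Aab; rewrite nuE// ac ?adde0//; [exact: measurableI|by move=> x [/Aab]|exact: null].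
pose D : set (measurableTypeR R) := `]a, b[ `\` N'.
have mD : measurable D by apply: measurableD.
have Dab : D `<=` `]a, b[ by move=> x [].
have lD : (leb R D < +oo)%E.
  by apply: le_lt_trans (leb_itv_lty a b false true); rewrite le_measure ?inE.
have ae1 (t e : R) : 0 <= t -> `|e| = 1 ->
    {ae leb R, forall x, D x -> e * (p * t `^ (p - 1)) * w x <= f x + (p - 1) * t `^ p}.
  move=> t0 e1.
  have ic : (leb R).-integrable D (EFin \o (cst ((p - 1) * t `^ p) : R -> R)).
    apply: measurable_bounded_integrable => //.
    by exists `|(p - 1) * t `^ p|; split; [exact: num_real|move=> M cM z _; exact: ltW].
  have ifD : (leb R).-integrable D (EFin \o f) by exact: (integrableS _ _ _ intf).
  have iwD : (leb R).-integrable D (EFin \o w) by exact: (integrableS _ _ _ intw).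
  apply: ae_le_of_integrals => //.
  - exact: integrable_cmul.
  - exact: (integrableD mD ifD ic).
  move=> A mA AD; have Aab := subset_trans AD Dab.
  have iwA : (leb R).-integrable A (EFin \o w) by exact: (integrableS _ _ _ intw).
  have ifA : (leb R).-integrable A (EFin \o f) by exact: (integrableS _ _ _ intf).
  have icA : (leb R).-integrable A (EFin \o (cst ((p - 1) * t `^ p) : R -> R)) by exact: (integrableS _ _ _ ic).
  have := ineq t e A t0 e1 mA Aab; rewrite nuE'// EE//.
  rewrite (_ : A `&` N' = set0) ?charge0 ?adde0; last first.
    by apply/seteqP; split => // x [/AD[]].
  have -> : (\int[leb R]_(x in A) (e * (p * t `^ (p - 1)) * w x)%:E =
      (e * (p * t `^ (p - 1)))%:E * \int[leb R]_(x in A) (w x)%:E)%E.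
    by under eq_integral do rewrite EFinM; rewrite integralZl.
  have -> : (\int[leb R]_(x in A) (f x + (p - 1) * t `^ p)%:E =
      \int[leb R]_(x in A) (f x)%:E + ((p - 1) * t `^ p)%:E * leb R A)%E.
    under eq_integral do rewrite EFinD.
    rewrite (integralD mA ifA icA); congr (_ + _)%E.
    exact: (integral_cst _ mA ((p - 1) * t `^ p)%:E).
  by [].
have ae2 (q : nat) : {ae leb R, forall x, D x ->
    if (unpickle q : option rat) is Some r then (0 <= ratr r :> R) ->
      p * (ratr r) `^ (p - 1) * `|w x| - (p - 1) * (ratr r) `^ p <= f x else True}.
  case: (unpickle q) => [r|]; last by apply: (@aeW _ (measurableTypeR R)).
  have [r0|r0] := leP (0 : R) (ratr r); last first.
    by apply: (@aeW _ (measurableTypeR R)).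
  have e1 : `|1 : R| = 1 by rewrite normr1.
  have e2 : `|- 1 : R| = 1 by rewrite normrN1.
  apply: ae_imp2 (ae1 _ _ r0 e1) (ae1 _ _ r0 e2) => x h1 h2 Dx _.
  have := h1 Dx; have := h2 Dx.
  by case: (ger0P (w x)) => _; rewrite mul1r mulN1r; clear; lra.
have ae3 : {ae leb R, forall x, D x -> `|w x| `^ p <= f x}.
  apply: ae_imp (ae_foralln ae2) => x hx Dx; apply: le_powR_of_tangents => // q q0.
  by have := hx (pickle q) Dx; rewrite pickleK; apply.
have ae4 : {ae leb R, forall x, `]a, b[%classic x -> `|w x| `^ p <= f x}.
  have aeN : {ae leb R, forall x, ~ N' x} by exists N'; split => // x /contrapT.
  by apply: ae_imp2 ae3 aeN => x h1 h2 xab; apply: h1.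
have mw : measurable_fun `]a, b[ w.
  by apply: measurable_funTS; have /integrableP[/measurable_EFinP] := intw.
have mf : measurable_fun `]a, b[ f.
  by apply: measurable_funTS; have /integrableP[/measurable_EFinP] := intf.
have en : (energy a b p w <= total_var E setT)%E.
  (* Truncating at 0 makes the integrand nonnegative at every point, as the almost everywhere
     comparison and the removal of the null set [N'] ask. *)
  apply: (@le_trans _ _ (\int[leb R]_(x in `]a, b[) (Num.max (f x) 0)%:E)%E).
    apply: ae_ge0_le_integral => //.
    - by apply/measurable_EFinP; exact: measurable_powR_norm.
    - by move=> x _; rewrite lee_fin le_max lexx orbT.
    - by apply/measurable_EFinP; apply: measurable_maxr.
    - by apply: ae_imp ae4 => x h xab; rewrite lee_fin le_max h.
  have -> : (\int[leb R]_(x in `]a, b[) (Num.max (f x) 0)%:E = \int[leb R]_(x in D) (f x)%:E)%E.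
    have mM : measurable_fun `]a, b[ (fun x => (Num.max (f x) 0)%:E).
      by apply/measurable_EFinP; apply: measurable_maxr.
    rewrite (ge0_negligible_integral mN' _ mM _ N'0)//; last first.
      by move=> x _; rewrite lee_fin le_max lexx orbT.
    apply: ae_eq_integral => //.
    - exact: (measurable_funS _ _ mM).
    - by apply/measurable_EFinP; exact: (measurable_funS _ _ mf).
    - apply: ae_imp ae3 => x h Dx; rewrite max_l//.
      by apply: le_trans (h Dx); exact: powR_ge0.
  have -> : (\int[leb R]_(x in D) (f x)%:E = E D)%E.
    rewrite EE// (_ : D `&` N' = set0) ?charge0 ?adde0//.
    by apply/seteqP; split => // x [[]].
  rewrite jordanE//; apply: (@le_trans _ _ (pos_part E D)).
    by rewrite leeBlDr ?fin_num_measure// leeDl.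
  apply: (@le_trans _ _ (total_var E D)); first by rewrite total_varE leeDl.
  by rewrite le_measure ?inE.
exists w; split => //.
- apply/(Lp_energy _ _ _ p0); split => //; apply: le_lt_trans en _.
  by rewrite -ge0_fin_numE// total_var_fin_num.
- move=> A mA; rewrite (chargeDI nu mA (measurable_itvR `]a, b[)).
  rewrite nu0 ?add0e; [|exact: measurableD|by move=> x []].
  rewrite nuE'; [|exact: measurableI|exact: subIsetr].
  rewrite integral_mkcond [RHS]integral_mkcond; apply: eq_integral => x _.
  by rewrite !patchE in_setI; case: (x \in A); case: (x \in `]a, b[%classic).
Qed.

End tangents.

(** * Compactness of represented sequences *)

Section compactness.
Context {R : realType}.
Implicit Types (a b p K : R) (psi F : R -> R) (nu : signed_measure R).

Lemma Lp_norm_le a b p w K : a < b -> 1 < p -> Lp a b p%:E w -> (energy a b p w <= K%:E)%E ->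
  (\int[leb R]_x `|(w \_ `]a, b[) x|%:E <= (K + (p - 1) * (b - a))%:E)%E.
Proof.
move=> ab p1 Lw eK; have p0 : 0 < p by lra.
have [mw ew] := (Lp_energy a b w p0).1 Lw.
have -> : (\int[leb R]_x `|(w \_ `]a, b[) x|%:E = \int[leb R]_(x in `]a, b[) `|w x|%:E)%E.
  rewrite [RHS]integral_mkcond; apply: eq_integral => x _.
  by rewrite !patchE; case: ifP => //; rewrite normr0.
have icE : (\int[leb R]_(x in `]a, b[) (p - 1)%:E = ((p - 1) * (b - a))%:E)%E.
  rewrite (integral_cst _ (measurable_itvR `]a, b[) (p - 1)%:E).
  by have := @lebesgue_measure_itv R `]a, b[ => /= ->; rewrite lte_fin ab -EFinB -EFinM.
apply: (@le_trans _ _ (energy a b p w + ((p - 1) * (b - a))%:E)%E); last first.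
  by rewrite EFinD leeD2r.
rewrite -icE -ge0_integralD//=.
- apply: ge0_le_integral => //.
  + by apply/measurable_EFinP; exact: measurableT_comp.
  + by apply: emeasurable_funD => //; apply/measurable_EFinP; exact: measurable_powR_norm.
  move=> x _; rewrite -EFinD lee_fin.
  have := @young_tangent _ p 1 `|w x| p1 ler01 (normr_ge0 _).
  by rewrite !powR1 !mulr1; have := normr_ge0 (w x); nra.
- by apply/measurable_EFinP; exact: measurable_powR_norm.
- by move=> x _; rewrite lee_fin; lra.
Qed.

Lemma cdf_copp nu x : cdf (copp nu : signed_measure R) x = - cdf nu x.
Proof. by rewrite /cdf coppE fineN. Qed.

Context {I : Type} (U : set_system I) {UU : UltraFilter U}.

(** The bound V0 <= G c on [x, y] has to be relaxed before it holds for the V i: [c] is raised to c'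
    and the interval prolonged slightly beyond y by continuity. [right_slope] passes the resulting
    inequalities to the limit, and c' then decreases to [c]. *)
Lemma slope_le_limit a b (G V0 : R -> R) (V : I -> R -> R) (m : I -> signed_measure R)
    (m0 : signed_measure R) (L : R -> R) (k : R) :
  (forall x y, (G x < G y) = (x < y)) -> continuous V0 ->
  (forall i x y, a < x -> x < y -> y < b -> slope_le G (m i) (V i) x y) ->
  (forall x, cdf (m i) x @[i --> U] --> L x) ->
  (forall x, a <= x < b -> L y @[y --> x^'+] --> k + cdf m0 x) ->
  (forall e : R, 0 < e -> \forall i \near U, forall x, x \in `]a, b[ -> `|V i x - V0 x| <= e) ->
  forall x y, a < x -> x < y -> y < b -> slope_le G m0 V0 x y.
Proof.
move=> Glt V0c sl mL Lr VV0 x y ax xy yb c Vc.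
rewrite (chargeE_cdf m0 (ltW xy)) lee_fin.
have main c' : c < c' -> cdf m0 y - cdf m0 x <= c' * (y - x).
  move=> cc'; have Gcc' : G c < G c' by rewrite Glt.
  (* Half of the gap absorbs the variation of V0 beyond y, the other half the uniform distance
     between V i and V0. *)
  set e := (G c' - G c) / 2; have e0 : 0 < e by rewrite divr_gt0// subr_gt0.
  have : \forall t \near y, V0 t < G c + e.
    have V0y : {for y, continuous V0} by exact: V0c.
    move/cvgr_lt : V0y; apply.
    by rewrite (@le_lt_trans _ _ (G c)) ?ltrDl// Vc// lexx ltW.
  move=> /nbhs_ballP[r /= r0 Hr].
  pose z := Num.min b (y + r).
  have yz : y < z by rewrite lt_min yb ltrDl.
  have V0z t : x < t -> t < z -> V0 t <= G c + e.
    rewrite lt_min => xt /andP[tb ty].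
    have [ty'|yt] := leP t y.
      by rewrite (@le_trans _ _ (G c)) ?lerDl ?(ltW e0)// Vc// (ltW xt).
    by apply/ltW/Hr; rewrite /ball/= ltr_norml; apply/andP; split; lra.
  rewrite (_ : _ - _ = (k + cdf m0 y) - (k + cdf m0 x)); last first.
    by move: (cdf _ _) (cdf _ _); clear; move=> ? ?; lra.
  apply: (right_slope xy yz (A := L)).
  - by apply: Lr; rewrite (lt_trans xy yb) ltW.
  - by apply: Lr; rewrite yb (ltW (lt_trans ax xy)).
  move=> s t xs st tz.
  have c1 : cdf (m i) t - cdf (m i) s @[i --> U] --> L t - L s by apply: cvgB; [exact: (mL t)|exact: (mL s)].
  apply: (cvg_le_near c1).
  apply: filterS (VV0 e e0) => i Hi.
  have as' : a < s by exact: lt_trans xs.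
  have tb : t < b by move: tz; rewrite lt_min => /andP[].
  have := sl i s t as' st tb c'; rewrite (chargeE_cdf (m i) (ltW st)) lee_fin; apply.
  move=> v /andP[sv vt].
  have := Hi v; rewrite in_itv/= (lt_le_trans as' sv) (le_lt_trans vt tb) => /(_ isT).
  have := V0z v (lt_le_trans xs sv) (le_lt_trans vt tz).
  by rewrite ler_norml /e => h /andP[_]; move: h; clear; lra.
apply/ler_addgt0Pr => e e0.
have yx0 : 0 < y - x by rewrite subr_gt0.
have := main (c + e / (y - x)); rewrite ltrDl divr_gt0// => /(_ isT).
by rewrite mulrDl mulfVK ?gt_eqF.
Qed.

(** [helly_charge] is applied to the charges mu i, w i dx and |w i|^p dx; the last limit dominates
    the energy of w0 through [tangent_density]. The constants lost at [a] for mu and w are absorbed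
    into c0 and d0. *)
Theorem compactness a b p psi K (u : I -> R -> R) (c d : I -> R) (mu : I -> signed_measure R)
    (w : I -> R -> R) : let F := PsiR p psi in
  a < b -> 1 < p -> (forall x y, (F x < F y) = (x < y)) ->
  (forall i, represented a b p F (u i) (c i) (mu i) (d i) (w i)) ->
  (forall i, `|c i| <= K) -> (forall i, `|d i| <= K) ->
  (forall i, (total_var (mu i) setT <= K%:E)%E) ->
  (forall i, (energy a b p (w i) <= K%:E)%E) ->
  (forall i, measurable_fun `]a, b[ (u i)) ->
  exists u0 c0 mu0 d0 w0, [/\ represented a b p F u0 c0 mu0 d0 w0,
    (leb R).-integrable `]a, b[ (EFin \o u0),
    forall e : R, 0 < e -> \forall i \near U,
      (\int[leb R]_(x in `]a, b[) `|u i x - u0 x|%:E <= e%:E)%E,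
    forall l : R, (\forall i \near U, (total_var (mu i) setT + energy a b p (w i) <= l%:E)%E) ->
      (total_var mu0 setT + energy a b p w0 <= l%:E)%E &
    forall e : R, 0 < e -> \forall i \near U, forall x, x \in `]a, b[ ->
      `|(d i + prim a b (w i) x) - (d0 + prim a b w0 x)| <= e].
Proof.
move=> F ab p1 Flt Hrep cK dK muK wK um.
have p0 : 0 < p by lra.
have Lw i : Lp a b p%:E (w i) by have [] := Hrep i.
have iw i := Lp_integrable p1 (Lw i).
have mw i : measurable_fun `]a, b[ (w i) by have [] := Lw i.
have wfin i : (energy a b p (w i) < +oo)%E by have [_] := (Lp_energy a b (w i) p0).1 (Lw i).
have iw0 i := integrable_restrict_itv (iw i).
have ie i := energy_integrable (mw i) (wfin i).
have ie0 i := integrable_restrict_itv (ie i).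
have K0 : 0 <= K.
  rewrite leNgt; apply/negP => K0.
  have /filter_ex[i _] : U setT by exact: filterT.
  by have := cK i; rewrite leNgt (lt_le_trans K0).
have [cc Hcc] := ultra_cvg cK; have [dd Hdd] := ultra_cvg dK.
have [mu0 [L [k [muL mu00 Lr muTV muL1]]]] := helly_charge (UU := UU) ab muK.
pose nu i : signed_measure R := induced_charge (iw0 i).
have nuK i : (total_var (nu i) setT <= (K + (p - 1) * (b - a))%:E)%E.
  by apply: le_trans (total_var_induced _) _; exact: Lp_norm_le.
have [nu0 [LV [kV [nuL nu00 LVr _ _]]]] := helly_charge (UU := UU) ab nuK.
have nuE i x : cdf (nu i) x = prim a b (w i) x by [].
pose En i : signed_measure R := induced_charge (ie0 i).
have EnK i : (total_var (En i) setT <= energy a b p (w i))%E.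
  apply: le_trans (total_var_induced _) _.
  rewrite /energy [leRHS]integral_mkcond le_eqVlt; apply/orP; left; apply/eqP.
  apply: eq_integral => x _; rewrite !patchE; case: ifP => _; rewrite ?normr0//.
  by rewrite ger0_norm// powR_ge0.
have EnK' i : (total_var (En i) setT <= K%:E)%E by exact: le_trans (EnK i) (wK i).
have [E0 [LE [kE [EL E00 LEr ETV _]]]] := helly_charge (UU := UU) ab EnK'.
have EE i x : cdf (En i) x = energy_cdf a b p (w i) x by [].
have tang x y t e : a < x -> x < y -> y < b -> 0 <= t -> `|e| = 1 ->
    e * (p * t `^ (p - 1)) * (cdf nu0 y - cdf nu0 x) <=
    cdf E0 y - cdf E0 x + (p - 1) * t `^ p * (y - x).
  move=> ax xy yb t0 e1; set q := p * t `^ (p - 1); set m := (p - 1) * t `^ p.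
  have q0 : 0 <= q by rewrite mulr_ge0 ?powR_ge0// ltW.
  have axb : a <= x < b by rewrite (lt_trans xy yb) ltW.
  have ayb : a <= y < b by rewrite yb (ltW (lt_trans ax xy)).
  have := @right_slope _ (fun s => e * q * LV s - LE s) (e * q * (kV + cdf nu0 x) - (kE + cdf E0 x))
    (e * q * (kV + cdf nu0 y) - (kE + cdf E0 y)) m x y b xy yb.
  have cr z : a <= z < b -> e * q * LV s - LE s @[s --> z^'+] --> e * q * (kV + cdf nu0 z) - (kE + cdf E0 z).
    by move=> azb; apply: cvgB; [apply: cvgMr; exact: LVr|exact: LEr].
  move=> /(_ (cr _ axb) (cr _ ayb)) H.
  have {}H : e * q * (kV + cdf nu0 y) - (kE + cdf E0 y) - (e * q * (kV + cdf nu0 x) - (kE + cdf E0 x)) <= m * (y - x).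
    apply: H => s s' xs ss' sb.
    have c1 : (e * q * cdf (nu i) s' - cdf (En i) s') - (e * q * cdf (nu i) s - cdf (En i) s) @[i --> U]
       --> (e * q * LV s' - LE s') - (e * q * LV s - LE s).
      by apply: cvgB; (apply: cvgB; [apply: cvgMr; exact: nuL|exact: EL]).
    apply: (cvg_le_near c1); apply: nearW => i; rewrite !nuE !EE.
    have := prim_energy p1 t0 (ltW ss') (Lw i); rewrite -/q -/m.
    have : e * (prim a b (w i) s' - prim a b (w i) s) <= `|prim a b (w i) s' - prim a b (w i) s|.
      by apply: le_trans (ler_norm _) _; rewrite normrM e1 mul1r.
    move: (prim _ _ _ _) (prim _ _ _ _) (energy_cdf _ _ _ _ _) (energy_cdf _ _ _ _ _) => v2 v1 v4 v3 h1.
    have : q * (e * (v1 - v2)) <= q * `|v1 - v2| by exact: ler_wpM2l.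
    rewrite (_ : e * q * v1 - v3 - (e * q * v2 - v4) = q * (e * (v1 - v2)) - (v3 - v4)); last by clear; lra.
    by clear; lra.
  move: H; move: (cdf _ _) (cdf _ _) (cdf _ _) (cdf _ _) => v1 v2 v3 v4; clear; lra.
have [w0 [Lw0 ew0 nuw0]] := tangent_density p1 nu00 tang.
have primE x : cdf nu0 x = prim a b w0 x by rewrite /cdf nuw0.
have prim0c := prim_continuous p1 Lw0.
pose V i x := d i + prim a b (w i) x.
have VL x : V i x @[i --> U] --> dd + LV x by apply: cvgD => //; exact: nuL.
have Vmod (e : R) : 0 < e -> exists2 r : R, 0 < r & forall i (x y : R), x \in `[a, b] -> y \in `[a, b] ->
     `|x - y| <= r -> `|V i x - V i y| <= e.
  move=> e0; have [r r0 Hr] := prim_modulus p1 K0 e0.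
  exists r => // i x y _ _ xy; rewrite /V opprD addrACA subrr add0r.
  exact: Hr (Lw i) (wK i) xy.
have [Wmod Wunif] := equicontinuous_uniform ab Vmod (fun x _ => VL x).
(* The pointwise limit of the V i inherits their modulus, so it is continuous and equals its right
   limit, the expression in terms of [nu0]. *)
have WE x : x \in `]a, b[ -> dd + LV x = (dd + kV) + prim a b w0 x.
  rewrite in_itv/= => /andP[ax xb].
  have axb : a <= x < b by rewrite xb ltW.
  rewrite -primE -addrA; congr (_ + _).
  apply: (@cvg_unique _ _ (LV y @[y --> x^'+])) => //; last exact: LVr.
  apply/cvgrPdist_le => e e0; have [r r0 Hr] := Wmod e e0.
  near=> y.
  have xy : x < y by near: y; exact: nbhs_right_gt.
  have yr : y < x + r by near: y; apply: nbhs_right_lt; rewrite ltrDl.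
  have yb : y < b by near: y; exact: nbhs_right_lt.
  have xin : x \in `[a, b] by rewrite in_itv/= !ltW.
  have yin : y \in `[a, b] by rewrite in_itv/= !ltW// (lt_trans ax).
  have := Hr x y xin yin; rewrite opprD addrACA subrr add0r; apply.
  by rewrite ltr0_norm ?subr_lt0//; clear -yr; lra.
pose d0 := dd + kV; pose V0 x := d0 + prim a b w0 x.
have V0c : continuous V0 by move=> x; apply: cvgD; [exact: cvg_cst|exact: prim0c].
have VV0 (e : R) : 0 < e -> \forall i \near U, forall x, x \in `]a, b[ -> `|V i x - V0 x| <= e.
  move=> e0; apply: filterS (Wunif e e0) => i Hi x xab.
  rewrite /V0 /d0 -WE//; apply: Hi.
  by move: xab; rewrite !in_itv/= => /andP[/ltW-> /ltW->].
have sl0 : slopes a b F mu0 V0.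
  move=> x y ax xy yb; split.
  - apply: (slope_le_limit Flt V0c (V := V) (m := mu) _ muL Lr VV0) => // i s t as' st tb.
    by have [_ _ _ /(_ s t as' st tb)[]] := Hrep i.
  - apply: (@slope_le_limit a b (flip F) (fun x => - V0 x) (fun i x => - V i x)
      (fun i => copp (mu i)) (copp mu0) (fun x => - L x) (- k)) => //.
    + exact: flip_lt.
    + by move=> z; apply: cvgN; exact: V0c.
    + by move=> i s t as' st tb; have [_ _ _ /(_ s t as' st tb)[]] := Hrep i.
    + by move=> z; under eq_cvg do rewrite cdf_copp; apply: cvgN; exact: muL.
    + move=> z azb; rewrite cdf_copp -opprD; apply: cvgN; exact: Lr.
    + move=> e e0; apply: filterS (VV0 e e0) => i Hi z zab.
      by rewrite -opprD normrN; exact: Hi.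
pose u0 x := (cc + k) + cdf mu0 x.
have mu0m : measurable_fun [set: measurableTypeR R] u0.
  by apply: measurable_funD => //; exact: cdf_measurable.
have iu0 : (leb R).-integrable `]a, b[ (EFin \o u0).
  apply: (integrable_bounded_itv (M := `|cc + k| + fine (total_var mu0 setT))).
    exact: measurable_funTS.
  by move=> x _; apply: le_trans (ler_normD _ _) _; rewrite lerD2l normr_cdf_le.
exists u0, (cc + k), mu0, d0, w0; split => //.
- by split => //; apply: (@aeW _ (measurableTypeR R)).
- move=> e e0.
  have e1 : 0 < e / (2 * (b - a)) by rewrite divr_gt0// mulr_gt0// subr_gt0.
  have e2 : 0 < e / 2 by rewrite divr_gt0.
  move/cvgrPdist_le : Hcc => /(_ _ e1) Hcc.
  apply: filterS2 (muL1 _ e2) Hcc => i h1 h2.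
  have [_ uE _ _] := Hrep i.
  have mc : measurable_fun `]a, b[ (fun x => cdf (mu i) x - (k + cdf mu0 x)).
    apply: measurable_funB; first by apply: measurable_funTS; exact: cdf_measurable.
    by apply: measurable_funD => //; apply: measurable_funTS; exact: cdf_measurable.
  apply: (@le_trans _ _ (\int[leb R]_(x in `]a, b[) ((`|cdf (mu i) x - (k + cdf mu0 x)|)%:E + (e / (2 * (b - a)))%:E))%E).
    apply: ae_ge0_le_integral => //.
    + apply/measurable_EFinP/measurableT_comp => //; apply: measurable_funB; first exact: um.
      exact: measurable_funTS.
    + by move=> x _; rewrite -EFinD lee_fin addr_ge0// ltW.
    + apply: emeasurable_funD => //; apply/measurable_EFinP; exact: measurableT_comp.
    + apply: ae_imp uE => x h xab; rewrite h// -EFinD lee_fin /u0.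
      rewrite (_ : _ - _ = (cdf (mu i) x - (k + cdf mu0 x)) + (c i - cc)); last first.
        by move: (cdf _ _) (cdf _ _); clear; move=> ? ?; lra.
      by apply: le_trans (ler_normD _ _) _; rewrite lerD2l distrC.
  rewrite ge0_integralD//; last 2 first.
  + apply/measurable_EFinP; exact: measurableT_comp.
  + by move=> x _; rewrite lee_fin ltW.
  rewrite (integral_cst _ (measurable_itvR `]a, b[) (e / (2 * (b - a)))%:E).
  have := @lebesgue_measure_itv R `]a, b[ => /= ->; rewrite lte_fin ab -EFinB -EFinM.
  have -> : e / (2 * (b - a)) * (b - a) = e / 2.
    by rewrite invfM mulrA mulfVK// subr_eq0 gt_eqF.
  rewrite [X in (_ <= X%:E)%E](splitr e).
  by rewrite EFinD leeD2r.
- move=> l Hl.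
  have TK i : `|fine (total_var (mu i) setT)| <= K.
    by rewrite ger0_norm ?fine_ge0// -lee_fin fineK// total_var_fin_num.
  have enf i : energy a b p (w i) \is a fin_num by rewrite ge0_fin_numE ?energy_ge0.
  have eK i : `|fine (energy a b p (w i))| <= K.
    by rewrite ger0_norm ?fine_ge0 ?energy_ge0// -lee_fin fineK.
  (* [l] bounds the sum only; the ultrafilter limits of the two terms split it into one bound for
     each. *)
  have [T HT] := ultra_cvg TK; have [e He] := ultra_cvg eK.
  have Tl : T + e <= l.
    apply: (cvg_le_near (cvgD HT He)); apply: filterS Hl => i.
    by rewrite -lee_fin EFinD !fineK// total_var_fin_num.
  have h1 : (total_var mu0 setT <= T%:E)%E.
    apply/lee_addgt0Pr => r r0; rewrite -EFinD; apply: muTV.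
    move/cvgrPdist_le : HT => /(_ _ r0); apply: filterS => i.
    rewrite distrC ler_norml => /andP[_]; rewrite lerBlDl => h.
    by rewrite -[leLHS]fineK ?lee_fin// total_var_fin_num.
  have h2 : (energy a b p w0 <= e%:E)%E.
    apply: le_trans ew0 _; apply/lee_addgt0Pr => r r0; rewrite -EFinD; apply: ETV.
    move/cvgrPdist_le : He => /(_ _ r0); apply: filterS => i.
    rewrite distrC ler_norml => /andP[_]; rewrite lerBlDl => h.
    by apply: le_trans (EnK i) _; rewrite -[leLHS]fineK ?lee_fin.
  by apply: le_trans (leeD h1 h2) _; rewrite -EFinD lee_fin.
Unshelve. all: by end_near. Qed.

End compactness.

(** * C^1 regularity and convergence *)

Section regularity.
Context {R : realType}.
Implicit Types (a b p c d D k : R) (u w F : R -> R) (mu nu : signed_measure R).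

Lemma lipschitz_within (f : R -> R) (A : set R) (L : R) : 0 <= L ->
  (forall x y, A x -> A y -> x <= y -> `|f y - f x| <= L * (y - x)) ->
  {within A, continuous f}.
Proof.
move=> L0 H; apply/subspace_continuousP => x Ax; apply/cvgrPdist_le => e e0.
have L1 : 0 < L + 1 by lra.
rewrite near_withinE; near=> y => Ay.
have yx : `|x - y| < e / (L + 1).
  by near: y; apply/nbhs_ballP; exists (e / (L + 1)) => //=; rewrite divr_gt0.
have {}yx : (L + 1) * `|x - y| <= e by rewrite mulrC -ler_pdivlMr// ltW.
have := normr_ge0 (x - y); have [xy|/ltW xy] := leP x y.
  have := H x y Ax Ay xy; rewrite distrC -(@ger0_norm _ (y - x)) ?subr_ge0// [in X in _ <= X]distrC; nra.
by have := H y x Ay Ax xy; rewrite -(@ger0_norm _ (x - y)) ?subr_ge0//; nra.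
Unshelve. all: by end_near. Qed.

(** Bounds on V inside ]a, b[ give bounds on all increments there; since [mu] has no mass outside
    ]a, b[, they extend to all x <= y by [charge_ineq_local] with zero energy charge. *)
Lemma slope_lipschitz a b F (V : R -> R) mu D : 0 <= D -> (forall x y, (F x < F y) = (x < y)) ->
  continuous V ->
  (forall A : set (measurableTypeR R), measurable A -> A `<=` ~` `]a, b[ -> mu A = 0%E) ->
  slopes a b F mu V -> (forall x, x \in `]a, b[ -> F (- D) <= V x <= F D) ->
  forall x y, x <= y -> `|cdf mu y - cdf mu x| <= D * (y - x).
Proof.
move=> D0 Flt Vc mu0 sl VD x y xy.
have main (nu : signed_measure R) :
    (forall A : set (measurableTypeR R), measurable A -> A `<=` ~` `]a, b[ -> nu A = 0%E) ->
    (forall s t, a < s -> s < t -> t < b -> (nu `]s, t]%classic <= (D * (t - s))%:E)%E) ->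
    cdf nu y - cdf nu x <= D * (y - x).
  move=> nu0 nus; rewrite -lee_fin -chargeE_cdf//.
  rewrite (chargeDI nu (measurable_itvR `]x, y]) (measurable_itvR `]a, b[)).
  rewrite nu0 ?add0e; [|exact: measurableD|by move=> z []].
  pose Z : signed_measure R := czero.
  have := @charge_ineq_local _ a b nu Z 1 D _ (`]x, y] `&` `]a, b[).
  rewrite mul1e add0e => H.
  apply: (le_trans (H _ _ (@subIsetr _ _ _))).
  - move=> s t as' st tb; rewrite mul1r /Z /cdf /= subrr add0r.
    by have := nus s t as' st tb; rewrite (chargeE_cdf nu (ltW st)) lee_fin.
  - exact: measurableI.
  rewrite EFinM; apply: lee_wpmul2l; first by rewrite lee_fin.
  apply: (@le_trans _ _ (leb R `]x, y])); first by rewrite le_measure ?inE//; exact: measurableI.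
  have := @lebesgue_measure_itv R `]x, y] => /= ->.
  by move: xy; rewrite le_eqVlt lte_fin => /predU1P[->|->//]; rewrite ltxx subrr.
have VD' s t : a < s -> t < b -> forall z, s <= z <= t -> F (- D) <= V z <= F D.
  by move=> as' tb z /andP[sz zt]; apply: VD; rewrite in_itv/= (lt_le_trans as') ?(le_lt_trans zt).
rewrite ler_norml; apply/andP; split.
- have := main (copp mu); rewrite !cdf_copp => H.
  suff : - cdf mu y - - cdf mu x <= D * (y - x).
    by move: (cdf _ _) (cdf _ _) => v1 v2; clear; lra.
  apply: H => [A mA Aab|s t as' st tb]; first by rewrite coppE mu0// oppe0.
  have [_ H] := sl s t as' st tb; apply: H => z szt.
  by have /andP[h _] := VD' s t as' tb z szt; rewrite /flip lerN2.
- apply: main => // s t as' st tb.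
  have [H _] := sl s t as' st tb; apply: H => z szt.
  by have /andP[_ h] := VD' s t as' tb z szt.
Qed.

(** The derivative is phi = F^-1(V), which exists by the intermediate value theorem and is
    continuous because F has slope at least [k] on [-D, D]. Near x, V lies between F (phi x - e) and
    F (phi x + e), so the slope inequalities squeeze the difference quotients of [cdf mu] between
    phi x - e and phi x + e. *)
Lemma represented_C1 a b p F u c mu d w D k : let V x := d + prim a b w x in
  a < b -> 1 < p -> 0 <= D -> 0 < k -> (forall x y, (F x < F y) = (x < y)) -> continuous F ->
  (forall x y, - D <= x -> x <= y -> y <= D -> k * (y - x) <= F y - F x) ->
  represented a b p F u c mu d w -> (forall x, x \in `]a, b[ -> F (- D) <= V x <= F D) ->
  exists phi, C1_representative a b u (fun x => c + cdf mu x) phi /\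
    forall x, x \in `[a, b] -> [/\ F (phi x) = V x, - D <= phi x & phi x <= D].
Proof.
move=> V ab p1 D0 k0 Flt Fc Fk [mu0 uc Lw sl] VD.
have Vc : continuous V.
  by move=> x; apply: cvgD; [exact: cvg_cst|exact: (prim_continuous p1 Lw)].
have aeT (P : R -> Prop) : (forall x, P x) -> {ae leb R, forall x, P x}.
  by move=> HP; apply: (@aeW _ (measurableTypeR R)).
have VDc x : x \in `[a, b] -> F (- D) <= V x <= F D.
  move=> xab; apply/andP; split; last first.
    by apply: (@ae_le_continuous _ a b V) => //; apply: aeT => y /VD/andP[].
  rewrite -lerN2; apply: (@ae_le_continuous _ a b (fun y => - V y)) => //.
    by move=> y; apply: cvgN; exact: Vc.
  by apply: aeT => y /VD/andP[h _]; rewrite lerN2.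
have phiE x : exists t, x \in `[a, b] -> [/\ F t = V x, - D <= t & t <= D].
  have [xab|xab] := boolP (x \in `[a, b]); last by exists 0.
  have DD : - D <= D by lra.
  have FDD : F (- D) <= F D by rewrite leNgt Flt -leNgt.
  have [||t tD Ft] := @IVT _ F (- D) D (V x) DD.
  - exact: continuous_subspaceT.
  - by rewrite min_l// max_r// VDc.
  by exists t => _; move: tD; rewrite in_itv/= => /andP[].
move: phiE => /choice[phi Hphi]; exists phi; split => //.
have phi_lip x y : `[a, b]%classic x -> `[a, b]%classic y -> `|phi y - phi x| <= k^-1 * `|V y - V x|.
  move=> xab yab; have [Fx x1 x2] := Hphi x xab; have [Fy y1 y2] := Hphi y yab.
  rewrite ler_pdivlMl// -Fx -Fy.
  have [xy|/ltW yx] := leP (phi x) (phi y).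
    rewrite ger0_norm ?subr_ge0//; apply: le_trans (ler_norm _); exact: Fk.
  by rewrite distrC [leRHS]distrC ger0_norm ?subr_ge0//; apply: le_trans (ler_norm _); exact: Fk.
have lip := slope_lipschitz D0 Flt Vc mu0 sl VD.
split => //.
- apply: (lipschitz_within D0) => x y _ _ xy.
  by rewrite opprD addrACA subrr add0r; exact: lip.
- apply/subspace_continuousP => x xab; apply/cvgrPdist_le => e e0.
  rewrite near_withinE.
  have ke : 0 < k * e by rewrite mulr_gt0.
  have := Vc x => /cvgrPdist_le/(_ _ ke); apply: filterS => y Hy yab.
  apply: le_trans (phi_lip y x yab xab) _.
  by rewrite ler_pdivrMl.
- move=> x xab; apply: is_derive_of_linear_bound => e e0.
  have xab' : x \in `[a, b] by move: xab; rewrite !in_itv/= => /andP[/ltW-> /ltW->].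
  have [Fx x1 x2] := Hphi x xab'.
  have nb : \forall t \near x, [/\ t \in `]a, b[, V t <= F (phi x + e) & F (phi x - e) <= V t].
    have Vx : {for x, continuous V} by exact: Vc.
    have h1 : \forall t \near x, V t < F (phi x + e).
      by move/cvgr_lt : Vx; apply; rewrite -Fx Flt ltrDl.
    have h2 : \forall t \near x, F (phi x - e) < V t.
      by move/cvgr_gt : Vx; apply; rewrite -Fx Flt ltrBlDr ltrDl.
    apply: filterS3 (near_in_itvoo xab) h1 h2 => t t1 t2 t3; split => //; exact: ltW.
  move: nb => /nbhs_ballP[r /= r0 Hr]; exists r => // h hr.
  have key s t : `|s - x| < r -> `|t - x| < r -> s < t ->
      (phi x - e) * (t - s) <= cdf mu t - cdf mu s <= (phi x + e) * (t - s).
    rewrite !ltr_norml => /andP[s1 s2] /andP[t1 t2] st.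
    have nbz z : s <= z <= t -> [/\ z \in `]a, b[, V z <= F (phi x + e) & F (phi x - e) <= V z].
      by move=> /andP[z1 z2]; apply: Hr; rewrite /ball/= ltr_norml; apply/andP; split; clear -s1 s2 t1 t2 z1 z2; lra.
    have [sab _ _] : [/\ s \in `]a, b[, V s <= F (phi x + e) & F (phi x - e) <= V s].
      by apply: nbz; rewrite lexx ltW.
    have [tab _ _] : [/\ t \in `]a, b[, V t <= F (phi x + e) & F (phi x - e) <= V t].
      by apply: nbz; rewrite lexx ltW.
    move: sab tab; rewrite !in_itv/= => /andP[as' _] /andP[_ tb].
    have [S1 S2] := sl s t as' st tb.
    apply/andP; split.
      have := S2 (- (phi x - e)); rewrite coppE (chargeE_cdf mu (ltW st)) -EFinN lee_fin.
      have hz z : s <= z <= t -> - V z <= flip F (- (phi x - e)).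
        by move=> /nbz[_ _ h3]; rewrite /flip opprK lerN2.
      move=> /(_ hz); move: (cdf _ _) (cdf _ _) => v1 v2; clear; lra.
    have := S1 (phi x + e); rewrite (chargeE_cdf mu (ltW st)) lee_fin; apply.
    by move=> z /nbz[].
  have [h0|h0|<-] := ltgtP 0 h.
  + have := key x (x + h); rewrite addrAC subrr add0r normr0 => /(_ r0 hr).
    rewrite ltrDl => /(_ h0).
    rewrite (gtr0_norm h0) ler_norml.
    move: (cdf _ _) (cdf _ _) => v1 v2 /andP[g1 g2]; apply/andP; split; clear -g1 g2; lra.
  + have := key (x + h) x; rewrite addrAC subrr add0r normr0 => /(_ hr r0).
    have -> : x - (x + h) = - h by clear; lra.
    rewrite gtrDl => /(_ h0).
    rewrite (ltr0_norm h0) ler_norml.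
    move: (cdf _ _) (cdf _ _) => v1 v2 /andP[g1 g2]; apply/andP; split; clear -g1 g2; lra.
  + by rewrite addr0 subrr mul0r subr0 normr0 mulr0.
Qed.

(** Let D bound the derivative of the C^1 representative. If V exceeded F (D + 1) at a point, it
    would do so nearby, and the lower slope inequality would make [cdf mu] grow at rate D + 1,
    against the mean value theorem. Reflection gives the lower bound. *)
Lemma C1_slope_bound a b p F u c mu d w : let V x := d + prim a b w x in
  a < b -> 1 < p -> (forall x y, (F x < F y) = (x < y)) ->
  represented a b p F u c mu d w -> C1 a b u ->
  exists2 D, 0 <= D & forall x, x \in `]a, b[ -> F (- D) <= V x <= F D.
Proof.
move=> V ab p1 Flt [mu0 uc Lw sl] [W [dW [Wc dWc WE uW]]].
have Vc : continuous V.
  by move=> x; apply: cvgD; [exact: cvg_cst|exact: (prim_continuous p1 Lw)].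
have [D0 [_ HD]] := compact_bounded (continuous_compact dWc (@segment_compact R a b)).
pose D := Num.max D0 0 + 1.
have DD : D0 < D by rewrite /D (@le_lt_trans _ _ (Num.max D0 0)) ?le_max ?lexx// ltrDl.
have D1 : 0 <= D by rewrite /D addr_ge0// le_max lexx orbT.
have dWD x : x \in `[a, b] -> `|dW x| <= D.
  by move=> xab; apply: (HD D DD); exists x.
have [Wi Wa Wb] := (continuous_within_itvP W ab).1 Wc.
have cW x : x \in `]a, b[ -> c + cdf mu x = W x.
  move: x; apply: ae_eq_right_continuous.
  - by move=> x _; apply: cvgD; [exact: cvg_cst|exact: cdf_right_continuous].
  - by move=> x xab; apply: cvg_at_right_filter; exact: Wi.
  - by apply: ae_imp2 uc uW => x h1 h2 xab; rewrite -h1// h2.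
have mvt x y : a < x -> x < y -> y < b -> `|cdf mu y - cdf mu x| <= D * (y - x).
  move=> ax xy yb.
  have xab : x \in `]a, b[ by rewrite in_itv/= ax (lt_trans xy).
  have yab : y \in `]a, b[ by rewrite in_itv/= yb (lt_trans ax).
  have H1 z : z \in `]x, y[ -> is_derive z 1 W (dW z).
    rewrite in_itv/= => /andP[xz zy]; apply: WE; rewrite in_itv/=.
    by rewrite (lt_trans ax) ?(lt_trans zy).
  have H2 : {within `[x, y], continuous W}.
    apply: continuous_subspaceW Wc => z /=; rewrite !in_itv/= => /andP[xz zy].
    by rewrite (le_trans (ltW ax) xz) (le_trans zy (ltW yb)).
  have [z + E] := MVT xy H1 H2.
  rewrite in_itv/= => /andP[xz zy].
  have -> : cdf mu y - cdf mu x = W y - W x.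
    by rewrite -!cW//; move: (cdf _ _) (cdf _ _) => v1 v2; clear; lra.
  have yx0 : 0 <= y - x by rewrite subr_ge0 ltW.
  rewrite E normrM (ger0_norm yx0); apply: ler_wpM2r => //.
  by apply: dWD; rewrite in_itv/= !ltW ?(lt_trans ax) ?(lt_trans zy).
exists (D + 1); first by rewrite addr_ge0.
have key (G Y : R -> R) (nu : signed_measure R) x : (forall x y, (G x < G y) = (x < y)) -> continuous Y ->
    (forall x y, a < x -> x < y -> y < b -> slope_le (flip G) (copp nu) (fun t => - Y t) x y) ->
    (forall x y, a < x -> x < y -> y < b -> cdf nu y - cdf nu x <= D * (y - x)) ->
    x \in `]a, b[ -> Y x <= G (D + 1).
  move=> Glt Yc slG nuD; rewrite in_itv/= => /andP[ax xb]; rewrite leNgt; apply/negP => Yx.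
  have : \forall t \near x, G (D + 1) < Y t.
    by have Yx' : {for x, continuous Y} by [exact: Yc]; move/cvgr_gt : Yx'; apply.
  move=> /nbhs_ballP[r /= r0 Hr].
  pose y := Num.min ((x + b) / 2) (x + r / 2).
  have xy : x < y by rewrite lt_min; apply/andP; split; clear -xb r0; lra.
  have yb : y < b by rewrite gt_min; apply/orP; left; clear -xb; lra.
  have yr : y <= x + r / 2 by rewrite ge_min lexx orbT.
  have := slG x y ax xy yb (- (D + 1)).
  rewrite coppE (chargeE_cdf nu (ltW xy)) -EFinN lee_fin => h.
  have {}h : - (cdf nu y - cdf nu x) <= - (D + 1) * (y - x).
    apply: h => z /andP[xz zy]; rewrite /flip opprK lerN2; apply/ltW/Hr.
    by rewrite /ball/= ltr_norml; apply/andP; split; clear -xz zy yr r0; lra.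
  have := nuD x y ax xy yb; move: h xy; move: (cdf _ _) (cdf _ _) => v1 v2; clear; nra.
move=> x xab; apply/andP; split; last first.
  apply: (key F V mu) => // s t as' st tb; first by have [] := sl s t as' st tb.
  by apply: le_trans (ler_norm _) _; exact: mvt.
rewrite -lerN2 -[leRHS]/(flip F (D + 1)).
apply: (key (flip F) (fun t => - V t) (copp mu)) => //.
- exact: flip_lt.
- by move=> t; apply: cvgN; exact: Vc.
- move=> s t as' st tb e He; have [H _] := sl s t as' st tb.
  rewrite coppE coppE oppeK; apply: H => z szt.
  by have := He z szt; rewrite /flip !opprK.
- move=> s t as' st tb; rewrite !cdf_copp; have := mvt s t as' st tb.
  by rewrite ler_norml => /andP[+ _]; move: (cdf _ _) (cdf _ _) => v1 v2; clear; lra.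
Qed.

End regularity.

(** * From uniform convergence of V to convergence in C^1 *)

Section C1_convergence.
Context {R : realType}.
Implicit Types (a b p c d D k : R) (u w F : R -> R) (mu nu : signed_measure R).

Lemma C1norm_le a b u W dW (e : R) : C1_representative a b u W dW ->
  (forall x, x \in `[a, b] -> `|W x| <= e /\ `|dW x| <= e) -> (C1norm a b u <= (e + e)%:E)%E.
Proof.
move=> HW He; apply: (@le_trans _ _ (ereal_sup [set `|W x|%:E | x in `[a, b]] +
         ereal_sup [set `|dW x|%:E | x in `[a, b]])%E).
  by apply: ereal_inf_lbound; exists W, dW.
by rewrite EFinD; apply: leeD; apply: ge_ereal_sup => _ [x xab <-]; rewrite lee_fin; have [] := He x xab.
Qed.

(** [Z] varies by at most (b - a) r, so |Z| is at least |Z x| - (b - a) r throughout; integrating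
    this constant bounds it by s / (b - a). *)
Lemma C1_sup_le a b (Z dZ : R -> R) (r s : R) : a < b -> 0 <= r ->
  {within `[a, b], continuous Z} -> (forall x, x \in `]a, b[ -> is_derive x 1 Z (dZ x)) ->
  (forall x, x \in `[a, b] -> `|dZ x| <= r) ->
  (\int[leb R]_(x in `]a, b[) `|Z x|%:E <= s%:E)%E ->
  forall x, x \in `[a, b] -> `|Z x| <= s / (b - a) + (b - a) * r.
Proof.
move=> ab r0 Zc Zd dZr Zs.
have ba0 : 0 < b - a by rewrite subr_gt0.
have lip x y : x \in `[a, b] -> y \in `[a, b] -> x <= y -> `|Z y - Z x| <= (b - a) * r.
  rewrite !in_itv/= => /andP[ax xb] /andP[ay yb] xy.
  have H1 z : z \in `]x, y[ -> is_derive z 1 Z (dZ z).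
    rewrite in_itv/= => /andP[xz zy]; apply: Zd; rewrite in_itv/=.
    by rewrite (le_lt_trans ax xz) (lt_le_trans zy yb).
  have H2 : {within `[x, y], continuous Z}.
    apply: continuous_subspaceW Zc => z /=; rewrite !in_itv/= => /andP[xz zy].
    by rewrite (le_trans ax xz) (le_trans zy yb).
  have [z] := MVT_segment xy H1 H2.
  rewrite in_itv/= => /andP[xz zy] ->; rewrite normrM mulrC.
  rewrite (@ger0_norm _ (y - x)) ?subr_ge0//; apply: ler_pM => //; first by rewrite subr_ge0.
    by clear -ax yb; lra.
  by apply: dZr; rewrite in_itv/= (le_trans ax xz) (le_trans zy yb).
move=> x xab; pose m := `|Z x| - (b - a) * r.
have mZ y : y \in `]a, b[ -> m <= `|Z y|.
  move=> yab; have yab' : y \in `[a, b] by move: yab; rewrite !in_itv/= => /andP[/ltW-> /ltW->].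
  have h : `|Z x - Z y| <= (b - a) * r.
    by have [xy|/ltW yx] := leP x y; [rewrite distrC|]; exact: lip.
  have := ler_normD (Z x - Z y) (Z y); rewrite subrK /m; move: h; clear; lra.
suff : m <= s / (b - a) by rewrite /m; clear; lra.
have [m0|m0] := leP m 0.
  apply: (le_trans m0); apply: divr_ge0; last exact: ltW.
  by rewrite -lee_fin; apply: le_trans Zs; exact: integral_ge0.
rewrite ler_pdivlMr// -lee_fin; apply: le_trans Zs.
have -> : (m * (b - a))%:E = (\int[leb R]_(x in `]a, b[) m%:E)%E.
  rewrite (integral_cst _ (measurable_itvR `]a, b[) m%:E).
  by have := @lebesgue_measure_itv R `]a, b[ => /= ->; rewrite lte_fin ab -EFinB -EFinM.
apply: ge0_le_integral => //.
- by move=> y _; rewrite lee_fin ltW.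
- apply/measurable_EFinP/measurableT_comp => //; apply: subspace_continuous_measurable_fun => //.
  apply: continuous_subspaceW Zc => z /=; rewrite !in_itv/= => /andP[xz zy].
  by rewrite !ltW.
Qed.

(** Both derivatives are values of F^-1, which is Lipschitz with constant 1/k on the image of
    [-D, D]; this bounds the derivative of the difference. The difference itself is then controlled
    by its L^1 norm, by [C1_sup_le]. *)
Lemma C1_close a b p F u c mu d w u0 c0 mu0 d0 w0 D k (eta s : R) :
  let V x := d + prim a b w x in let V0 x := d0 + prim a b w0 x in
  a < b -> 1 < p -> 0 <= D -> 0 < k -> (forall x y, (F x < F y) = (x < y)) -> continuous F ->
  (forall x y, - D <= x -> x <= y -> y <= D -> k * (y - x) <= F y - F x) ->
  represented a b p F u c mu d w -> represented a b p F u0 c0 mu0 d0 w0 ->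
  (forall x, x \in `]a, b[ -> F (- D) <= V x <= F D) ->
  (forall x, x \in `]a, b[ -> F (- D) <= V0 x <= F D) ->
  (forall x, x \in `]a, b[ -> `|V x - V0 x| <= eta) ->
  measurable_fun `]a, b[ u -> measurable_fun `]a, b[ u0 ->
  (\int[leb R]_(x in `]a, b[) `|u x - u0 x|%:E <= s%:E)%E ->
  C1 a b u /\ exists W dW, C1_representative a b (u \- u0) W dW /\
    forall x, x \in `[a, b] -> `|W x| <= s / (b - a) + (b - a) * (k^-1 * eta) /\ `|dW x| <= k^-1 * eta.
Proof.
move=> V V0 ab p1 D0 k0 Flt Fc Fk ru ru0 VD V0D VV0 mu_ mu0_ uu0.
have [phi [C1u Hphi]] := represented_C1 ab p1 D0 k0 Flt Fc Fk ru VD.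
have [phi0 [C1u0 Hphi0]] := represented_C1 ab p1 D0 k0 Flt Fc Fk ru0 V0D.
split; first by exists (fun x => c + cdf mu x), phi.
have [c1 c2 c3 c4] := C1u; have [e1 e2 e3 e4] := C1u0.
have [_ _ Lw _] := ru; have [_ _ Lw0 _] := ru0.
pose Z x := (c + cdf mu x) - (c0 + cdf mu0 x); pose dZ x := phi x - phi0 x.
have VV0c x : x \in `[a, b] -> `|V x - V0 x| <= eta.
  apply: (@ae_le_continuous _ a b (fun x => `|V x - V0 x|)) => //.
    move=> y; apply: cvg_norm; apply: cvgB; apply: cvgD; do ?exact: cvg_cst.
      exact: (prim_continuous p1 Lw).
    exact: (prim_continuous p1 Lw0).
  exact: (@aeW _ (measurableTypeR R)).
have dZe x : x \in `[a, b] -> `|dZ x| <= k^-1 * eta.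
  move=> xab; have [Fx x1 x2] := Hphi x xab; have [Fy y1 y2] := Hphi0 x xab.
  rewrite ler_pdivlMl//; apply: le_trans (VV0c x xab); rewrite -/(V x) -/(V0 x) in Fx Fy *.
  rewrite -Fx -Fy /dZ.
  have [xy|/ltW yx] := leP (phi x) (phi0 x).
    rewrite distrC [leRHS]distrC ger0_norm ?subr_ge0//; apply: le_trans (ler_norm _); exact: Fk.
  by rewrite ger0_norm ?subr_ge0//; apply: le_trans (ler_norm _); exact: Fk.
have Zrep : C1_representative a b (u \- u0) Z dZ.
  split.
  - by move=> x; apply: cvgB; [exact: c1|exact: e1].
  - by move=> x; apply: cvgB; [exact: c2|exact: e2].
  - by move=> x xab; have := c3 x xab; have := e3 x xab => ? ?; exact: is_deriveB.
  - by apply: ae_imp2 c4 e4 => x h1 h2 xab; rewrite /= h1// h2.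
have eta0 : 0 <= k^-1 * eta.
  have mab : (a + b) / 2 \in `[a, b] by rewrite in_itv/=; apply/andP; split; clear -ab; lra.
  exact: le_trans (normr_ge0 _) (dZe _ mab).
exists Z, dZ; split => // x xab; split; last exact: dZe.
have [z1 z2 z3 z4] := Zrep.
apply: (C1_sup_le ab eta0 z1 z3 dZe _ xab).
apply: le_trans uu0; rewrite le_eqVlt; apply/orP; left; apply/eqP; apply: ae_eq_integral => //.
- apply/measurable_EFinP/measurableT_comp => //; apply: subspace_continuous_measurable_fun => //.
  apply: continuous_subspaceW z1 => z /=; rewrite !in_itv/= => /andP[xz zy].
  by rewrite !ltW.
- by apply/measurable_EFinP/measurableT_comp => //; exact: measurable_funB.
- by apply: ae_imp z4 => y h yab; rewrite -h.
Qed.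

Context {I : Type} (U : set_system I) {FU : Filter U}.

Theorem C1_convergence a b p F (u : I -> R -> R) (c d : I -> R) (mu : I -> signed_measure R)
    (w : I -> R -> R) u0 c0 mu0 d0 w0 :
  a < b -> 1 < p -> (forall x y, (F x < F y) = (x < y)) -> continuous F ->
  (forall D, exists2 k, 0 < k & forall x y, - D <= x -> x <= y -> y <= D -> k * (y - x) <= F y - F x) ->
  (forall i, represented a b p F (u i) (c i) (mu i) (d i) (w i)) -> represented a b p F u0 c0 mu0 d0 w0 ->
  (forall i, measurable_fun `]a, b[ (u i)) -> measurable_fun `]a, b[ u0 ->
  (forall e : R, 0 < e -> \forall i \near U, (\int[leb R]_(x in `]a, b[) `|u i x - u0 x|%:E <= e%:E)%E) ->
  (forall e : R, 0 < e -> \forall i \near U, forall x, x \in `]a, b[ ->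
      `|(d i + prim a b (w i) x) - (d0 + prim a b w0 x)| <= e) ->
  C1 a b u0 ->
  (\forall i \near U, C1 a b (u i)) /\
  forall e : R, 0 < e -> \forall i \near U, (C1norm a b (u i \- u0)%R <= e%:E)%E.
Proof.
move=> ab p1 Flt Fc Flow ru ru0 um u0m L1 Vunif C1u0.
have [D D0 V0D] := C1_slope_bound ab p1 Flt ru0 C1u0.
have D10 : 0 <= D + 1 by rewrite addr_ge0.
have [k k0 Fk] := Flow (D + 1).
have F1 : F D < F (D + 1) by rewrite Flt ltrDl.
have F2 : F (- (D + 1)) < F (- D) by rewrite Flt ltrN2 ltrDl.
have ba0 : 0 < b - a by rewrite subr_gt0.
have main (e : R) : 0 < e -> \forall i \near U, C1 a b (u i) /\ (C1norm a b (u i \- u0)%R <= e%:E)%E.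
  move=> e0; pose e4 := e / 4; have e40 : 0 < e4 by rewrite divr_gt0.
  have e42 : e4 + e4 = e / 2 by rewrite /e4; lra.
  (* The first two terms keep V i between F (-(D + 1)) and F (D + 1), given that V0 lies between F
     (-D) and F D. The last two make the derivative bound, and b - a times it, at most e / 4. With
     the L^1 term each supremum is then at most e / 2. *)
  pose eta := Num.min (Num.min (F (D + 1) - F D) (F (- D) - F (- (D + 1))))
    (Num.min (k * e4) (k * (e4 / (b - a)))).
  have eta0 : 0 < eta.
    by rewrite /eta !lt_min !subr_gt0 F1 F2 (mulr_gt0 k0 e40) (mulr_gt0 k0) ?divr_gt0.
  have s0 : 0 < e4 * (b - a) by rewrite mulr_gt0.
  apply: filterS2 (L1 _ s0) (Vunif _ eta0) => i h1 h2.
  have E1 : eta <= F (D + 1) - F D by rewrite /eta !ge_min lexx.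
  have E2 : eta <= F (- D) - F (- (D + 1)) by rewrite /eta !ge_min lexx orbT.
  have E3 : k^-1 * eta <= e4 by rewrite ler_pdivrMl// /eta !ge_min lexx !orbT.
  have E4 : k^-1 * eta <= e4 / (b - a) by rewrite ler_pdivrMl// /eta !ge_min lexx !orbT.
  have VD x : x \in `]a, b[ -> F (- (D + 1)) <= d i + prim a b (w i) x <= F (D + 1).
    move=> xab; have := h2 x xab; have := V0D x xab; rewrite ler_norml => /andP[g1 g2] /andP[g3 g4].
    by apply/andP; split; clear -g1 g2 g3 g4 E1 E2; lra.
  have V0D' x : x \in `]a, b[ -> F (- (D + 1)) <= d0 + prim a b w0 x <= F (D + 1).
    move=> xab; have /andP[g1 g2] := V0D x xab.
    by apply/andP; split; clear -g1 g2 F1 F2; lra.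
  have [C1u [W [dW [HW HWe]]]] := C1_close ab p1 D10 k0 Flt Fc Fk (ru i) ru0 VD V0D' h2 (um i) u0m h1.
  split => //; apply: (@le_trans _ _ (e / 2 + e / 2)%:E); last by rewrite -splitr.
  apply: (C1norm_le HW) => x xab; have [b1 b2] := HWe x xab.
  split; last by apply: le_trans b2 _; rewrite -e42; clear -E3 e40; lra.
  apply: le_trans b1 _; rewrite -e42; apply: lerD; first by rewrite mulfK// gt_eqF.
  by rewrite mulrC -ler_pdivlMr.
split; first by apply: filterS (main 1 ltr01) => i [].
by move=> e e0; apply: filterS (main e e0) => i [].
Qed.

End C1_convergence.

(** * Boundedness of weakly* convergent sequences *)

Section uniform_boundedness.
Context {R : realType} (a b : R).
Implicit Types (f h : R -> R) (m B : R).

Lemma Lp_infty_bounded h : Lp a b +oo%E h ->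
  exists B : R, {ae leb R, forall x, x \in `]a, b[ -> `|h x| <= B}.
Proof.
move=> [mh]; rewrite unlock /= (_ : (0 < leb R [set: R])%E = true); last first.
  apply/idP; apply: (@lt_le_trans _ _ (leb R `]0, 1[%classic)).
    by have := @lebesgue_measure_itv R `]0, 1[ => /= ->; rewrite lte_fin ltr01 sube0 lte_fin.
  by apply: le_measure; rewrite ?inE.
move=> hs.
move: hs; set E := (X in (X < +oo)%E) => hs.
have [B HB] : exists B : R, (E <= B%:E)%E.
  case: E hs => [r| |]// _; first by exists r.
  by exists 0; rewrite leNye.
have HB' : {ae leb R, forall x, ((abse \o (EFin \o h) \_ `]a, b[) x <= B%:E)%E}.
  by apply/ess_sup_inf.ess_supP; exact: HB.
exists B; apply: ae_imp HB' => x /= + xab.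
by rewrite patchE mem_set// lee_fin.
Qed.

(** Doubling [B] until it becomes an essential bound locates the essential supremum within a factor
    2. *)
Lemma ess_bound_doubling h B : 0 < B -> Lp a b +oo%E h ->
  ~ {ae leb R, forall x, x \in `]a, b[ -> `|h x| <= B} ->
  exists m, [/\ B <= m, {ae leb R, forall x, x \in `]a, b[ -> `|h x| <= 2 * m} &
    ~ {ae leb R, forall x, x \in `]a, b[ -> `|h x| <= m}].
Proof.
move=> B0 Lh nB; have [M HM] := Lp_infty_bounded Lh.
pose P n := `[< {ae leb R, forall x, x \in `]a, b[ -> `|h x| <= B * 2 ^+ n} >].
have exP : exists n, P n.
  have [n Hn] : exists n : nat, M / B < n%:R.
    by exists (Num.truncn (`|M / B|)).+1; apply: le_lt_trans (ler_norm _) _; exact: truncnS_gt.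
  exists n; apply/asboolP; apply: ae_imp HM => x hx xab; apply: (le_trans (hx xab)).
  rewrite -ler_pdivrMl// mulrC; apply: (le_trans (ltW Hn)).
  by rewrite -natrX ler_nat ltnW// ltn_expl.
case: (ex_minnP exP) => -[|n] /asboolP Pn nmin.
  by exfalso; apply: nB; rewrite expr0 mulr1 in Pn.
exists (B * 2 ^+ n); split.
- by rewrite ler_pMr// exprn_ege1// ler1n.
- by move: Pn; rewrite exprS mulrCA.
- by move=> H; have := nmin n; rewrite ltnn => H'; have : false by apply: H'; apply/asboolP.
Qed.

(** One of the sets where h > m or h < -m has positive measure; its normalized indicator has
    integral 1 and tests [h] above m. *)
Lemma bump_exists h m : 0 < m -> Lp a b +oo%E h ->
  ~ {ae leb R, forall x, x \in `]a, b[ -> `|h x| <= m} ->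
  exists phi : R -> R, [/\ forall x, 0 <= phi x, measurable_fun [set: measurableTypeR R] phi,
    (exists M, forall x, phi x <= M),
    (\int[leb R]_(x in `]a, b[) (phi x)%:E = 1)%E &
    m <= `|\int[leb R]_(x in `]a, b[) (h x * phi x)|].
Proof.
move=> m0 Lh; have [mh _] := Lh; have [M HM] := Lp_infty_bounded Lh.
pose A1 : set (measurableTypeR R) := `]a, b[ `&` h @^-1` `]m, +oo[.
pose A2 : set (measurableTypeR R) := `]a, b[ `&` h @^-1` `]-oo, - m[.
have mA1 : measurable A1 by exact: mh.
have mA2 : measurable A2 by exact: mh.
have main (A : set (measurableTypeR R)) (s : R) : measurable A -> A `<=` `]a, b[ -> `|s| = 1 ->
    (forall x, A x -> m <= s * h x) -> leb R A <> 0%E ->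
    exists phi : R -> R, [/\ forall x, 0 <= phi x, measurable_fun [set: measurableTypeR R] phi,
      (exists M, forall x, phi x <= M),
      (\int[leb R]_(x in `]a, b[) (phi x)%:E = 1)%E &
      m <= `|\int[leb R]_(x in `]a, b[) (h x * phi x)|].
  move=> mA Aab s1 sh A0.
  have lA : (leb R A < +oo)%E.
    by apply: le_lt_trans (leb_itv_lty a b false true); rewrite le_measure ?inE.
  have Afin : leb R A \is a fin_num by rewrite ge0_fin_numE.
  set r := fine (leb R A); have rE : leb R A = r%:E by rewrite fineK.
  have r0 : 0 < r.
    by rewrite lt_neqAle fine_ge0// andbT eq_sym; apply/eqP => h0; apply: A0; rewrite rE h0.
  pose phi x := r^-1 * \1_A x.
  have mphi : measurable_fun [set: measurableTypeR R] phi.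
    by apply: measurable_funM => //; exact: measurable_indic.
  have phi0 x : 0 <= phi x by rewrite mulr_ge0// invr_ge0 ltW.
  have phiM x : phi x <= r^-1.
    by rewrite /phi ler_piMr// ?invr_ge0 ?ltW// indicE; case: (_ \in _).
  have intphi : (\int[leb R]_(x in `]a, b[) (phi x)%:E = 1)%E.
    under eq_integral do rewrite EFinM.
    rewrite ge0_integralZl//; last 2 first.
      by apply/measurable_EFinP; apply: measurable_funTS; exact: measurable_indic.
      by rewrite lee_fin invr_ge0 ltW.
    rewrite (integral_indic (leb R) (measurable_itvR `]a, b[) mA).
    rewrite (_ : A `&` _ = A); last exact/setIidl.
    rewrite [X in (_ * X)%E](_ : _ = r%:E); last exact: rE.
    by rewrite -EFinM mulVf// gt_eqF.
  exists phi; split => //; first by exists r^-1.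
  have iphi : (leb R).-integrable `]a, b[ (EFin \o phi).
    apply: (integrable_bounded_itv (M := r^-1)); first exact: measurable_funTS.
    by move=> x _; rewrite ger0_norm.
  have ihphi : (leb R).-integrable `]a, b[ (EFin \o (fun x => h x * phi x)).
    apply/integrableP; split.
      by apply/measurable_EFinP; apply: measurable_funM => //; exact: measurable_funTS.
    apply: (@le_lt_trans _ _ (\int[leb R]_(x in `]a, b[) (`|M| * r^-1)%:E)%E); last first.
      rewrite (integral_cst _ (measurable_itvR `]a, b[) (`|M| * r^-1)%:E).
      by have := @lebesgue_measure_itv R `]a, b[ => /= ->; case: ifP; rewrite ?mule0 -?EFinB -?EFinM ltry.
    apply: ae_ge0_le_integral => //.
    - by apply: measurableT_comp => //; apply/measurable_EFinP; apply: measurable_funM => //; exact: measurable_funTS.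
    - by move=> x _; rewrite lee_fin mulr_ge0// invr_ge0 ltW.
    - apply: ae_imp HM => x hx xab; rewrite /= lee_fin normrM ler_pM//.
        by apply: le_trans (hx xab) (ler_norm _).
      by rewrite ger0_norm.
  have e1 : \int[leb R]_(x in `]a, b[) (s * (h x * phi x)) = s * \int[leb R]_(x in `]a, b[) (h x * phi x).
    by rewrite RintegralZl.
  have -> : `|\int[leb R]_(x in `]a, b[) (h x * phi x)| = `|s * \int[leb R]_(x in `]a, b[) (h x * phi x)|.
    by rewrite normrM s1 mul1r.
  rewrite -e1; apply: le_trans (ler_norm _).
  have -> : m = \int[leb R]_(x in `]a, b[) (m * phi x).
    by rewrite RintegralZl//; rewrite /Rintegral intphi mulr1.
  apply: le_Rintegral => //; [exact: integrable_cmul|exact: integrable_cmul|].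
  move=> x _; rewrite /phi indicE; have [xA|xA] := boolP (x \in A); last by rewrite !mulr0.
  rewrite mulr1 mulrA; apply: ler_wpM2r; first by rewrite invr_ge0 ltW.
  by apply: sh; exact: set_mem.
move=> nm; have [A10|A10] := eqVneq (leb R A1) 0%E; last first.
  apply: (main A1 1) => //; first exact: subIsetl; first by rewrite normr1.
    by move=> x [_]; rewrite /= in_itv/= andbT mul1r => /ltW.
  exact/eqP.
have [A20|A20] := eqVneq (leb R A2) 0%E; last first.
  apply: (main A2 (-1)) => //; first exact: subIsetl; first by rewrite normrN1.
    by move=> x [_]; rewrite /= in_itv/= mulN1r lerNr => /ltW.
  exact/eqP.
exfalso; apply: nm.
have n1 : {ae leb R, forall x, ~ A1 x} by exists A1; split => // x /contrapT.
have n2 : {ae leb R, forall x, ~ A2 x} by exists A2; split => // x /contrapT.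
apply: ae_imp2 n1 n2 => x h1 h2 xab; rewrite ler_norml; apply/andP; split.
- by rewrite leNgt; apply/negP => hx; apply: h2; split => //; rewrite /= in_itv.
- by rewrite leNgt; apply/negP => hx; apply: h1; split => //; rewrite /= in_itv/= hx.
Qed.

(** The ratio is matched with the bounds m k >= 16^k chosen later: the k-th bump contributes q^k m k
    >= 2^k, while everything after it contributes at most 2 m k (16/7) q^(k+1) = (4/7) q^k m k. So
    3/7 of the contribution survives. *)
Let q : R := 8^-1.

Lemma geometric_tail_le K n :
  \sum_(0 <= i < n) (if (K <= i)%N then q ^+ i else 0) <= 8 / 7 * q ^+ K.
Proof.
have q0 : 0 < q by rewrite invr_gt0.
have qn i : 0 < q ^+ i by exact: exprn_gt0.
(* The exact partial sum, with - q^n kept, is what the induction carries. *)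
have H : \sum_(0 <= i < n) (if (K <= i)%N then q ^+ i else 0) <=
    if (K <= n)%N then 8 / 7 * (q ^+ K - q ^+ n) else 0.
  elim: n => [|n IH].
    by rewrite big_geq//; case: ifP => // /[!leqn0] /eqP ->; rewrite subrr mulr0.
  rewrite big_nat_recr//=; move: IH; rewrite [(K <= n.+1)%N]leq_eqVlt.
  have [->|Kn] := eqVneq K n.+1.
    by rewrite ltnn subrr mulr0 addr0.
  rewrite /= ltnS; case: ifP => // Kn'; last by rewrite addr0.
  rewrite exprS; move: (q ^+ K) (q ^+ n) => x y; rewrite /q; set S := \sum_(_ <= _ < _) _; lra.
apply: (le_trans H); case: ifP => _; first by rewrite ler_wpM2l ?gerBl ?(ltW (qn _))//; lra.
by rewrite mulr_ge0 ?(ltW (qn _))//; lra.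
Qed.

(** The flags [c] select the bumps of one sign, so that the series has nonnegative terms and can be
    integrated termwise. The signed series is the difference of two such sums. *)
Lemma series_tail (e : nat -> R -> R) (c : nat -> bool) :
  (forall k x, 0 <= e k x) -> (forall k, measurable_fun [set: measurableTypeR R] (e k)) ->
  (forall k, (\int[leb R]_(x in `]a, b[) (e k x)%:E = (q ^+ k)%:E)%E) ->
  exists f, (leb R).-integrable `]a, b[ (EFin \o f) /\ forall K,
    (\int[leb R]_(x in `]a, b[) `|f x - \sum_(0 <= k < K) (c k)%:R * e k x|%:E <= (8 / 7 * q ^+ K)%:E)%E.
Proof.
move=> e0 me ie.
pose g k x : \bar R := ((c k)%:R * e k x)%:E.
have g0 k x : (0 <= g k x)%E by rewrite lee_fin mulr_ge0.
have mg k : measurable_fun `]a, b[ (g k).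
  apply/measurable_EFinP; apply: measurable_funTS.
  by apply: measurable_funM => //; exact: me.
pose S x := (\sum_(k <oo) g k x)%E.
pose tail K x := (\sum_(k <oo) (if (K <= k)%N then g k x else 0))%E.
have SE K x : S x = ((\sum_(0 <= k < K) (c k)%:R * e k x)%:E + tail K x)%E.
  rewrite /S (nneseries_split 0 K); last by move=> k _; exact: g0.
  by rewrite add0n sumEFin eseries_cond eseries_mkcond.
have tail0 K x : (0 <= tail K x)%E by apply: nneseries_ge0 => k _ _; case: ifP.
have mif K k : measurable_fun `]a, b[ (fun x => if (K <= k)%N then g k x else 0%E).
  by case: (K <= k)%N.
have mtail K : measurable_fun `]a, b[ (tail K).
  apply: (ge0_emeasurable_sum (P := xpredT)) => //.
  by move=> k x _ _; case: ifP.
have itail K : (\int[leb R]_(x in `]a, b[) tail K x <= (8 / 7 * q ^+ K)%:E)%E.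
  rewrite integral_nneseries//; [|exact: mif|by move=> k x _; case: ifP].
  apply: lime_le; first by apply: is_cvg_nneseries => k _ _; apply: integral_ge0 => x _; case: ifP.
  apply: nearW => n; apply: (@le_trans _ _ (\sum_(0 <= i < n) (if (K <= i)%N then q ^+ i else 0))%:E); last first.
    by rewrite lee_fin geometric_tail_le.
  rewrite -sumEFin; apply: lee_sum => k _; case: ifP => _; last by rewrite integral0.
  rewrite -ie; apply: ge0_le_integral => //.
  - exact: mg.
  - by apply/measurable_EFinP; apply: measurable_funTS; exact: me.
  - by move=> x _; rewrite lee_fin ler_piMl//; case: (c k).
have mS : measurable_fun `]a, b[ S.
  by apply: (ge0_emeasurable_sum (P := xpredT)) => //.
pose f x := fine (S x).
have mf : measurable_fun `]a, b[ f by exact: measurableT_comp.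
have mpart K : measurable_fun `]a, b[ (fun x => \sum_(0 <= k < K) (c k)%:R * e k x).
  apply: measurable_funTS; apply: measurable_sum => k.
  by apply: measurable_funM => //; exact: me.
have bound K : (\int[leb R]_(x in `]a, b[) `|f x - \sum_(0 <= k < K) (c k)%:R * e k x|%:E <= (8 / 7 * q ^+ K)%:E)%E.
  apply: le_trans (itail K); apply: ge0_le_integral => //.
  - by apply/measurable_EFinP/measurableT_comp => //; apply: measurable_funB => //; exact: mpart.
  - exact: mtail.
  move=> x _; rewrite /f (SE K); move: (tail K x) (tail0 K x) => [t| |] t0 /=; rewrite ?leey//.
  by rewrite lee_fin addrAC subrr add0r ger0_norm.
exists f; split => //; apply/integrableP; split; first exact/measurable_EFinP.
have := bound 0%N; under eq_integral do rewrite big_geq// subr0.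
by move=> h; apply: (le_lt_trans h); rewrite ltry.
Qed.

Lemma ae_bounded_mul h f B (s : R) : 0 <= B -> measurable_fun `]a, b[ h ->
  {ae leb R, forall x, x \in `]a, b[ -> `|h x| <= B} ->
  (leb R).-integrable `]a, b[ (EFin \o f) ->
  (leb R).-integrable `]a, b[ (EFin \o (fun x => h x * f x)) /\
  ((\int[leb R]_(x in `]a, b[) `|f x|%:E <= s%:E)%E ->
    `|\int[leb R]_(x in `]a, b[) (h x * f x)| <= B * s).
Proof.
move=> B0 mh hB intf.
have mf : measurable_fun `]a, b[ f by have /integrableP[/measurable_EFinP] := intf.
have mhf : measurable_fun `]a, b[ (fun x => h x * f x) by exact: measurable_funM.
have absf : (\int[leb R]_(x in `]a, b[) `|f x|%:E < +oo)%E by have /integrableP[] := intf.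
have le : (\int[leb R]_(x in `]a, b[) `|h x * f x|%:E <= B%:E * \int[leb R]_(x in `]a, b[) `|f x|%:E)%E.
  rewrite -ge0_integralZl//; last first.
    by apply/measurable_EFinP; exact: measurableT_comp.
  apply: ae_ge0_le_integral => //.
  - by apply/measurable_EFinP; exact: measurableT_comp.
  - by move=> x _; rewrite -EFinM lee_fin mulr_ge0.
  - by apply/measurable_EFinP; apply: measurable_funM => //; exact: measurableT_comp.
  - by apply: ae_imp hB => x hx xab; rewrite -EFinM lee_fin normrM ler_wpM2r// hx.
have inthf : (leb R).-integrable `]a, b[ (EFin \o (fun x => h x * f x)).
  apply/integrableP; split; first exact/measurable_EFinP.
  apply: (le_lt_trans le); rewrite -ge0_fin_numE; last first.
    by apply: mule_ge0; rewrite ?lee_fin//; exact: integral_ge0.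
  by apply: fin_numM => //; rewrite ge0_fin_numE//; exact: integral_ge0.
split=> // fs; apply: (le_trans (le_normr_Rintegral _ inthf)) => //.
rewrite -lee_fin /Rintegral fineK; last first.
  exact: (integrable_fin_num _ (integrable_norm inthf)).
by apply: (le_trans le); rewrite EFinM lee_wpmul2l.
Qed.

(* Sokal's argument: [f] is the sum of the bumps [8^-k phi_k] with signs chosen so
   that the k-th partial sum is large against [h (n k)]. *)
Theorem weak_star_bounded (h : nat -> R -> R) : a < b -> (forall n, Lp a b +oo%E (h n)) ->
  weak_star_to0 a b h ->
  exists B : R, 0 < B /\ forall n, {ae leb R, forall x, x \in `]a, b[ -> `|h n x| <= B}.
Proof.
move=> ab Lh h0; apply: contrapT => unb.
have q0 : 0 < q by rewrite invr_gt0.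
have qn i : 0 < q ^+ i by exact: exprn_gt0.
have B0 k : 0 < 16 ^+ k :> R by exact: exprn_gt0.
have bump k : exists x : nat * R * (R -> R),
  [/\ 16 ^+ k <= x.1.2, {ae leb R, forall t, t \in `]a, b[ -> `|h x.1.1 t| <= 2 * x.1.2} &
    [/\ forall t, 0 <= x.2 t, measurable_fun [set: measurableTypeR R] x.2,
      (exists M, forall t, x.2 t <= M),
      (\int[leb R]_(t in `]a, b[) (x.2 t)%:E = 1)%E &
      x.1.2 <= `|\int[leb R]_(t in `]a, b[) (h x.1.1 t * x.2 t)|]].
  have [n Hn] : exists n, ~ {ae leb R, forall x, x \in `]a, b[ -> `|h n x| <= 16 ^+ k}.
    apply/existsNP => H; apply: unb; exists (16 ^+ k); split => //.
  have [m [m1 m2 m3]] := ess_bound_doubling (B0 k) (Lh n) Hn.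
  have [phi Hphi] := bump_exists (lt_le_trans (B0 k) m1) (Lh n) m3.
  by exists (n, m, phi).
move: bump => /choice[s Hs].
pose n k := (s k).1.1; pose m k := (s k).1.2; pose phi k := (s k).2.
have m0 k : 0 <= 2 * m k.
  by have [m1 _ _] := Hs k; rewrite mulr_ge0// (le_trans _ m1)// ltW.
pose e k x := q ^+ k * phi k x.
have e0 k x : 0 <= e k x.
  by have [_ _ [p0 _ _ _ _]] := Hs k; apply: mulr_ge0; [exact: ltW|exact: p0].
have me k : measurable_fun [set: measurableTypeR R] (e k).
  by have [_ _ [_ mp _ _ _]] := Hs k; exact: measurable_funM.
have ie k : (\int[leb R]_(x in `]a, b[) (e k x)%:E = (q ^+ k)%:E)%E.
  have [_ _ [p0 mp _ ip _]] := Hs k.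
  under eq_integral do rewrite EFinM.
  rewrite ge0_integralZl// ?ip ?mule1//.
  - by apply/measurable_EFinP; exact: measurable_funTS.
  - by move=> x _; rewrite lee_fin; exact: p0.
  - by rewrite lee_fin ltW.
have inte k : (leb R).-integrable `]a, b[ (EFin \o e k).
  apply/integrableP; split; first by apply/measurable_EFinP; apply: measurable_funTS; exact: me.
  under eq_integral do rewrite /= ger0_norm//.
  by rewrite ie ltry.
pose T k f := \int[leb R]_(x in `]a, b[) (h (n k) x * f x).
have Tb k f (r : R) : (leb R).-integrable `]a, b[ (EFin \o f) ->
    (leb R).-integrable `]a, b[ (EFin \o (fun x => h (n k) x * f x)) /\
    ((\int[leb R]_(x in `]a, b[) `|f x|%:E <= r%:E)%E -> `|T k f| <= 2 * m k * r).
  move=> intf; have [_ hm _] := Hs k; have [mh _] := Lh (n k).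
  exact: ae_bounded_mul.
have TD k f g : (leb R).-integrable `]a, b[ (EFin \o f) -> (leb R).-integrable `]a, b[ (EFin \o g) ->
    T k (fun x => f x + g x) = T k f + T k g.
  move=> intf intg; have [i1 _] := Tb k f 0 intf; have [i2 _] := Tb k g 0 intg.
  by rewrite -RintegralD//; apply: eq_Rintegral => x _; rewrite mulrDr.
have intN f : (leb R).-integrable `]a, b[ (EFin \o f) -> (leb R).-integrable `]a, b[ (EFin \o (fun x => - f x)).
  move=> intf; have := integrable_cmul (-1) (measurable_itvR `]a, b[) intf.
  by under [X in EFin \o X]eq_fun do rewrite mulN1r.
have TN k f : (leb R).-integrable `]a, b[ (EFin \o f) -> T k (fun x => - f x) = - T k f.
  move=> intf; have [i1 _] := Tb k f 0 intf.
  by rewrite -mulN1r -RintegralZl//; apply: eq_Rintegral => x _; rewrite mulrN mulN1r.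
(* T f + T e and T f - T e differ by 2 T e, so at least one of them is at least |T e| in absolute
   value; the flag records whether the sign + works. *)
pose sgn k f := `|T k (e k)| <= `|T k f + T k (e k)|.
pose f K := iteri K (fun k f x => f x + (if sgn k f then e k x else - e k x)) (fun=> 0).
pose c k := sgn k (f k).
have fS k : f k.+1 = fun x => f k x + (if c k then e k x else - e k x) by rewrite /f iteriS.
have inte' k : (leb R).-integrable `]a, b[ (EFin \o (fun x => if c k then e k x else - e k x)).
  by case: (c k) => //; exact: intN.
have intf k : (leb R).-integrable `]a, b[ (EFin \o f k).
  elim: k => [|k IH]; first exact: (integrable0 (leb R)).
  by rewrite fS; exact: (integrableD (measurable_itvR _) IH (inte' k)).
have fE K x : f K x = \sum_(0 <= k < K) (c k)%:R * e k x - \sum_(0 <= k < K) (~~ c k)%:R * e k x.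
  elim: K => [|K IH]; first by rewrite !big_geq// subrr.
  rewrite fS IH !big_nat_recr//=; case: (c K); rewrite ?mul1r ?mul0r ?addr0; set x1 := \sum_(_ <= _ < _) _; set x2 := \sum_(_ <= _ < _) _; lra.
have Tf k : q ^+ k * m k <= `|T k (f k.+1)|.
  have [_ _ [_ _ _ _ Tphi]] := Hs k.
  have Te : q ^+ k * m k <= `|T k (e k)|.
    have -> : T k (e k) = q ^+ k * \int[leb R]_(x in `]a, b[) (h (n k) x * phi k x).
      rewrite -RintegralZl//; last first.
        have [i1 _] := Tb k _ 0 (integrable_cmul (q ^- k) (measurable_itvR `]a, b[) (inte k)).
        apply: eq_integrable i1 => // x _; by rewrite /= /e mulKf// gt_eqF.
      by apply: eq_Rintegral => x _; rewrite /e mulrCA.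
    by rewrite normrM (ger0_norm (ltW (qn k))) ler_wpM2l// ltW.
  apply: (le_trans Te); rewrite fS TD//.
  have [ck|] := boolP (c k); first exact: ck.
  rewrite TN// /c /sgn -ltNge => h1.
  have := ler_normB (T k (f k) + T k (e k)) (T k (f k) - T k (e k)).
  have -> : T k (f k) + T k (e k) - (T k (f k) - T k (e k)) = T k (e k) *+ 2 by rewrite mulr2n; lra.
  rewrite normrMn mulr2n; lra.
have [fp [ifp Hfp]] := series_tail c e0 me ie.
have [fm [ifm Hfm]] := series_tail (fun k => ~~ c k) e0 me ie.
pose G x := fp x - fm x.
have iG : (leb R).-integrable `]a, b[ (EFin \o G) by exact: (integrableB (measurable_itvR _) ifp ifm).
have iGf k : (leb R).-integrable `]a, b[ (EFin \o (fun x => G x - f k x)).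
  exact: (integrableB (measurable_itvR _) iG (intf k)).
have Gf K : (\int[leb R]_(x in `]a, b[) `|G x - f K x|%:E <= (16 / 7 * q ^+ K)%:E)%E.
  have msum (c' : nat -> bool) : measurable_fun `]a, b[ (fun x => \sum_(0 <= k < K) (c' k)%:R * e k x).
    apply: measurable_funTS; apply: measurable_sum => k.
    by apply: measurable_funM => //; exact: me.
  have mfp : measurable_fun `]a, b[ fp by have /integrableP[/measurable_EFinP] := ifp.
  have mfm : measurable_fun `]a, b[ fm by have /integrableP[/measurable_EFinP] := ifm.
  have mabs (g1 g2 : R -> R) : measurable_fun `]a, b[ g1 -> measurable_fun `]a, b[ g2 ->
      measurable_fun `]a, b[ (fun x => `|g1 x - g2 x|%:E).
    by move=> m1 m2; apply/measurable_EFinP/measurableT_comp => //; exact: measurable_funB.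
  have -> : 16 / 7 * q ^+ K = 8 / 7 * q ^+ K + 8 / 7 * q ^+ K by lra.
  rewrite EFinD; apply: le_trans (leeD (Hfp K) (Hfm K)).
  rewrite -ge0_integralD//; [|exact: mabs|exact: mabs].
  apply: ge0_le_integral => //.
  - by have /integrableP[/measurable_EFinP mGf _] := iGf K; apply/measurable_EFinP/measurableT_comp.
  - by apply: emeasurable_funD; exact: mabs.
  move=> x _; rewrite -EFinD lee_fin fE /G.
  set x1 := \sum_(_ <= _ < _) _; set x2 := \sum_(_ <= _ < _) _.
  by rewrite (_ : _ - _ = (fp x - x1) - (fm x - x2)) ?ler_normB//; lra.
have TG k : 3 / 7 * 2 ^+ k <= `|T k G|.
  have [m1 _ _] := Hs k.
  have [_ /(_ (Gf k.+1))] := Tb k _ (16 / 7 * q ^+ k.+1) (iGf k.+1).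
  have -> : T k (fun x => G x - f k.+1 x) = T k G - T k (f k.+1).
    by rewrite -TN// -TD//; exact: intN.
  have := Tf k; have := ler_normB (T k G) (T k G - T k (f k.+1)).
  rewrite opprB addrCA subrr addr0.
  move: (`|T k G|) (`|T k (f k.+1)|) (`|T k G - T k (f k.+1)|) => x y z.
  rewrite exprS -/(m k) in m1 *.
  have : 2 ^+ k <= q ^+ k * m k.
    rewrite mulrC -ler_pdivrMr//; apply: le_trans m1; rewrite ler_pdivrMr// -exprMn.
    by rewrite le_eqVlt; apply/orP; left; apply/eqP; congr (_ ^+ _); rewrite /q; lra.
  rewrite /q; move: (8^-1 ^+ k) (2 ^+ k) => Q t; move: (m k) => M0.
  have -> : 2 * M0 * (16 / 7 * (8^-1 * Q)) = 4 / 7 * (Q * M0) by lra.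
  by move: (Q * M0) => P; lra.
have cG : cvgn (fun n => \int[leb R]_(x in `]a, b[) (h n x * G x)).
  by apply/cvg_ex; exists 0; exact: h0.
have [M [_ HM]] := cvg_seq_bounded cG.
have [k Hk] : exists k : nat, (M + 1) * (7 / 3) < k%:R.
  by exists (Num.truncn (`|(M + 1) * (7 / 3)|)).+1; apply: le_lt_trans (ler_norm _) _; exact: truncnS_gt.
have M1 : M < M + 1 by rewrite ltrDl.
have := HM (M + 1) M1 (n k) Logic.I; rewrite /= => h1.
have := le_trans (TG k) h1.
have k2 : k%:R <= 2 ^+ k :> R by rewrite -natrX ler_nat ltnW// ltn_expl.
move: k2 Hk; move: (2 ^+ k) (k%:R : R) => x y; clear; lra.
Qed.

End uniform_boundedness.

(** * The minimization problems *)

Section minimization.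
Context {R : realType} (a b p : R) (psi : R -> R).
Hypothesis ab : a < b.
Hypothesis p_gt1 : 1 < p.
Hypothesis psi_gt0 : forall t, 0 < psi t.
Hypothesis psi_meas : measurable_fun [set: R] psi.
Hypothesis psi_bounded : exists B : R, forall t, psi t <= B.
Hypothesis psi_inf : forall K : set R, compact K ->
  (0 < ereal_inf [set (psi t)%:E | t in K])%E.
Hypothesis psi_int : (\int[leb R]_t (psi t `^ p^-1)%:E < +oo)%E.

Let F := PsiR p psi.
Let F_lt : forall x y, (F x < F y) = (x < y).
Proof. by move=> x y; exact: PsiR_lt. Qed.
Let F_cont : continuous F. Proof. exact: PsiR_continuous. Qed.
Let F_bounded : exists M : R, forall x, 0 <= F x <= M. Proof. exact: PsiR_bounded. Qed.
Let F_lower : forall D, exists2 k, 0 < k &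
  forall x y, - D <= x -> x <= y -> y <= D -> k * (y - x) <= F y - F x.
Proof. by move=> D; exact: PsiR_lower. Qed.

Let wd u := weak_deriv a b p (Psi_Da a b p psi u).

Lemma FbarE u : X a b p psi u ->
  Fbar a b p psi u = (total_var (Du a b u) setT + energy a b p (wd u))%E.
Proof.
move=> [bvu _ _ _]; rewrite /Fbar -/(energy a b p (wd u)); congr (_ + _)%E.
have [Du0 _] := Du_spec bvu.
have mI : measurable (`]a, b[ : set (measurableTypeR R)) by exact: measurable_itvR.
have mC : measurable (~` `]a, b[ : set (measurableTypeR R)) by exact: measurableC.
have [[mP _] [mN _] _ _] := hahnP (Du a b u).
rewrite -(setUv (`]a, b[ : set (measurableTypeR R))) measureU ?setICr//.
rewrite [X in (_ + X)%E](_ : _ = 0%E) ?adde0//.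
apply: (eq_trans (total_varE _ _)); rewrite pos_partE// neg_partE//.
have D0 (A : set (measurableTypeR R)) : measurable A -> Du a b u (~` `]a, b[ `&` A) = 0%E.
  by move=> mA; apply: Du0; [exact: measurableI|exact: subIsetl].
by rewrite (D0 _ mP) (D0 _ mN) sube0.
Qed.

Lemma Fbar_fin u : X a b p psi u -> Fbar a b p psi u \is a fin_num.
Proof.
move=> uX; have [_ Wv _ _] := uX; have [Lw _] := weak_deriv_spec Wv.
have p0 : 0 < p := lt_trans ltr01 p_gt1.
have [_ ew] := (Lp_energy a b _ p0).1 Lw.
by rewrite FbarE// fin_numD total_var_fin_num// ge0_fin_numE ?energy_ge0.
Qed.

Lemma X_integrable u : X a b p psi u -> (leb R).-integrable `]a, b[ (EFin \o u).
Proof. by case=> -[]. Qed.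

(** A priori bounds for the compactness theorem. [c] is u - cdf almost everywhere, hence controlled
    in mean by the L^1 norm and the total variation; [d] is the value of V at [a], where [prim]
    vanishes, and V stays within the bounds of F. *)
Lemma X_represented_bounds u : X a b p psi u -> exists c d,
  [/\ represented a b p F u c (Du a b u) d (wd u),
    `|c| * (b - a) <= fine (\int[leb R]_(x in `]a, b[) `|u x|%:E)%E +
      fine (total_var (Du a b u) setT) * (b - a) &
    forall M, (forall x, 0 <= F x <= M) -> `|d| <= M].
Proof.
move=> uX; have [c [d [Hrep FV]]] := X_represented ab p_gt1 F_lt F_cont F_bounded uX.
have iu := X_integrable uX; have [_ uc Lw _] := Hrep.
exists c, d; split => //.
- set t := fine (total_var _ _).
  have E (r : R) : (\int[leb R]_(x in `]a, b[) r%:E = (r * (b - a))%:E)%E.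
    rewrite (integral_cst _ (measurable_itvR `]a, b[) r%:E).
    by have := @lebesgue_measure_itv R `]a, b[ => /= ->; rewrite lte_fin ab -EFinB -EFinM.
  have mu_ : measurable_fun `]a, b[ u by have /integrableP[/measurable_EFinP] := iu.
  have fin : (\int[leb R]_(x in `]a, b[) `|u x|%:E)%E \is a fin_num.
    by rewrite ge0_fin_numE ?integral_ge0//; have /integrableP[] := iu.
  have t0 : 0 <= t by exact: fine_ge0.
  rewrite -lee_fin EFinD fineK// -!E -ge0_integralD//; last first.
    by apply/measurable_EFinP; exact: measurableT_comp.
  apply: ae_ge0_le_integral => //.
  + by move=> x _; rewrite -EFinD lee_fin addr_ge0.
  + by apply: emeasurable_funD => //; apply/measurable_EFinP; exact: measurableT_comp.
  apply: ae_imp uc => x h xab; rewrite -EFinD lee_fin.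
  have -> : c = u x - cdf (Du a b u) x by rewrite h// addrK.
  by apply: le_trans (ler_normB _ _) _; rewrite lerD2l normr_cdf_le.
- move=> M HM.
  have aab : a \in `[a, b] by rewrite in_itv/= lexx ltW.
  have prima : prim a b (wd u) a = 0.
    rewrite /prim /Rintegral (_ : integral _ _ _ = 0%E)//; apply: integral0_eq => x.
    rewrite /= in_itv/= => xa; rewrite patchE; case: ifPn => // /set_mem.
    by rewrite /= in_itv/= => /andP[ax _]; have := lt_le_trans ax xa; rewrite ltxx.
  have Vc : continuous (fun x => d + prim a b (wd u) x).
    by move=> x; apply: cvgD; [exact: cvg_cst|exact: (prim_continuous p_gt1 Lw)].
  have h1 : d + prim a b (wd u) a <= M.
    apply: (ae_le_continuous ab Vc _ aab); apply: ae_imp FV => x h xab.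
    by rewrite -h//; have /andP[] := HM (Da a b u x).
  have h2 : - (d + prim a b (wd u) a) <= 0.
    have Vc' : continuous (fun x => - (d + prim a b (wd u) x)) by move=> x; apply: cvgN; exact: Vc.
    apply: (ae_le_continuous ab Vc' _ aab); apply: ae_imp FV => x h xab.
    by rewrite -h// oppr_le0; have /andP[] := HM (Da a b u x).
  move: h1 h2; rewrite prima addr0 oppr_le0 => h1 h2.
  by rewrite ger0_norm.
Qed.

Section limits.
Context {I : Type} (U : set_system I) {UU : UltraFilter U}.

Theorem X_compactness (u : I -> R -> R) (K : R) : (forall i, X a b p psi (u i)) ->
  (forall i, (Fbar a b p psi (u i) <= K%:E)%E) ->
  (forall i, (\int[leb R]_(x in `]a, b[) `|u i x|%:E <= K%:E)%E) ->
  exists u0, [/\ X a b p psi u0,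
    forall e : R, 0 < e -> \forall i \near U, (\int[leb R]_(x in `]a, b[) `|u i x - u0 x|%:E <= e%:E)%E,
    forall l : R, (\forall i \near U, (Fbar a b p psi (u i) <= l%:E)%E) ->
      (Fbar a b p psi u0 <= l%:E)%E &
    C1 a b u0 -> (\forall i \near U, C1 a b (u i)) /\
      forall e : R, 0 < e -> \forall i \near U, (C1norm a b (u i \- u0)%R <= e%:E)%E].
Proof.
move=> uX FK uK.
have /choice[cd Hcd] : forall i, exists cd : R * R,
    [/\ represented a b p F (u i) cd.1 (Du a b (u i)) cd.2 (wd (u i)),
    `|cd.1| * (b - a) <= fine (\int[leb R]_(x in `]a, b[) `|u i x|%:E)%E +
      fine (total_var (Du a b (u i)) setT) * (b - a) &
    forall M, (forall x, 0 <= F x <= M) -> `|cd.2| <= M].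
  by move=> i; have [c [d Hcd]] := X_represented_bounds (uX i); exists (c, d).
have [M HM] := F_bounded.
have M0 : 0 <= M by have /andP[h1 h2] := HM 0; exact: le_trans h2.
have ba0 : 0 < b - a by rewrite subr_gt0.
have TE i : (total_var (Du a b (u i)) setT <= K%:E)%E /\ (energy a b p (wd (u i)) <= K%:E)%E.
  have := FK i; rewrite FbarE// => h; split; apply: le_trans h.
    by rewrite leeDl// energy_ge0.
  by rewrite leeDr.
have /filter_ex[i0 _] : U setT by exact: filterT.
have K0 : 0 <= K by rewrite -lee_fin; apply: le_trans (energy_ge0 _ _ _ _) (TE i0).2.
pose K1 := K / (b - a) + K + M.
have KK1 : K <= K1.
  have : 0 <= K / (b - a) by rewrite divr_ge0// ltW.
  by rewrite /K1; lra.
have Hrep i : represented a b p F (u i) (cd i).1 (Du a b (u i)) (cd i).2 (wd (u i)) by have [] := Hcd i.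
have cK i : `|(cd i).1| <= K1.
  have [_ h _] := Hcd i.
  have h1 : fine (\int[leb R]_(x in `]a, b[) `|u i x|%:E)%E <= K.
    rewrite -lee_fin fineK// ge0_fin_numE ?integral_ge0//.
    by apply: le_lt_trans (uK i) _; rewrite ltry.
  have h2 : fine (total_var (Du a b (u i)) setT) <= K.
    by rewrite -lee_fin fineK ?total_var_fin_num//; exact: (TE i).1.
  rewrite /K1 -(ler_pM2r ba0); apply: (le_trans h).
  rewrite mulrDl mulrDl mulfVK ?gt_eqF//.
  have := ler_wpM2r (ltW ba0) h2; have := mulr_ge0 M0 (ltW ba0); lra.
have dK i : `|(cd i).2| <= K1.
  have [_ _ h] := Hcd i; apply: (le_trans (h M HM)).
  have : 0 <= K / (b - a) by rewrite divr_ge0// ltW.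
  by rewrite /K1; lra.
have TK i : (total_var (Du a b (u i)) setT <= K1%:E)%E by apply: le_trans (TE i).1 _; rewrite lee_fin.
have EK i : (energy a b p (wd (u i)) <= K1%:E)%E by apply: le_trans (TE i).2 _; rewrite lee_fin.
have um i : measurable_fun `]a, b[ (u i).
  by have /integrableP[/measurable_EFinP] := X_integrable (uX i).
have [u0 [c0 [mu0 [d0 [w0 [rep0 iu0 L1 lsc Vunif]]]]]] :=
  compactness (UU := UU) ab p_gt1 F_lt Hrep cK dK TK EK um.
have [u0X DuE wE] := represented_X ab p_gt1 F_lt F_cont F_bounded iu0 rep0.
exists u0; split; [exact: u0X|exact: L1| |].
- move=> l Hl; rewrite FbarE// wE.
  (* The two charges agree on measurable sets but may come with different Hahn sets, hence two
     applications of [total_var_le]. *)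
  have tvE : total_var (Du a b u0) setT = total_var mu0 setT.
    apply/eqP; rewrite eq_le; apply/andP; split.
      apply: (@total_var_le _ (Du a b u0) (jordan_pos (hahnP mu0)) (jordan_neg (hahnP mu0))) => A mA.
      by rewrite DuE// jordanE.
    apply: (@total_var_le _ mu0 (jordan_pos (hahnP (Du a b u0))) (jordan_neg (hahnP (Du a b u0)))) => A mA.
    by rewrite -DuE// jordanE.
  rewrite tvE; apply: lsc; apply: filterS Hl => i.
  by rewrite (FbarE (uX i)) => h; exact: h.
- move=> C1u0; apply: (C1_convergence ab p_gt1 F_lt F_cont F_lower Hrep rep0 um _ L1 Vunif C1u0).
  by have /integrableP[/measurable_EFinP] := iu0.
Qed.

End limits.
End minimization.

(** * Linear calculus of integrals of essentially bounded functions *)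

Section essentially_bounded.
Context {R : realType} (a b : R).
Implicit Types f g h : R -> R.

(** An algebra containing X, the datum and the h_n, on which every integral is finite; products and
    sums then integrate without further side conditions. *)
Definition ess_bounded f := measurable_fun `]a, b[ f /\
  exists M : R, {ae leb R, forall x, x \in `]a, b[ -> `|f x| <= M}.

Local Notation S f := (\int[leb R]_(x in `]a, b[) f x).

Lemma ess_bounded_integrable f : ess_bounded f -> (leb R).-integrable `]a, b[ (EFin \o f).
Proof.
move=> [mf [M fM]].
have i1 : (leb R).-integrable `]a, b[ (EFin \o (cst 1 : R -> R)).
  exact: (integrable_bounded_itv (M := `|1|)).
have fM' : {ae leb R, forall x, x \in `]a, b[ -> `|f x| <= `|M|}.
  by apply: ae_imp fM => x h xab; apply: le_trans (h xab) (ler_norm _).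
have [i _] := ae_bounded_mul 0 (normr_ge0 M) mf fM' i1.
by apply: eq_integrable i => // x _; rewrite /= mulr1.
Qed.

Lemma ess_boundedD f g : ess_bounded f -> ess_bounded g -> ess_bounded (fun x => f x + g x).
Proof.
move=> [mf [M fM]] [mg [N gN]]; split; first exact: measurable_funD.
exists (M + N); apply: ae_imp2 fM gN => x h1 h2 xab.
by apply: le_trans (ler_normD _ _) _; apply: lerD; [exact: h1|exact: h2].
Qed.

Lemma ess_boundedM f g : ess_bounded f -> ess_bounded g -> ess_bounded (fun x => f x * g x).
Proof.
move=> [mf [M fM]] [mg [N gN]]; split; first exact: measurable_funM.
exists (M * N); apply: ae_imp2 fM gN => x h1 h2 xab.
by rewrite normrM; apply: ler_pM => //; [exact: h1|exact: h2].
Qed.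

Lemma ess_bounded_cst (c : R) : ess_bounded (fun=> c).
Proof. by split => //; exists `|c|; apply: (@aeW _ (measurableTypeR R)). Qed.

Lemma ess_boundedB f g : ess_bounded f -> ess_bounded g -> ess_bounded (fun x => f x - g x).
Proof.
move=> hf hg; have := ess_boundedD hf (ess_boundedM (ess_bounded_cst (-1)) hg).
by under eq_fun do rewrite mulN1r.
Qed.

Lemma ess_bounded_norm f : ess_bounded f -> ess_bounded (fun x => `|f x|).
Proof.
move=> [mf [M fM]]; split; first exact: measurableT_comp.
by exists M; apply: ae_imp fM => x h xab; rewrite normr_id h.
Qed.

Lemma ess_bounded_integralD f g : ess_bounded f -> ess_bounded g -> S (fun x => f x + g x) = S f + S g.
Proof. by move=> hf hg; rewrite RintegralD//; exact: ess_bounded_integrable. Qed.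

Lemma ess_bounded_integralZ (c : R) f : ess_bounded f -> S (fun x => c * f x) = c * S f.
Proof. by move=> hf; rewrite RintegralZl//; exact: ess_bounded_integrable. Qed.

Lemma ess_bounded_integral_le f g : ess_bounded f -> ess_bounded g -> (forall x, f x <= g x) -> S f <= S g.
Proof. by move=> hf hg fg; apply: le_Rintegral => //; exact: ess_bounded_integrable. Qed.

Lemma Rintegral_itv_cst (c : R) : a < b -> S (fun=> c) = c * (b - a).
Proof.
move=> ab; rewrite Rintegral_cst//; congr (_ * _).
by have := @lebesgue_measure_itv R `]a, b[ => /= ->; rewrite lte_fin ab.
Qed.

Lemma EFin_ess_bounded_integral f : ess_bounded f -> (\int[leb R]_(x in `]a, b[) (f x)%:E)%E = (S f)%:E.
Proof.
move=> hf; rewrite /Rintegral fineK//.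
exact: (integrable_fin_num _ (ess_bounded_integrable hf)).
Qed.

(** Convexity of the square: (f - h)^2 >= (g - h)^2 + 2 (g - h)(f - g), whose cross term is at most
    2 M |f - g| in absolute value. This gives lower semicontinuity of the quadratic term under L^1
    convergence to [g]. *)
Lemma sqdist_perturbation f g h (M e : R) : ess_bounded f -> ess_bounded g -> ess_bounded h -> 0 <= M ->
  {ae leb R, forall x, x \in `]a, b[ -> `|g x - h x| <= M} -> S (fun x => `|f x - g x|) <= e ->
  S (fun x => (g x - h x) ^+ 2) - 2 * M * e <= S (fun x => (f x - h x) ^+ 2).
Proof.
move=> hf hg hh M0 ghM fge.
have hgh := ess_boundedB hg hh; have hfh := ess_boundedB hf hh; have hfg := ess_boundedB hf hg.
have hgh2 := ess_boundedM hgh hgh; have hfh2 := ess_boundedM hfh hfh.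
have hc := ess_boundedM hgh hfg.
have [_ H] := ae_bounded_mul e M0 hgh.1 ghM (ess_bounded_integrable hfg).
have : `|S (fun x => (g x - h x) * (f x - g x))| <= M * e.
  by apply: H; rewrite (EFin_ess_bounded_integral (ess_bounded_norm hfg)) lee_fin.
rewrite ler_norml => /andP[h1 _].
have : S (fun x => (g x - h x) * (g x - h x) + 2 * ((g x - h x) * (f x - g x))) <=
    S (fun x => (f x - h x) * (f x - h x)).
  apply: ess_bounded_integral_le => //.
    by apply: ess_boundedD => //; apply: ess_boundedM => //; exact: ess_bounded_cst.
  move=> x; have := sqr_ge0 (f x - g x); rewrite expr2; nra.
rewrite ess_bounded_integralD//; last by apply: ess_boundedM => //; exact: ess_bounded_cst.
rewrite ess_bounded_integralZ//; under [in X in _ -> X]eq_Rintegral do rewrite expr2.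
under [in X in _ -> _ <= X]eq_Rintegral do rewrite expr2.
by move=> h2; lra.
Qed.

End essentially_bounded.

(** The trace of \oo on the bad indices is a proper filter and extends to an ultrafilter; this plays
    the part of a bad subsequence. *)
Lemma ultrafilter_frequently (bad : nat -> Prop) : ~ (\forall n \near \oo, ~ bad n) ->
  exists U : set_system nat, [/\ UltraFilter U, U bad & \oo `<=` U].
Proof.
move=> H; have PF : ProperFilter (within bad \oo).
  by split; [move=> h; apply: H; exact: h|exact: within_filter].
have [U [UU HU]] := ultraFilterLemma PF.
exists U; split => //.
  by apply: HU; apply: nearW.
by move=> A HA; apply: HU; apply: filterS HA.
Qed.

Definition Fbar_real (R : realType) (a b p : R) (psi u : R -> R) : R :=
  fine (Fbar a b p psi u).

Definition sqdist (R : realType) (a b : R) (g u : R -> R) : R :=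
  \int[leb R]_(x in `]a, b[) (u x - g x) ^+ 2.

Definition pairing (R : realType) (a b : R) (g k u : R -> R) : R :=
  \int[leb R]_(x in `]a, b[) ((u x - g x) * k x).

Lemma absorb_half (R : realType) (l x1 x2 x3 x4 x5 : R) :
  l * (2 * x2) <= l * (x1 / 2 + x5) -> x3 + l * (x1 - 2 * x2) <= x4 ->
  x3 + l * (x1 / 2) <= x4 + l * x5.
Proof. by rewrite !mulrDr mulrN; lra. Qed.

Lemma absorb_one (R : realType) (l q x e e0 : R) :
  2 * (l * x) <= 1 -> e + l * (q - 2 * x) <= e0 -> e + l * q <= e0 + 1.
Proof. rewrite mulrBr; lra. Qed.

(** The letters e, q, p stand for energy, quadratic term and pairing with h_n; the suffixes n, w, 0
    for the minimizer, the competitor and the limit. [l] is lambda, [m] bounds |u0 - g| and [d] is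
    the allowed error. *)
Lemma compare_minimizers (R : realType) (l m d q0 qn qw pn pw en ew : R) :
  l * (q0 - 2 * m * d) <= l * qn -> l * (pn - pw) <= l * d ->
  en + l * (qn - 2 * pn) <= ew + l * (qw - 2 * pw) ->
  en <= ew + l * qw + l * (2 * m + 2) * d - l * q0.
Proof. lra. Qed.

(** * Convergence of the minimizers *)

Section theorem.
Context {R : realType} (a b p : R) (psi g : R -> R) (h : nat -> R -> R).
Hypothesis ab : a < b.
Hypothesis p_gt1 : 1 < p.
Hypothesis psi_gt0 : forall t, 0 < psi t.
Hypothesis psi_meas : measurable_fun [set: R] psi.
Hypothesis psi_bounded : exists B : R, forall t, psi t <= B.
Hypothesis psi_inf : forall K : set R, compact K ->
  (0 < ereal_inf [set (psi t)%:E | t in K])%E.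
Hypothesis psi_int : (\int[leb R]_t (psi t `^ p^-1)%:E < +oo)%E.
Hypothesis gX : X a b p psi g.
Hypothesis h_Linfty : forall n, Lp a b +oo%E (h n).
Hypothesis h_to0 : weak_star_to0 a b h.

Local Notation S f := (\int[leb R]_(x in `]a, b[) f x).
Local Notation E := (Fbar_real a b p psi).
Local Notation Q := (sqdist a b g).
Local Notation P n := (pairing a b g (h n)).

Lemma X_ess_bounded u : X a b p psi u -> ess_bounded a b u.
Proof.
move=> uX; have iu := X_integrable uX.
split; first by have /integrableP[/measurable_EFinP] := iu.
have [c [d [[_ uc _ _] _ _]]] := X_represented_bounds ab p_gt1 psi_gt0 psi_meas psi_bounded psi_inf psi_int uX.
exists (`|c| + fine (total_var (Du a b u) setT)).
by apply: ae_imp uc => x H xab; rewrite H//; apply: le_trans (ler_normD _ _) _; rewrite lerD2l normr_cdf_le.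
Qed.

Let gB := X_ess_bounded gX.

Lemma h_bounded : exists B : R, 0 < B /\
  forall n, {ae leb R, forall x, x \in `]a, b[ -> `|h n x| <= B}.
Proof. exact: weak_star_bounded. Qed.

Let hB n : ess_bounded a b (h n).
Proof. by have [B [_ HB]] := h_bounded; split; [have [] := h_Linfty n|exists B]. Qed.

Lemma FbarK u : X a b p psi u -> Fbar a b p psi u = (E u)%:E.
Proof. by move=> uX; rewrite /Fbar_real fineK// Fbar_fin. Qed.

Lemma functionalE lambda f u : ess_bounded a b f -> X a b p psi u ->
  functional a b p psi lambda f u = (E u + lambda * S (fun x => (u x - f x) ^+ 2))%:E.
Proof.
move=> fB uX; rewrite /functional FbarK// EFinD EFinM; congr (_ + _ * _)%E.
have uf := ess_boundedB (X_ess_bounded uX) fB.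
rewrite -EFin_ess_bounded_integral; first by apply: eq_integral => x _; rewrite real_normK// num_real.
exact: (ess_boundedM uf uf).
Qed.

(** The last term does not depend on [u] and cancels when two competitors are compared. *)
Lemma square_expand n u : X a b p psi u ->
  S (fun x => (u x - (g \+ h n) x) ^+ 2) = Q u - 2 * P n u + S (fun x => h n x ^+ 2).
Proof.
move=> uX; have uf := ess_boundedB (X_ess_bounded uX) gB.
have ufh := ess_boundedM uf (hB n); have hh := ess_boundedM (hB n) (hB n); have uu := ess_boundedM uf uf.
have c2 := ess_boundedM (ess_bounded_cst a b (-2)) ufh.
have -> : S (fun x => (u x - (g \+ h n) x) ^+ 2) =
    S (fun x => ((u x - g x) ^+ 2 + (-2) * ((u x - g x) * h n x)) + h n x ^+ 2).
  by apply: eq_Rintegral => x _ /=; rewrite !expr2; lra.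
rewrite ess_bounded_integralD//; last exact: ess_boundedD uu c2.
by rewrite ess_bounded_integralD// ess_bounded_integralZ// mulNr.
Qed.

Lemma minimizer_le lambda n u w :
  minimizers a b p psi lambda (g \+ h n) u -> X a b p psi w ->
  E u + lambda * (Q u - 2 * P n u) <= E w + lambda * (Q w - 2 * P n w).
Proof.
move=> [uX umin] wX; have := umin w wX.
have ghB : ess_bounded a b (g \+ h n) by exact: ess_boundedD.
rewrite (functionalE lambda ghB uX) (functionalE lambda ghB wX) lee_fin.
rewrite (square_expand n uX) (square_expand n wX).
move: (Q u - _) (Q w - _) (S (fun x => h n x ^+ 2)) (E u) (E w) => x1 x2 x3 x4 x5.
by rewrite !mulrDr addrA [leRHS]addrA lerD2r.
Qed.

Lemma sqdist_datum : Q g = 0.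
Proof.
by rewrite /sqdist; under eq_Rintegral do rewrite subrr expr0n/=; rewrite Rintegral_itv_cst// mul0r.
Qed.

Lemma pairing_datum n : P n g = 0.
Proof.
by rewrite /pairing; under eq_Rintegral do rewrite subrr mul0r; rewrite Rintegral_itv_cst// mul0r.
Qed.

Lemma minimizer_le_datum lambda n u : minimizers a b p psi lambda (g \+ h n) u ->
  E u + lambda * (Q u - 2 * P n u) <= E g.
Proof.
move=> /minimizer_le /(_ gX).
have -> : Q g - 2 * P n g = 0 by rewrite sqdist_datum pairing_datum mulr0 subr0.
move: (Q u - _) (E u) (E g) => x1 x2 x3.
by rewrite mulr0 addr0.
Qed.

Lemma sqdist_ge0 u : 0 <= Q u.
Proof. by apply: Rintegral_ge0 => x _; exact: sqr_ge0. Qed.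

(** Pointwise 2 y k <= y^2 / 2 + 2 k^2: half of the quadratic term absorbs the pairing. Multiplied
    by lambda the remainder grows with lambda, so this bound is for fixed lambda. *)
Lemma pairing_le n u B : 0 < B -> X a b p psi u ->
  {ae leb R, forall x, x \in `]a, b[ -> `|h n x| <= B} ->
  2 * P n u <= Q u / 2 + 2 * B ^+ 2 * (b - a).
Proof.
move=> B0 uX HB; have uf := ess_boundedB (X_ess_bounded uX) gB.
have ufh := ess_boundedM uf (hB n); have hh := ess_boundedM (hB n) (hB n); have uu := ess_boundedM uf uf.
have : S (fun x => 2 * ((u x - g x) * h n x)) <= S (fun x => 2^-1 * (u x - g x) ^+ 2 + 2 * h n x ^+ 2).
  apply: ess_bounded_integral_le.
  - exact: ess_boundedM (ess_bounded_cst a b 2) ufh.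
  - apply: ess_boundedD; apply: ess_boundedM; do ?exact: ess_bounded_cst; [exact: uu|exact: hh].
  - by move=> x; have := sqr_ge0 (u x - g x - 2 * h n x); rewrite !expr2; nra.
rewrite ess_bounded_integralZ// ess_bounded_integralD; last 2 first.
  exact: ess_boundedM (ess_bounded_cst a b _) uu.
  exact: ess_boundedM (ess_bounded_cst a b _) hh.
rewrite ess_bounded_integralZ// ess_bounded_integralZ// => H; apply: (le_trans H).
rewrite -/(Q u) [_ / 2]mulrC lerD2l -mulrA ler_pM2l//.
have [i1 i2] := ae_bounded_mul (B * (b - a)) (ltW B0) (hB n).1 HB (ess_bounded_integrable (hB n)).
have : (\int[leb R]_(x in `]a, b[) `|h n x|%:E <= (B * (b - a))%:E)%E.
  rewrite -(Rintegral_itv_cst B ab) -(EFin_ess_bounded_integral (ess_bounded_cst a b B)).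
  apply: ae_ge0_le_integral => //.
  - by apply/measurable_EFinP; apply: measurableT_comp => //; exact: (hB n).1.
  - by move=> x _; rewrite lee_fin ltW.
move=> /i2; rewrite expr2 -mulrA; apply: le_trans.
by under eq_Rintegral do rewrite expr2; exact: ler_norm.
Qed.

(** Pointwise |u| <= |g| + |u - g|^2 + 1; this supplies the L^1 bound required by
    [X_compactness]. *)
Lemma norm_le u : X a b p psi u -> S (fun x => `|u x|) <= S (fun x => `|g x|) + Q u + (b - a).
Proof.
move=> uX; have uf := ess_boundedB (X_ess_bounded uX) gB; have uu := ess_boundedM uf uf.
have gn := ess_bounded_norm gB; have guu := ess_boundedD gn uu.
rewrite -[b - a]mul1r -Rintegral_itv_cst// -ess_bounded_integralD// -ess_bounded_integralD//; last exact: ess_bounded_cst.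
apply: ess_bounded_integral_le.
- exact: ess_bounded_norm (X_ess_bounded uX).
- exact: ess_boundedD guu (ess_bounded_cst a b 1).
move=> x; have := ler_normD (u x - g x) (g x); rewrite subrK.
have : `|u x - g x| <= (u x - g x) ^+ 2 + 1.
  by rewrite -(real_normK (num_real (u x - g x))) expr2; have := normr_ge0 (u x - g x); nra.
by lra.
Qed.

(** The alternative [u n = g] fills the indices at which no minimizer has been singled out, or none
    exists; [g] satisfies the same a priori bound, so compactness applies to the whole family. *)
Lemma sequence_limit lambda (u : nat -> R -> R) (U : set_system nat) {UU : UltraFilter U} :
  0 < lambda -> \oo `<=` U ->
  (forall n, minimizers a b p psi lambda (g \+ h n) (u n) \/ u n = g) ->
  exists u0, [/\ X a b p psi u0,
    forall e : R, 0 < e -> \forall n \near U, S (fun x => `|u n x - u0 x|) <= e,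
    forall l : R, (\forall n \near U, E (u n) <= l) -> E u0 <= l,
    C1 a b u0 -> (\forall n \near U, C1 a b (u n)) &
    forall w, X a b p psi w -> forall e : R, 0 < e ->
      \forall n \near U, `|S (fun x => (u n x - w x) * h n x)| <= e].
Proof.
move=> l0 ooU Hu; have [B [B0 HB]] := h_bounded.
have uX n : X a b p psi (u n) by case: (Hu n) => [[]|->].
pose K := E g + lambda * (2 * B ^+ 2 * (b - a)).
have uK n : E (u n) + lambda * (Q (u n) / 2) <= K.
  have B2 : 0 <= 2 * B ^+ 2 * (b - a) by rewrite mulr_ge0 ?subr_ge0 ?(ltW ab)// mulr_ge0// sqr_ge0.
  have lB2 := mulr_ge0 (ltW l0) B2.
  case: (Hu n) => [un|->]; last by rewrite sqdist_datum mul0r mulr0 addr0 /K; lra.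
  have := minimizer_le_datum un.
  have := ler_wpM2l (ltW l0) (pairing_le B0 (uX n) (HB n)); rewrite /K.
  move: (Q (u n)) (P n (u n)) (E (u n)) (E g) (2 * B ^+ 2 * (b - a)) => x1 x2 x3 x4 x5.
  exact: absorb_half.
have E0 v : 0 <= E v.
  apply: fine_ge0; apply: adde_ge0; first exact: measure_ge0.
  by apply: integral_ge0 => x _; rewrite lee_fin powR_ge0.
pose K2 := K + (S (fun x => `|g x|) + 2 * K / lambda + (b - a)).
have Q2 n : Q (u n) <= 2 * K / lambda.
  rewrite ler_pdivlMr//; have := uK n; have := E0 (u n); lra.
have K0 : 0 <= K by have := uK 0%N; have := E0 (u 0%N); have := mulr_ge0 (ltW l0) (sqdist_ge0 (u 0%N)); lra.
have Sg0 : 0 <= S (fun x => `|g x|) by apply: Rintegral_ge0.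
have K20 : 0 <= S (fun x => `|g x|) + 2 * K / lambda + (b - a).
  have b0 : 0 <= b - a by rewrite subr_ge0 ltW.
  have K0' : 0 <= 2 * K / lambda by rewrite divr_ge0 ?(ltW l0)// mulr_ge0.
  exact: addr_ge0 (addr_ge0 Sg0 K0') b0.
have FK n : (Fbar a b p psi (u n) <= K2%:E)%E.
  rewrite (FbarK (uX n)) lee_fin; apply: (@le_trans _ _ K); last by rewrite /K2 lerDl.
  apply: le_trans (uK n); rewrite lerDl; apply: mulr_ge0; first exact: ltW.
  by apply: divr_ge0 => //; exact: sqdist_ge0.
have nK n : (\int[leb R]_(x in `]a, b[) `|u n x|%:E <= K2%:E)%E.
  rewrite (EFin_ess_bounded_integral (ess_bounded_norm (X_ess_bounded (uX n)))) lee_fin.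
  apply: (le_trans (norm_le (uX n))); apply: (@le_trans _ _ (S (fun x => `|g x|) + 2 * K / lambda + (b - a))).
    by rewrite lerD2r lerD2l; exact: Q2.
  by rewrite /K2 lerDr.
have [u0 [u0X L1 lsc C1c]] := X_compactness (UU := UU) ab p_gt1 psi_gt0 psi_meas psi_bounded psi_inf psi_int uX FK nK.
have L1' (e : R) : 0 < e -> \forall n \near U, S (fun x => `|u n x - u0 x|) <= e.
  move=> e0; apply: filterS (L1 e e0) => n.
  have uu0 := ess_boundedB (X_ess_bounded (uX n)) (X_ess_bounded u0X).
  by rewrite (EFin_ess_bounded_integral (ess_bounded_norm uu0)) lee_fin.
exists u0; split; [exact: u0X|exact: L1'| | |].
- move=> l Hl; rewrite -lee_fin -(FbarK u0X); apply: lsc.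
  by apply: filterS Hl => n Hn; rewrite (FbarK (uX n)) lee_fin; exact: Hn.
- by move=> C1u0; have [] := C1c C1u0.
- move=> w wX e e0.
  have e1 : 0 < e / 2 / B by rewrite !divr_gt0.
  have e2 : 0 < e / 2 by rewrite divr_gt0.
  have iw : (leb R).-integrable `]a, b[ (EFin \o (fun x => u0 x - w x)).
    exact: ess_bounded_integrable (ess_boundedB (X_ess_bounded u0X) (X_ess_bounded wX)).
  have c : \forall n \near U, `|\int[leb R]_(x in `]a, b[) (h n x * (u0 x - w x))| <= e / 2.
    apply: ooU; have /cvgrPdist_le/(_ _ e2) := h_to0 iw.
    by apply: filterS => n; rewrite sub0r normrN.
  apply: filterS2 (L1' _ e1) c => n Hn c'.
  have uu0 := ess_boundedB (X_ess_bounded (uX n)) (X_ess_bounded u0X).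
  have u0w := ess_boundedB (X_ess_bounded u0X) (X_ess_bounded wX).
  (* L^1 convergence against the bounded h_n handles the first term, and weak-star convergence
     against the fixed function u0 - w the second. *)
  have -> : S (fun x => (u n x - w x) * h n x) = S (fun x => h n x * (u n x - u0 x) + h n x * (u0 x - w x)).
    by apply: eq_Rintegral => x _; rewrite -mulrDr addrA subrK mulrC.
  rewrite ess_bounded_integralD; [|exact: ess_boundedM (hB n) uu0|exact: ess_boundedM (hB n) u0w].
  rewrite [leRHS]splitr; apply: le_trans (ler_normD _ _) _; apply: lerD => //.
  have [_ H] := ae_bounded_mul (e / 2 / B) (ltW B0) (hB n).1 (HB n) (ess_bounded_integrable uu0).
  have -> : e / 2 = B * (e / 2 / B) by rewrite [RHS]mulrC mulfVK// gt_eqF.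
  by apply: H; rewrite (EFin_ess_bounded_integral (ess_bounded_norm uu0)) lee_fin.
Qed.

(** Uniformity over all minimizers is obtained by contradiction: picking a bad minimizer at each bad
    index and passing to the limit makes the pairing with u n - g small. *)
Lemma perturbation_small lambda (e : R) : 0 < lambda -> 0 < e ->
  \forall n \near \oo, forall u, minimizers a b p psi lambda (g \+ h n) u -> `|P n u| <= e.
Proof.
move=> l0 e0; pose bad n := exists u, minimizers a b p psi lambda (g \+ h n) u /\ e < `|P n u|.
apply: contrapT => H.
have /ultrafilter_frequently[U [UU Ubad ooU]] : ~ \forall n \near \oo, ~ bad n.
  move=> nb; apply: H; apply: filterS nb => n nbad u un.
  by rewrite leNgt; apply/negP => eP; apply: nbad; exists u.
have /choice[u Hu] : forall n, exists u, (bad n -> minimizers a b p psi lambda (g \+ h n) u /\ e < `|P n u|) /\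
    (minimizers a b p psi lambda (g \+ h n) u \/ u = g).
  move=> n; have [[u [un eu]]|nb] := pselect (bad n).
    by exists u; split => //; left.
  by exists g; split => //; right.
have [u0 [_ _ _ _ Hs]] := sequence_limit (UU := UU) l0 ooU (fun n => (Hu n).2).
have [n [bn Pn]] := filter_ex (filterI Ubad (Hs g gX e e0)).
by have [_] := (Hu n).1 bn; rewrite ltNge Pn.
Qed.

Lemma eventually_C1 lambda : 0 < lambda ->
  (forall u0, minimizers a b p psi lambda g u0 -> C1 a b u0) ->
  \forall n \near \oo, minimizers a b p psi lambda (g \+ h n) `<=` C1 a b.
Proof.
move=> l0 HC1; pose bad n := exists u, minimizers a b p psi lambda (g \+ h n) u /\ ~ C1 a b u.
apply: contrapT => H.
have /ultrafilter_frequently[U [UU Ubad ooU]] : ~ \forall n \near \oo, ~ bad n.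
  move=> nb; apply: H; apply: filterS nb => n nbad u un.
  by apply: contrapT => nC; apply: nbad; exists u.
have /choice[u Hu] : forall n, exists u, (bad n -> minimizers a b p psi lambda (g \+ h n) u /\ ~ C1 a b u) /\
    (minimizers a b p psi lambda (g \+ h n) u \/ u = g).
  move=> n; have [[u [un eu]]|nb] := pselect (bad n).
    by exists u; split => //; left.
  by exists g; split => //; right.
have uX n : X a b p psi (u n) by case: (Hu n) => _ [[]|->].
have [u0 [u0X L1 lsc C1c Hs]] := sequence_limit (UU := UU) l0 ooU (fun n => (Hu n).2).
have u0min : minimizers a b p psi lambda g u0.
  split => // w wX; rewrite (functionalE lambda gB u0X) (functionalE lambda gB wX) lee_fin -/(Q u0) -/(Q w).
  have [mu0 [M HM]] := ess_boundedB (X_ess_bounded u0X) gB.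
  have HM' : {ae leb R, forall x, x \in `]a, b[ -> `|u0 x - g x| <= `|M|}.
    by apply: ae_imp HM => x hx xab; apply: le_trans (hx xab) (ler_norm _).
  (* The errors 2 |M| d from the quadratic term and 2 d from the pairing, both multiplied by lambda,
     add up to e. *)
  apply/ler_addgt0Pr => e e0; pose d := e / (lambda * (2 * `|M| + 2)).
  have M2 : 0 < 2 * `|M| + 2 by have := normr_ge0 M; lra.
  have d0 : 0 < d by rewrite divr_gt0// mulr_gt0.
  have dE : lambda * (2 * `|M| + 2) * d = e by rewrite mulrC mulfVK// gt_eqF// mulr_gt0.
  rewrite -lerBrDr; apply: lsc; apply: filterS (filterI Ubad (filterI (L1 d d0) (Hs w wX d d0))) => n [bn [Ln Sn]].
  have [un _] := (Hu n).1 bn.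
  have unB := X_ess_bounded (uX n); have wB := X_ess_bounded wX.
  have := minimizer_le un wX.
  have := sqdist_perturbation unB (X_ess_bounded u0X) gB (normr_ge0 M) HM' Ln; rewrite -/(Q u0) -/(Q (u n)).
  have PE : P n (u n) - P n w = S (fun x => (u n x - w x) * h n x).
    have i1 := ess_boundedM (ess_boundedB unB wB) (hB n).
    have i2 := ess_boundedM (ess_boundedB wB gB) (hB n).
    have -> : P n (u n) = S (fun x => (u n x - w x) * h n x + (w x - g x) * h n x).
      by apply: eq_Rintegral => x _; rewrite -mulrDl addrA subrK.
    by rewrite ess_bounded_integralD// addrK.
  move: Sn; rewrite -PE ler_norml => /andP[_ Sn] Qn Jn.
  have h1 := ler_wpM2l (ltW l0) Qn; have h2 := ler_wpM2l (ltW l0) Sn.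
  rewrite -dE; exact: compare_minimizers h1 h2 Jn.
have [n [bn Cn]] := filter_ex (filterI Ubad (C1c (HC1 u0 u0min))).
by have [_] := (Hu n).1 bn.
Qed.

Lemma C1_representative_ae u v W dW : {ae leb R, forall x, x \in `]a, b[ -> u x = v x} ->
  C1_representative a b u W dW -> C1_representative a b v W dW.
Proof.
move=> uv [H1 H2 H3 H4]; split => //.
by apply: ae_imp2 uv H4 => x h1 h2 xab; rewrite -h1// h2.
Qed.

Lemma C1norm_ae u v : {ae leb R, forall x, x \in `]a, b[ -> u x = v x} ->
  (C1norm a b u <= C1norm a b v)%E.
Proof.
move=> uv; apply: le_ereal_inf => _ [W [dW [H ->]]]; exists W, dW; split => //.
by apply: C1_representative_ae H; apply: ae_imp uv => x uvx xab; rewrite uvx.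
Qed.

(** Weighted pointwise bound |y| <= y^2 / d + d; the weight [d] is free. *)
Lemma sqdist_controls_norm u (d : R) : 0 < d -> X a b p psi u ->
  S (fun x => `|u x - g x|) <= d^-1 * Q u + d * (b - a).
Proof.
move=> d0 uX; have uf := ess_boundedB (X_ess_bounded uX) gB; have uu := ess_boundedM uf uf.
have duu := ess_boundedM (ess_bounded_cst a b d^-1) uu.
rewrite -(Rintegral_itv_cst d ab) -(ess_bounded_integralZ d^-1 uu) -(ess_bounded_integralD duu (ess_bounded_cst a b d)).
apply: ess_bounded_integral_le; [exact: ess_bounded_norm uf|exact: ess_boundedD duu (ess_bounded_cst a b d)|].
move=> x; rewrite -(ler_pM2l d0) mulrDr mulVKf ?gt_eqF//.
rewrite -expr2 -(real_normK (num_real (u x - g x))) expr2; have := normr_ge0 (u x - g x).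
by move: `|_| => y; nra.
Qed.

(** A counterexample gives minimizers u k with parameters l k >= k + 1 that stay away from [g] in
    C^1. The bound Fbar (u k) + l k Q (u k) <= Fbar g + 1 yields compactness and Q (u k) -> 0, so
    the limit is [g]; it is C^1, and convergence in C^1 contradicts the choice of u k. *)
Lemma uniform_C1_closeness (eps : R) : C1 a b g -> 0 < eps ->
  exists2 Lambda : R, 0 < Lambda & forall lambda, Lambda <= lambda ->
    \forall n \near \oo, forall u, minimizers a b p psi lambda (g \+ h n) u ->
      (C1norm a b (u \- g)%R <= eps%:E)%E.
Proof.
move=> gC1 eps0; apply: contrapT => H.
(* For each lambda, [perturbation_small] at level 1 / (2 lambda) allows n to be taken so large that
   the last condition holds in addition. *)
have step k : exists t : R * nat * (R -> R), [/\ k.+1%:R <= t.1.1,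
    minimizers a b p psi t.1.1 (g \+ h t.1.2) t.2,
    ~ (C1norm a b (t.2 \- g)%R <= eps%:E)%E &
    2 * (t.1.1 * P t.1.2 t.2) <= 1].
  apply: contrapT => Hk; apply: H; exists k.+1%:R => // lambda kl.
  have l0 : 0 < lambda by apply: lt_le_trans kl.
  have e0 : 0 < (2 * lambda)^-1 by rewrite invr_gt0 mulr_gt0.
  apply: filterS (perturbation_small l0 e0) => n Hn u un.
  apply: contrapT => nC; apply: Hk; exists (lambda, n, u); split => //=.
  have := le_trans (ler_norm _) (Hn u un); rewrite mulrA.
  have l20 : 0 < 2 * lambda by rewrite mulr_gt0.
  by move=> /(ler_wpM2l (ltW l20)); rewrite mulfV// gt_eqF.
move: step => /choice[t Ht].
pose l k := (t k).1.1; pose m k := (t k).1.2; pose u k := (t k).2.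
have uX k : X a b p psi (u k) by have [_ []] := Ht k.
have l1 k : k.+1%:R <= l k by have [] := Ht k.
have l0 k : 0 < l k by apply: lt_le_trans (l1 k).
pose K := E g + 1.
have uK k : E (u k) + l k * Q (u k) <= K.
  have [_ un _ H1] := Ht k; have H2 := minimizer_le_datum un.
  move: H1 H2; rewrite -/(l k) -/(u k) -/(m k) /K.
  move: (l k) (P _ _) (Q _) (E _) (E g) => x1 x2 x3 x4 x5; exact: absorb_one.
have E0 v : 0 <= E v.
  apply: fine_ge0; apply: adde_ge0; first exact: measure_ge0.
  by apply: integral_ge0 => x _; rewrite lee_fin powR_ge0.
have K0 : 0 <= K by exact: addr_ge0 (E0 g) ler01.
have Qk k : k.+1%:R * Q (u k) <= K.
  apply: le_trans (uK k); apply: (@le_trans _ _ (l k * Q (u k))); last by rewrite lerDr.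
  by apply: ler_wpM2r => //; exact: sqdist_ge0.
have QK k : Q (u k) <= K.
  by apply: le_trans (Qk k); apply: ler_peMl; [exact: sqdist_ge0|rewrite ler1n].
have Sg0 : 0 <= S (fun x => `|g x|) by apply: Rintegral_ge0.
have b0 : 0 <= b - a by rewrite subr_ge0 ltW.
pose K2 := S (fun x => `|g x|) + K + (b - a).
have KK2 : K <= K2 by rewrite /K2 addrAC lerDr; exact: addr_ge0.
have FK k : (Fbar a b p psi (u k) <= K2%:E)%E.
  rewrite (FbarK (uX k)) lee_fin; apply: le_trans KK2; apply: le_trans (uK k); rewrite lerDl.
  by apply: mulr_ge0; [exact: ltW|exact: sqdist_ge0].
have nK k : (\int[leb R]_(x in `]a, b[) `|u k x|%:E <= K2%:E)%E.
  rewrite (EFin_ess_bounded_integral (ess_bounded_norm (X_ess_bounded (uX k)))) lee_fin.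
  by apply: (le_trans (norm_le (uX k))); rewrite /K2 lerD2r lerD2l.
have [U [UU ooU]] := ultraFilterLemma eventually_filter.
have [u0 [u0X L1 _ C1c]] := X_compactness (UU := UU) ab p_gt1 psi_gt0 psi_meas psi_bounded psi_inf psi_int uX FK nK.
have u0g := ess_boundedB (X_ess_bounded u0X) gB.
(* The weight [d] makes the term d (b - a) equal to e / 3; then k so large that K / (d (k + 1)) <= e
   / 3 handles the quadratic term, and the L^1 distance of u k to u0 takes the last third. *)
have dist0 : S (fun x => `|u0 x - g x|) <= 0.
  apply/ler_addgt0Pr => e e0; rewrite add0r.
  pose d := e / 3 / (b - a).
  have ba0 : 0 < b - a by rewrite subr_gt0.
  have d0 : 0 < d by rewrite !divr_gt0.
  have e30 : 0 < e / 3 by rewrite divr_gt0.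
  have [N HN] : exists N : nat, K / d / (e / 3) < N%:R.
    by exists (Num.truncn (`|K / d / (e / 3)|)).+1; apply: le_lt_trans (ler_norm _) _; exact: truncnS_gt.
  have nearN : \forall k \near U, (N <= k)%N by apply: ooU; exists N.
  have [k [Nk Lk]] := filter_ex (filterI nearN (L1 (e / 3) e30)).
  have uu0 := ess_boundedB (X_ess_bounded (uX k)) (X_ess_bounded u0X).
  have ug := ess_boundedB (X_ess_bounded (uX k)) gB.
  move: Lk; rewrite (EFin_ess_bounded_integral (ess_bounded_norm uu0)) lee_fin => Lk.
  apply: (@le_trans _ _ (S (fun x => `|u k x - u0 x| + `|u k x - g x|))).
    apply: ess_bounded_integral_le; [exact: ess_bounded_norm|by apply: ess_boundedD; exact: ess_bounded_norm|].
    by move=> x; rewrite (distrC (u k x) (u0 x)); exact: ler_distD.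
  rewrite ess_bounded_integralD; [|exact: ess_bounded_norm|exact: ess_bounded_norm].
  have h1 := sqdist_controls_norm d0 (uX k).
  have h2 : d * (b - a) = e / 3 by rewrite mulfVK// gt_eqF.
  have h3 : d^-1 * Q (u k) <= e / 3.
    have Nk' : N%:R <= k.+1%:R :> R by rewrite ler_nat ltnW.
    have k0 : 0 < k.+1%:R :> R by [].
    rewrite -(ler_pM2l k0) mulrCA; apply: (@le_trans _ _ (d^-1 * K)).
      by apply: ler_wpM2l (Qk k); rewrite invr_ge0 ltW.
    rewrite mulrC -ler_pdivrMr//; exact: ltW (lt_le_trans HN Nk').
  move: h1; rewrite h2 => h1; apply: (le_trans (lerD Lk (le_trans h1 (lerD h3 (lexx _))))).
  by move: (e) => x; lra.
have u0E : {ae leb R, forall x, x \in `]a, b[ -> u0 x = g x}.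
  have mu0 : measurable_fun `]a, b[ (EFin \o (fun x => u0 x - g x)) by apply/measurable_EFinP; exact: u0g.1.
  have := (ae_eq_integral_abs (leb R) (measurable_itvR `]a, b[) mu0).1.
  have I0 : (\int[leb R]_(x in `]a, b[) `|(EFin \o (fun x => u0 x - g x)%R) x| = 0)%E.
    apply/eqP; rewrite eq_le integral_ge0// andbT.
    by rewrite [leLHS](EFin_ess_bounded_integral (ess_bounded_norm u0g)) lee_fin.
  move=> /(_ I0); apply: ae_imp => x H1 xab.
  by have [/eqP] := H1 xab; rewrite subr_eq0 => /eqP.
have C1u0 : C1 a b u0.
  have [W [dW HW]] := gC1; exists W, dW; apply: C1_representative_ae HW.
  by apply: ae_imp u0E => x h1 xab; rewrite h1.
have [_ /(_ eps eps0) conv] := C1c C1u0.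
have [k Hk] := filter_ex conv.
have [_ _ nC _] := Ht k; apply: nC; apply: le_trans Hk.
by apply: C1norm_ae; apply: ae_imp u0E => x h1 xab; rewrite /= h1.
Qed.

End theorem.

(** * Upper limits and the final statement *)

Lemma limn_esup_ge0 (R : realType) (v : nat -> \bar R) :
  (forall n, 0 <= v n)%E -> (0 <= limn_esup v)%E.
Proof.
move=> v0; apply: le_ereal_inf_tmp => _ [A [N _ AN] <-].
apply: (@le_trans _ _ (v N)) => //; apply: ereal_sup_ubound; exists N => //.
exact: AN (leqnn N).
Qed.

Lemma limn_esup_le (R : realType) (v : nat -> \bar R) (e : \bar R) :
  (\forall n \near \oo, (v n <= e)%E) -> (limn_esup v <= e)%E.
Proof.
move=> ve; apply: (@le_trans _ _ (ereal_sup (v @` [set n | (v n <= e)%E]))).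
  by apply: ereal_inf_lbound; exists [set n | (v n <= e)%E].
by apply: ge_ereal_sup => _ [n vn <-].
Qed.

Theorem theorem4p8 (R : realType) (a b p : R) (psi : R -> R)
    (g : R -> R) (h : nat -> R -> R) (lambdabar : R)
    (hab : a < b) (hp : 1 < p)
    (psi_gt0 : forall t, 0 < psi t)
    (psi_meas : measurable_fun [set: R] psi)
    (psi_bounded : exists B : R, forall t, psi t <= B)
    (psi_inf : forall K : set R, compact K ->
       (0 < ereal_inf [set (psi t)%:E | t in K])%E)
    (psi_int : (\int[leb R]_t (psi t `^ p^-1)%:E < +oo)%E)
    (gC1 : C1 a b g) (gX : X a b p psi g)
    (h_Linfty : forall n, Lp a b +oo%E (h n))
    (h_to0 : weak_star_to0 a b h)
    (lambdabar_gt0 : 0 < lambdabar)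
    (lambdabarP :
       let C := maxe (C1norm a b g) (Fbar a b p psi g) in
       forall gt : R -> R, C1 a b gt -> X a b p psi gt ->
         (C1norm a b gt <= C)%E -> (Fbar a b p psi gt <= C)%E ->
         forall lambda : R, lambdabar <= lambda ->
           minimizers a b p psi lambda gt `<=` C1 a b) :
  let A (lambda : R) (n : nat) := minimizers a b p psi lambda (g \+ h n) in
  (forall lambda : R, lambdabar <= lambda ->
     \forall n \near \oo, A lambda n `<=` C1 a b) /\
  limn_esup (fun n => nonneg_sup [set C1norm a b (u \- g) | u in A lambda n])
    @[lambda --> +oo] --> (0 : \bar R)%E.
Proof.
split=> [lambda ll|].
  apply: (eventually_C1 hab hp psi_gt0 psi_meas psi_bounded psi_inf psi_int gX h_Linfty h_to0).
    exact: lt_le_trans ll.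
  (* The property of [lambdabar] is applied to [g] itself, whose norm and energy are at most their
     maximum C. *)
  by move=> u0; apply: (lambdabarP g gC1 gX _ _ lambda ll); rewrite le_max lexx ?orbT.
pose A lambda n := minimizers a b p psi lambda (g \+ h n).
pose f lambda := limn_esup (fun n => nonneg_sup [set C1norm a b (u \- g) | u in A lambda n]).
have f0 lambda : (0 <= f lambda)%E.
  by apply: limn_esup_ge0 => n; apply: ereal_sup_ubound; left.
have fe (e : R) : 0 < e -> \forall lambda \near +oo%R, (f lambda <= e%:E)%E.
  move=> e0; have [L L0 HL] := uniform_C1_closeness hab hp psi_gt0 psi_meas psi_bounded psi_inf psi_int gX h_Linfty h_to0 gC1 e0.
  apply: filterS (nbhs_pinfty_ge (num_real L)) => lambda Ll.
  apply: limn_esup_le; apply: filterS (HL lambda Ll) => n Hn.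
  (* The first case is the element 0 adjoined by [nonneg_sup], which settles an empty class of
     minimizers. *)
  apply: ge_ereal_sup => _ [->|[u un <-]]; first by rewrite lee_fin ltW.
  exact: Hn.
apply/fine_cvgP; split.
  apply: filterS (fe 1 ltr01) => lambda f1.
  rewrite -/(f lambda) ge0_fin_numE//; apply: le_lt_trans f1 _; exact: ltry.
apply/cvgrPdist_le => e e0; apply: filterS (fe e e0) => lambda fl.
rewrite sub0r normrN -[X in `|X|]/(fine (f lambda)) ger0_norm; last exact: fine_ge0.
rewrite -lee_fin fineK// ge0_fin_numE//; apply: le_lt_trans fl _; exact: ltry.
Qed.
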